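(* Let $\alpha>1$ and let $\boldsymbol{\gamma}=(\gamma_j)_{j\ge1}$ be a sequence of weights with $1\ge\gamma_1\ge\gamma_2\ge\cdots>0$. Put $s_{\boldsymbol{\gamma}}:=\inf\{\kappa>0:\sum_{j=1}^\infty\gamma_j^\kappa<\infty\}$. Consider $L_2$-approximation $\mathrm{APP}=(\mathrm{APP}_s)_{s\ge1}$ for the weighted Hermite spaces $\mathcal{H}_R$, where $R$ is any one of $r_{s,\alpha,\boldsymbol{\gamma}},\ \rho_{s,\alpha,\boldsymbol{\gamma}},\ \psi_{s,\alpha,\boldsymbol{\gamma}}$ (with $\alpha\in\mathbb{N}$ in the case of $\psi_{s,\alpha,\boldsymbol{\gamma}}$), $s\in\mathbb{N}$, and for the information class $\Lambda^{\mathrm{std}}$. Then the following sufficient conditions hold: 1. SPT holds if $\sum_{j=1}^\infty\gamma_j<\infty$. In this case the exponent of SPT satisfies $\tau^*(\Lambda^{\mathrm{std}})=2\max\left(\frac1\alpha,s_{\boldsymbol{\gamma}}\right)$. 2. PT holds if $\limsup_{s\to\infty}\frac1{\ln s}\sum_{j=1}^s\gamma_j<\infty$. 3. WT holds if $\lim_{s\to\infty}\frac1s\sum_{j=1}^s\gamma_j=0$. 4. For $\sigma\in(0,1]$ (and every $\tau>0$), $(\sigma,\tau)$-WT holds if $\lim_{s\to\infty}\frac1{s^\sigma}\sum_{j=1}^s\gamma_j=0$. 5. UWT holds if $\lim_{s\to\infty}\frac1{s^\sigma}\sum_{j=1}^s\gamma_j=0$ for all $\sigma\in(0,1]$.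
   Context: Hermite polynomials: for $k\in\mathbb{N}_0$, $H_k(x)=\frac{(-1)^k}{\sqrt{k!}}e^{x^2/2}\frac{d^k}{dx^k}e^{-x^2/2}$; for $\boldsymbol{k}\in\mathbb{N}_0^s$, $H_{\boldsymbol{k}}(\boldsymbol{x})=\prod_{j=1}^sH_{k_j}(x_j)$. Let $\varphi(x)=\frac1{\sqrt{2\pi}}e^{-x^2/2}$, $\varphi_s(\boldsymbol{x})=\prod_{j=1}^s\varphi(x_j)$. The $H_{\boldsymbol{k}}$ form an orthonormal basis of $L_2(\mathbb{R}^s,\varphi_s)$ (all functions real-valued); $\widehat f(\boldsymbol{k})=\int_{\mathbb{R}^s}fH_{\boldsymbol{k}}\varphi_s\,d\boldsymbol{x}$. For $R:\mathbb{N}_0^s\to(0,\infty)$ (such that the kernel series converges absolutely), $\mathcal{H}_R$ is the reproducing kernel Hilbert space on $\mathbb{R}^s$ with kernel $K_R(\boldsymbol{x},\boldsymbol{y})=\sum_{\boldsymbol{k}\in\mathbb{N}_0^s}R(\boldsymbol{k})H_{\boldsymbol{k}}(\boldsymbol{x})H_{\boldsymbol{k}}(\boldsymbol{y})$ and inner product $\langle f,g\rangle_R=\sum_{\boldsymbol{k}}\frac1{R(\boldsymbol{k})}\widehat f(\boldsymbol{k})\widehat g(\boldsymbol{k})$; it consists of the functions $f=\sum_{\boldsymbol{k}}\widehat f(\boldsymbol{k})H_{\boldsymbol{k}}$ (pointwise) of finite norm. Fourier weights, for $\gamma\in(0,1]$: (r) $r_{\alpha,\gamma}(0)=1$, $r_{\alpha,\gamma}(k)=\gamma\frac1{k!}$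 for $1\le k<\alpha$, $r_{\alpha,\gamma}(k)=\gamma\frac{(k-\alpha)!}{k!}$ for $k\ge\alpha$, where $(k-\alpha)!$ means $\Gamma(k-\alpha+1)$ if $\alpha$ is not an integer; ($\rho$) $\rho_{\alpha,\gamma}(0)=1$, $\rho_{\alpha,\gamma}(k)=\gamma k^{-\alpha}$ for $k\ge1$; ($\psi$, for $\alpha\in\mathbb{N}$) $\psi_{\alpha,\gamma}(k)=\left(1+\frac1\gamma\sum_{\tau=1}^{\alpha}\beta_\tau(k)\right)^{-1}$ with $\beta_\tau(k)=\frac{k!}{(k-\tau)!}$ if $k\ge\tau$ and $\beta_\tau(k)=0$ otherwise. In each case the $s$-dimensional weight is the product, e.g. $r_{s,\alpha,\boldsymbol{\gamma}}(\boldsymbol{k})=\prod_{j=1}^sr_{\alpha,\gamma_j}(k_j)$, and likewise $\rho_{s,\alpha,\boldsymbol{\gamma}}$, $\psi_{s,\alpha,\boldsymbol{\gamma}}$. Approximation: $\mathrm{APP}_s:\mathcal{H}_R\to L_2(\mathbb{R}^s,\varphi_s)$, $\mathrm{APP}_s(f)=f$. For the class $\Lambda^{\mathrm{std}}$ of point evaluations, algorithms have the form $A_n(f)=\sum_{i=1}^nf(\boldsymbol{x}_i)g_i$ with $\boldsymbol{x}_i\in\mathbb{R}^s$, $g_i\in L_2(\mathbb{R}^s,\varphi_s)$. The worst-case error of $A_n$ is $\sup_{\|f\|_R\le1}\|f-A_n(f)\|_{L_2(\mathbb{R}^s,\varphi_s)}$, $e(n,\mathrm{APP}_s;\Lambda^{\mathrm{std}})$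 is the infimum of these errors over all such $A_n$ (for $n=0$ only the zero algorithm, with error $1$), and $n(\varepsilon,s):=\min\{n\in\mathbb{N}_0:e(n,\mathrm{APP}_s;\Lambda^{\mathrm{std}})\le\varepsilon\}$ for $\varepsilon\in(0,1)$, $s\in\mathbb{N}$. Tractability notions ($\log=\ln$): PT: there are $\tau,\sigma,C\ge0$ with $n(\varepsilon,s)\le C\varepsilon^{-\tau}s^\sigma$ for all $s\in\mathbb{N},\varepsilon\in(0,1)$. SPT: there are $\tau,C\ge0$ with $n(\varepsilon,s)\le C\varepsilon^{-\tau}$ for all $s\in\mathbb{N},\varepsilon\in(0,1)$; the exponent of SPT is the infimum of all $\tau$ for which such a $C>0$ exists. $(\sigma,\tau)$-WT (for given $\sigma,\tau>0$): $\lim_{s+\varepsilon^{-1}\to\infty}\frac{\log n(\varepsilon,s)}{s^\sigma+\varepsilon^{-\tau}}=0$. WT: $(1,1)$-WT. UWT: $(\sigma,\tau)$-WT for all $\sigma,\tau\in(0,1]$. *)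

(* Defs.v *)
(* MathComp-Analysis; the reals are an arbitrary realType R. *)
From HB Require Import structures.
From mathcomp Require Import all_boot all_order all_algebra.
From mathcomp Require Import all_classical all_reals all_analysis.

Set Implicit Arguments.
Unset Strict Implicit.
Unset Printing Implicit Defensive.

Import Order.TTheory GRing.Theory Num.Theory.
Import numFieldNormedType.Exports.

Local Open Scope classical_set_scope.
Local Open Scope ring_scope.

Notation Rvec R s := (s.-tuple (measurableTypeR R)).

Section lebesgue_cons.
Context (R : realType) (n : nat).
Variable mu : {sigma_finite_measure set (Rvec R n) -> \bar R}.

Let consp (p : measurableTypeR R * Rvec R n) : Rvec R n.+1 := [tuple of p.1 :: p.2].

Let measurable_consp : measurable_fun setT consp.
Proof. exact: measurable_cons. Qed.

(* The product of Lebesgue measure on R with mu, carried over to R^(n+1). *)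
Definition lebesgue_cons : set (Rvec R n.+1) -> \bar R :=
  fun A => (@lebesgue_measure R \x mu)%E (consp @^-1` A).

Let lebesgue_cons0 : lebesgue_cons set0 = 0%E.
Proof. by rewrite /lebesgue_cons preimage_set0 measure0. Qed.

Let lebesgue_cons_ge0 A : (0 <= lebesgue_cons A)%E.
Proof. exact: measure_ge0. Qed.

Let lebesgue_cons_sigma_additive : semi_sigma_additive lebesgue_cons.
Proof.
move=> F mF tF mUF; rewrite /lebesgue_cons preimage_bigcup.
apply: measure_semi_sigma_additive.
- by move=> k; rewrite -[X in measurable X]setTI; exact: measurable_consp.
- apply/trivIsetP => i j _ _ ij; rewrite -preimage_setI.
  by move/trivIsetP : tF => ->//; rewrite preimage_set0.
- by rewrite -preimage_bigcup -[X in measurable X]setTI; exact: measurable_consp.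
Qed.

HB.instance Definition _ := isMeasure.Build _ _ _ lebesgue_cons
  lebesgue_cons0 lebesgue_cons_ge0 lebesgue_cons_sigma_additive.

Let lebesgue_cons_sigma_finite : sigma_finite setT lebesgue_cons.
Proof.
have /sigma_finiteP[F [TF ndF Foo]] := sigma_finiteT (@lebesgue_measure R).
have /sigma_finiteP[G [TG ndG Goo]] := sigma_finiteT mu.
pose split (t : Rvec R n.+1) : measurableTypeR R * Rvec R n :=
  (thead t, [tuple of behead t]).
have msplit : measurable_fun setT split.
  by apply: measurable_fun_pair; [exact: measurable_tnth|exact: measurable_behead].
have splitK p : split (consp p) = p.
  case: p => x y; rewrite /split/= theadE; congr pair.
  exact/val_inj.
exists (fun k => split @^-1` (F k `*` G k)).
  rewrite -preimage_bigcup -(preimage_setT split) -setXTT TF TG; congr preimage.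
  apply/seteqP; split=> -[x y].
    move=> [/= [i _ Fix] [j _ Gjy]]; exists (maxn i j) => //; split => /=.
      by move: x Fix; exact/subsetPset/ndF/leq_maxl.
    by move: y Gjy; exact/subsetPset/ndG/leq_maxr.
  by move=> [i _ []/= ? ?]; split; exists i.
move=> k; have [mF Fkoo] := Foo k; have [mG Gkoo] := Goo k; split.
  by rewrite -[X in measurable X]setTI; apply: msplit => //; exact: measurableX.
rewrite /lebesgue_cons (_ : _ @^-1` _ = F k `*` G k); last first.
  by rewrite -comp_preimage (_ : split \o consp = id)//; apply/funext.
by rewrite product_measure1E// lte_mul_pinfty// ge0_fin_numE.
Qed.

HB.instance Definition _ := Measure_isSigmaFinite.Build _ _ _ lebesgue_cons
  lebesgue_cons_sigma_finite.

End lebesgue_cons.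

(* s-dimensional Lebesgue measure; R^0 is a single point of mass 1. *)
Fixpoint lebesgueRs (R : realType) (s : nat) :
    {sigma_finite_measure set (Rvec R s) -> \bar R} :=
  match s with
  | 0 => \d_([tuple] : Rvec R 0)
  | n.+1 => lebesgue_cons (lebesgueRs R n)
  end.

Section hermite_spaces.
Context {R : realType}.

Definition hermite (k : nat) (x : R) : R :=
  (-1) ^+ k / Num.sqrt k`!%:R * expR (x ^+ 2 / 2) *
  derive1n k (fun t : R => expR (- (t ^+ 2 / 2))) x.

Definition gauss (x : R) : R := (Num.sqrt (2 * pi))^-1 * expR (- (x ^+ 2 / 2)).

Context {s : nat}.
Implicit Types (k : s.-tuple nat) (x : Rvec R s) (f : Rvec R s -> R).

Definition mhermite k x : R := \prod_(j < s) hermite (tnth k j) (tnth x j).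

Definition mgauss x : R := \prod_(j < s) gauss (tnth x j).

Definition L2norm f : \bar R :=
  (poweR (\int[lebesgueRs R s]_x (f x ^+ 2 * mgauss x)%:E) 2^-1)%E.

Definition L2fun f := measurable_fun setT f /\ (L2norm f < +oo)%E.

Definition hcoef f k : R :=
  (\int[lebesgueRs R s]_x (f x * mhermite k x * mgauss x))%R.

(* l is the sum of the absolutely convergent family a over all multi-indices. *)
Definition abs_sum (a : s.-tuple nat -> R) (l : R) :=
  summable setT (EFin \o a) /\
  (\esum_(k in setT) (EFin \o a)^\+ k - \esum_(k in setT) (EFin \o a)^\- k
    = l%:E)%E.

(* The square root of <f,f>_R = \sum_k R(k)^-1 fhat(k) fhat(k). *)
Definition Hnorm (Rw : s.-tuple nat -> R) f : \bar R :=
  (poweR (\esum_(k in setT) ((Rw k)^-1 * (hcoef f k * hcoef f k))%:E) 2^-1)%E.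

(* The reproducing kernel Hilbert space with kernel
   \sum_k R(k) H_k(x) H_k(y): functions, not classes, that are everywhere equal
   to the sum of their Hermite series. *)
Definition Hspace (Rw : s.-tuple nat -> R) : set (Rvec R s -> R) :=
  [set f | [/\ L2fun f,
               (Hnorm Rw f < +oo)%E &
               forall x, abs_sum (fun k => hcoef f k * mhermite k x) (f x)]].

Definition std_alg n (x : 'I_n -> Rvec R s) (g : 'I_n -> Rvec R s -> R) f :
    Rvec R s -> R :=
  fun y => \sum_(i < n) f (x i) * g i y.

Definition wc_error (Rw : s.-tuple nat -> R) n
    (x : 'I_n -> Rvec R s) (g : 'I_n -> Rvec R s -> R) : \bar R :=
  ereal_sup [set L2norm (f \- std_alg x g f) | f in
              [set f | Hspace Rw f /\ (Hnorm Rw f <= 1)%E]].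

Definition min_error (Rw : s.-tuple nat -> R) (n : nat) : \bar R :=
  ereal_inf [set e | exists x : 'I_n -> Rvec R s,
                     exists g : 'I_n -> Rvec R s -> R,
                       (forall i, L2fun (g i)) /\ e = wc_error Rw x g].

(* The least n with min_error n <= eps, as an extended real: +oo if none exists. *)
Definition inf_compl (Rw : s.-tuple nat -> R) (eps : R) : \bar R :=
  ereal_inf [set n%:R%:E | n in [set n | (min_error Rw n <= eps%:E)%E]].

End hermite_spaces.

Section weights.
Context {R : realType}.

Definition Gamma (x : R) : R :=
  (\int[@lebesgue_measure R]_(t in `]0, +oo[) (t `^ (x - 1) * expR (- t)))%R.

(* x!, read as Gamma(x+1) when x is not a natural number. *)
Definition gen_fact (x : R) : R :=
  if x \is a Num.nat then (Num.truncn x)`!%:R else Gamma (x + 1).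

Definition r_weight (alpha gamma : R) (k : nat) : R :=
  if k == 0%N then 1
  else if k%:R < alpha then gamma * (k`!%:R)^-1
  else gamma * (gen_fact (k%:R - alpha) / k`!%:R).

Definition rho_weight (alpha gamma : R) (k : nat) : R :=
  if k == 0%N then 1 else gamma * k%:R `^ (- alpha).

Definition beta_coef (tau k : nat) : R :=
  if (tau <= k)%N then k`!%:R / (k - tau)`!%:R else 0.

Definition psi_weight (a : nat) (gamma : R) (k : nat) : R :=
  (1 + gamma^-1 * \sum_(1 <= tau < a.+1) beta_coef tau k)^-1.

Variant fourier_weight (alpha : R) : (R -> nat -> R) -> Prop :=
| FourierR : fourier_weight alpha (r_weight alpha)
| FourierRho : fourier_weight alpha (rho_weight alpha)
| FourierPsi (a : nat) : alpha = a%:R -> fourier_weight alpha (psi_weight a).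

(* gamma is indexed from 0: gamma j is the weight of the (j+1)-st coordinate. *)
Definition prod_weight (w : R -> nat -> R) (gamma : nat -> R) (s : nat)
    (k : s.-tuple nat) : R :=
  \prod_(j < s) w (gamma j) (tnth k j).

Definition s_gamma (gamma : nat -> R) : \bar R :=
  ereal_inf [set kappa%:E | kappa in
    [set kappa : R | 0 < kappa /\
       (\sum_(0 <= j <oo) (gamma j `^ kappa)%:E < +oo)%E]].

End weights.

Section tractability.
Context {R : realType}.
(* N eps s is the information complexity n(eps, s). *)
Implicit Types N : R -> nat -> \bar R.

Definition PT N := exists tau sigma C : R,
  [/\ 0 <= tau, 0 <= sigma, 0 <= C &
   forall (s : nat) (eps : R), (0 < s)%N -> 0 < eps < 1 ->
     (N eps s <= (C * eps `^ (- tau) * s%:R `^ sigma)%:E)%E].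

Definition SPT_bound N (tau C : R) :=
  forall (s : nat) (eps : R), (0 < s)%N -> 0 < eps < 1 ->
    (N eps s <= (C * eps `^ (- tau))%:E)%E.

Definition SPT N := exists tau C : R, [/\ 0 <= tau, 0 <= C & SPT_bound N tau C].

Definition SPT_exponent N : \bar R :=
  ereal_inf [set tau%:E | tau in
    [set tau : R | 0 <= tau /\ exists2 C : R, 0 < C & SPT_bound N tau C]].

(* The filter "s + 1/eps --> +oo" on pairs (s, eps), s >= 1 and eps in (0,1). *)
Definition seps_infty : set_system (nat * R) :=
  filter_from setT (fun M : R =>
    [set p | [/\ (0 < p.1)%N, 0 < p.2 < 1 & M <= p.1%:R + p.2^-1]]).

Definition stWT N (sigma tau : R) :=
  (fun p : nat * R =>
     lne (N p.2 p.1) * ((p.1%:R `^ sigma + p.2 `^ (- tau))^-1)%:E)%E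
  @ seps_infty --> 0%E.

Definition WT N := stWT N 1 1.

Definition UWT N := forall sigma tau : R,
  0 < sigma <= 1 -> 0 < tau <= 1 -> stWT N sigma tau.

End tractability.

(* Main.v *)
(* Upper bound.  Put t = eps^2 / 74 and let sum_k min (R k) t <= a * t.  The
   barrier method of Batson, Spielman and Srivastava selects n >= 8 a points
   x_i and weights c_i such that sum_i c_i v(x_i) v(x_i)^T dominates
   (n/4 - a) times the identity, where v collects the H_k with R k > t, while
   the operator norm of the same weighted sum for the features
   sqrt (min (R k) t) H_k is at most (a + n) t.  Only second moments enter, that
   is, the orthonormality of the H_k.  Weighted least squares on the span of
   the H_k with R k > t then has squared worst-case error at most 74 t.  Since
   min (R k) t <= (R k)^p t^(1-p) for p <= 1, this gives
   n(eps, s) <= C (sum_k (R k)^p) eps^(-2p), and the product structure turns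
   sum_k (R k)^p into a product of factors 1 + Z (gamma_j)^p, provided that
   p alpha > 1.  The choice p = 1 settles tractability, and p close to
   max (1/alpha) s_gamma settles the exponent.

   Lower bound.  If R k >= rho > eps^2 for n + 1 multi-indices k, then some
   nonzero combination of these H_k vanishes at any given n points.  One
   variable gives the exponent 2/alpha, and the multi-indices of total degree
   one give 2 s_gamma. *)
Require Import Defs.
From HB Require Import structures.
From mathcomp Require Import all_boot all_order all_algebra.
From mathcomp Require Import all_classical all_reals all_analysis.
From mathcomp Require Import measurable_realfun.
From mathcomp Require Import ring lra.

Set Implicit Arguments.
Unset Strict Implicit.
Unset Printing Implicit Defensive.

Import Order.TTheory GRing.Theory Num.Theory.
Import numFieldNormedType.Exports.

Local Open Scope classical_set_scope.
Local Open Scope ring_scope.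

(** * Positive definite matrices and barrier steps *)

Section posdef.
Context {R : realFieldType}.

(** The barrier method lives on finite matrices, while infinitely many features lie outside any of
    them. Beyond a cutoff chosen so that the remaining R k sum to at most t / 2, only the diagonal
    of the kernel is kept, and it becomes a third requirement on each selected point, next to the
    two barriers. A point meeting all three exists by averaging: the form that measures progress of
    the lower barrier has mean at least 3, the one that measures the cost at the upper barrier has
    mean at most 2, and the tail costs at most 1/2 on average. This tail is measured by the sum of R
    k itself, so R must be summable even when the count of points is controlled by a power p < 1.
    The constant 74 is 4 + 2 + 68. The error consists of the features with R k <= t below the
    cutoff, the tail, and the response of least squares to these two; their squared L2 norms are at
    most t, t / 2 and 34 t and enter with the factors 4, 4 and 2. *)

Definition qform n (A : 'M[R]_n) (v : 'cV[R]_n) : R := (v^T *m A *m v) 0 0.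

Definition posdef n (A : 'M[R]_n) : Prop :=
  A^T = A /\ forall v, v != 0 -> 0 < qform A v.

Lemma qformE n (A : 'M[R]_n) v : qform A v = \tr (A *m (v *m v^T)).
Proof.
by rewrite /qform mulmxA mxtrace_mulC mulmxA /mxtrace big_ord_recl big_ord0 addr0.
Qed.

Lemma qform_sum n (A : 'M[R]_n) v :
  qform A v = \sum_i \sum_j A i j * (v i 0 * v j 0).
Proof.
rewrite qformE /mxtrace; apply: eq_bigr => i _; rewrite mxE.
by apply: eq_bigr => j _; rewrite !mxE big_ord1 mxE (mulrC (v j 0)).
Qed.

Lemma qformD n (A B : 'M[R]_n) v : qform (A + B) v = qform A v + qform B v.
Proof. by rewrite !qformE mulmxDl mxtraceD. Qed.

Lemma qformN n (A : 'M[R]_n) v : qform (- A) v = - qform A v.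
Proof. by rewrite -scaleN1r !qformE -scalemxAl mxtraceZ mulN1r. Qed.

Lemma qformZ n a (A : 'M[R]_n) v : qform (a *: A) v = a * qform A v.
Proof. by rewrite !qformE -scalemxAl mxtraceZ. Qed.

Lemma qform_scalar n a (v : 'cV[R]_n) : qform a%:M v = a * qform 1%:M v.
Proof. by rewrite -(scalemx1 _ a) qformZ. Qed.

Lemma qform1 n (v : 'cV[R]_n) : qform 1%:M v = \sum_i v i 0 ^+ 2.
Proof.
rewrite /qform mulmx1 mxE; apply: eq_bigr => i _; by rewrite mxE expr2.
Qed.

Lemma qform1_ge0 n (v : 'cV[R]_n) : 0 <= qform 1%:M v.
Proof. by rewrite qform1 sumr_ge0// => i _; rewrite sqr_ge0. Qed.

Lemma qform1_gt0 n (v : 'cV[R]_n) : v != 0 -> 0 < qform 1%:M v.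
Proof.
move=> v0; rewrite lt_neqAle qform1_ge0 andbT eq_sym; apply: contra v0.
rewrite qform1 psumr_eq0; last by move=> i _; rewrite sqr_ge0.
move/allP => h; apply/eqP/matrixP => i j; rewrite ord1 mxE.
by have := h i (mem_index_enum i); rewrite /= sqrf_eq0 => /eqP.
Qed.

Lemma qform_outer n (u v : 'cV[R]_n) : qform (u *m u^T) v = ((u^T *m v) 0 0) ^+ 2.
Proof.
rewrite /qform mulmxA -mulmxA mxE big_ord1 expr2; congr (_ * _).
have -> : v^T *m u = (u^T *m v)^T by rewrite trmx_mul trmxK.
by rewrite mxE.
Qed.

Lemma qform_conj n (A B : 'M[R]_n) v :
  qform (B^T *m A *m B) v = qform A (B *m v).
Proof. by rewrite /qform trmx_mul !mulmxA. Qed.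

Lemma posdef_ge0 n (A : 'M[R]_n) v : posdef A -> 0 <= qform A v.
Proof.
case=> _ pA; have [->|/pA/ltW//] := eqVneq v 0.
by rewrite /qform mulmx0 mxE.
Qed.

Lemma posdef_unit n (A : 'M[R]_n) : posdef A -> A \in unitmx.
Proof.
move=> [sA pA]; rewrite -row_free_unit -kermx_eq0; apply/negPn/negP.
rewrite -submx0 => /rV_subP h; apply: h => v /sub_kermxP vA.
apply/negPn/negP; rewrite submx0 => v0.
have /pA : v^T != 0 by rewrite trmx_eq0.
by rewrite /qform trmxK vA mul0mx mxE ltxx.
Qed.

Lemma posdef_inv n (A : 'M[R]_n) : posdef A -> posdef (invmx A).
Proof.
move=> pA; have uA := posdef_unit pA; case: (pA) => sA pA'.
have sI : (invmx A)^T = invmx A by rewrite trmx_inv sA.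
split => // v v0.
have -> : qform (invmx A) v = qform A (invmx A *m v).
  by rewrite -qform_conj sI (mulVmx uA) mul1mx.
apply: pA'; apply: contra v0 => /eqP h; apply/eqP.
by rewrite -(mulKVmx uA v) h mulmx0.
Qed.

Lemma tr_conj_ge0 n (A B : 'M[R]_n) : posdef A -> 0 <= \tr (B^T *m A *m B).
Proof.
move=> pA; apply: sumr_ge0 => i _.
have := posdef_ge0 (col i B) pA; rewrite colE -qform_conj /qform trmx_delta.
by rewrite -rowE -colE mxE mxE.
Qed.

Lemma tr_conj_sym_ge0 n (A B : 'M[R]_n) : posdef A -> B^T = B ->
  0 <= \tr (B *m A *m B).
Proof. by move=> pA {1}<-; exact: tr_conj_ge0. Qed.

(** The largest eigenvalue is at most the trace. Spectral theory is avoided: [P] is q times the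
    projection onto the complement of v, so P P = q P, and tr (P Z P) >= 0 becomes tr (P Z) >= 0,
    which is the claim. *)
Lemma posdef_tr_ge n (Z : 'M[R]_n) v : posdef Z ->
  qform Z v <= \tr Z * qform 1%:M v.
Proof.
move=> pZ; have [->|v0] := eqVneq v 0.
  by rewrite /qform !mulmx0 mxE mulr0.
have q0 := qform1_gt0 v0; set q := qform _ v in q0 *.
pose P := q%:M - v *m v^T.
have vv : v^T *m v = q%:M by rewrite /q /qform mulmx1 -mx11_scalar.
have PP : P *m P = q *: P.
  rewrite /P mulmxBl mul_scalar_mx mulmxBr mul_mx_scalar.
  have -> : v *m v^T *m (v *m v^T) = q *: (v *m v^T).
    by rewrite !mulmxA -(mulmxA v) vv mul_mx_scalar -scalemxAl.
  by rewrite subrr subr0.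
have sP : P^T = P by rewrite /P linearB/= tr_scalar_mx trmx_mul trmxK.
have := tr_conj_sym_ge0 pZ sP.
rewrite mxtrace_mulC mulmxA PP -scalemxAl mxtraceZ pmulr_rge0//.
by rewrite /P mulmxBl linearB/= mul_scalar_mx mxtraceZ mxtrace_mulC -qformE subr_ge0 mulrC.
Qed.

(** Cauchy-Schwarz between the norms of A and of its inverse. The A-form is evaluated at w minus its
    A-orthogonal projection on A^-1 v, scaled by [b] to avoid a division. *)
Lemma posdef_cauchy n (A : 'M[R]_n) (v w : 'cV[R]_n) : posdef A ->
  ((v^T *m w) 0 0) ^+ 2 <= qform A w * qform (invmx A) v.
Proof.
move=> pA; have uA := posdef_unit pA; have [sA _] := pA.
have sI : (invmx A)^T = invmx A by rewrite trmx_inv sA.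
have [->|v0] := eqVneq v 0.
  by rewrite /qform trmx0 mul0mx mulmx0 !mxE expr2 !mulr0.
have b0 : 0 < qform (invmx A) v by apply: (posdef_inv pA).2.
set q := (v^T *m w) 0 0.
have := posdef_ge0 (qform (invmx A) v *: w - q *: (invmx A *m v)) pA.
set b := qform (invmx A) v in b0 *; set a := qform A w.
have -> : qform A (b *: w - q *: (invmx A *m v)) = b * (b * a - q ^+ 2).
  have e1 : v^T *m w = q%:M by rewrite -mx11_scalar.
  have e1' : w^T *m v = q%:M by rewrite -(trmxK (w^T *m v)) trmx_mul trmxK e1 tr_scalar_mx.
  have e2 : v^T *m invmx A *m v = b%:M by rewrite -mx11_scalar.
  have e3 : w^T *m (A *m w) = a%:M by rewrite mulmxA -mx11_scalar.
  have Aw : A *m (b *: w - q *: (invmx A *m v)) = b *: (A *m w) - q *: v.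
    by rewrite mulmxBr -!scalemxAr mulKVmx.
  rewrite {1}/qform -mulmxA Aw [(_ - _)^T]linearB/= ![(_ *: _)^T]linearZ/=.
  rewrite trmx_mul sI mulmxBl !mulmxBr -!scalemxAl -!scalemxAr.
  rewrite e3 e1' e2 (mulmxA _ A) (mulmxKV uA) e1.
  rewrite !mxE eqxx !mulr1n.
  ring.
by rewrite pmulr_rge0// subr_ge0 mulrC.
Qed.

Lemma posdef_add_outer n (A : 'M[R]_n) c (v : 'cV[R]_n) : posdef A -> 0 <= c ->
  posdef (A + c *: (v *m v^T)).
Proof.
move=> [sA pA] c0; split.
  by rewrite linearD linearZ/= sA trmx_mul trmxK.
move=> w w0; rewrite qformD qformZ qform_outer ltr_wpDr ?pA// mulr_ge0// ?sqr_ge0//.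
Qed.

Lemma posdef_sub_outer n (A : 'M[R]_n) c (v : 'cV[R]_n) : posdef A -> 0 < c ->
  c * qform (invmx A) v < 1 -> posdef (A - c *: (v *m v^T)).
Proof.
move=> pA c0 cb; have [sA pA'] := pA; split.
  by rewrite linearB linearZ/= sA trmx_mul trmxK.
move=> w w0; rewrite qformD qformN qformZ qform_outer subr_gt0.
have h := posdef_cauchy v w pA; have qw := pA' _ w0.
have := ler_wpM2l (ltW c0) h; move/le_lt_trans; apply.
by rewrite mulrCA gtr_pMr.
Qed.

(** Both signs of [c] occur: the lower barrier adds a rank-one term and the upper barrier subtracts
    one. *)
Lemma sherman_morrison n (A : 'M[R]_n) c (v : 'cV[R]_n) : A \in unitmx ->
  1 + c * qform (invmx A) v != 0 ->
  invmx (A + c *: (v *m v^T)) = invmx A -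
    (c / (1 + c * qform (invmx A) v)) *: (invmx A *m v *m v^T *m invmx A).
Proof.
move=> uA k0; set b := qform _ v in k0 *; set k := 1 + c * b in k0 *.
have vWv : v^T *m invmx A *m v = b%:M by rewrite -mx11_scalar.
set B := RHS.
have AB : (A + c *: (v *m v^T)) *m B = 1%:M.
  pose V := v *m v^T *m invmx A.
  have AQ : A *m (invmx A *m v *m v^T *m invmx A) = V by rewrite -!mulmxA mulKVmx// mulmxA.
  have PQ : v *m v^T *m (invmx A *m v *m v^T *m invmx A) = b *: V.
    rewrite /V 2!scalemxAl -mul_mx_scalar -vWv.
    by rewrite !mulmxA.
  rewrite /B mulmxBr !mulmxDl mulmxV// -!scalemxAr AQ -!scalemxAl PQ -/V.
  rewrite !scalerA -addrA -scalerDl -scalerBl.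
  rewrite (_ : c - _ = 0) ?scale0r ?addr0//.
  by rewrite /k; field.
have [uC _] := mulmx1_unit AB.
by rewrite -[LHS]mulmx1 -AB mulKmx.
Qed.

Lemma posdef_diag_gt0 n (A : 'M[R]_n) i : posdef A -> 0 < A i i.
Proof.
move=> [_ pA]; have e0 : delta_mx i 0 != 0 :> 'cV[R]_n.
  by apply/eqP => /matrixP/(_ i 0)/eqP; rewrite !mxE !eqxx oner_eq0.
by have := pA _ e0; rewrite /qform trmx_delta -rowE -colE !mxE.
Qed.

Lemma posdef_conj_diag_ge0 n (A B : 'M[R]_n) i : posdef A -> B^T = B ->
  0 <= (B *m A *m B) i i.
Proof.
move=> pA sB; have := posdef_ge0 (col i B) pA; rewrite colE -qform_conj sB.
by rewrite /qform trmx_delta -rowE -colE mxE mxE.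
Qed.

Lemma tr_diag_mul n (d : 'rV[R]_n) (A : 'M[R]_n) :
  \tr (diag_mx d *m A) = \sum_i d 0 i * A i i.
Proof. by apply: eq_bigr => i _; rewrite mul_diag_mx mxE. Qed.

(** The dimension is a successor because an empty matrix has trace 0. *)
Lemma tr_diag_sq_gt0 n (d : 'rV[R]_n.+1) (A : 'M[R]_n.+1) :
  (forall i, 0 < d 0 i) -> posdef A -> 0 < \tr (diag_mx d *m (A *m A)).
Proof.
move=> d0 pA; have [sA _] := pA; rewrite tr_diag_mul big_ord_recl ltr_pwDl//.
  rewrite mulr_gt0// mxE big_ord_recl ltr_pwDl//.
    by rewrite mulr_gt0// posdef_diag_gt0.
  by apply: sumr_ge0 => j _; rewrite -{2}sA mxE -expr2 sqr_ge0.
apply: sumr_ge0 => i _; rewrite mulr_ge0//; first exact: ltW.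
rewrite mxE; apply: sumr_ge0 => j _.
by rewrite -{2}sA mxE -expr2 sqr_ge0.
Qed.

(** The products of X - X' with the two inverses, in either order, equal X'^-1 - X^-1. Commutation
    follows by cancelling the scalar X - X' = a, and from X = X' when a = 0. *)
Lemma resolvent n (X X' : 'M[R]_n) a : X \in unitmx -> X' \in unitmx ->
  X = X' + a%:M -> invmx X' = invmx X + a *: (invmx X *m invmx X') /\
  invmx X *m invmx X' = invmx X' *m invmx X.
Proof.
move=> uX uX' e.
have h1 : invmx X *m (X - X') *m invmx X' = invmx X' - invmx X.
  by rewrite mulmxBr mulmxBl mulVmx// mul1mx mulmxK.
have h2 : invmx X' *m (X - X') *m invmx X = invmx X' - invmx X.
  by rewrite mulmxBr mulmxBl mulVmx// mul1mx mulmxK.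
have eX : X - X' = a%:M by rewrite e addrC addKr.
split.
  by move: h1; rewrite eX mul_mx_scalar -scalemxAl => ->; rewrite addrC subrK.
have [a0|a0] := eqVneq a 0.
  by move: eX; rewrite a0 raddf0 => /eqP; rewrite subr_eq0 => /eqP ->.
apply: (scalerI a0); rewrite !scalemxAl -!mul_mx_scalar -eX.
by rewrite h1 h2.
Qed.

(** This estimate fixes the size of the lower step: for a = 1/4 it gives tr Q >= a^-1 - tr Z >= 3 in
    [lower_barrier_step]. With [p] and [s] as below, the gap of the traces is a p and the claim
    reduces to a p^2 <= s, which follows from p^2 <= z s since a and z are at most 1. *)
Lemma resolvent_square_trace n (Z Z' : 'M[R]_n.+1) (a : R) :
  posdef Z -> posdef Z' -> 0 < a <= 1 -> \tr Z <= 1 ->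
  Z' = Z + a *: (Z *m Z') -> Z *m Z' = Z' *m Z ->
  0 < \tr Z' - \tr Z /\
  (\tr Z' - \tr Z) * (a^-1 - \tr Z + \tr Z') <= \tr (Z' *m Z').
Proof.
move=> pZ pZ' /andP[a0 a1] z1 e c.
have [sZ _] := pZ; have [sZ' _] := pZ'.
set z := \tr Z in z1 *; set p := \tr (Z *m Z'); set s := \tr (Z' *m Z *m Z').
have z'E : \tr Z' = z + a * p by rewrite e mxtraceD mxtraceZ.
have sqE : \tr (Z' *m Z') = p + a * s.
  by rewrite {2}e mulmxDr mxtraceD -c -scalemxAr mxtraceZ mulmxA.
have p0 : 0 < p.
  rewrite /p e mulmxDr mxtraceD -scalemxAr mxtraceZ c mulmxA ltr_wpDr//.
    by apply: mulr_ge0; [exact: ltW|exact: tr_conj_sym_ge0].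
  have := tr_diag_sq_gt0 (d := const_mx 1) (A := Z) _ pZ.
  by rewrite diag_const_mx mul1mx; apply => i; rewrite mxE.
have z0 : 0 < z.
  rewrite /z /mxtrace big_ord_recl ltr_pwDl ?posdef_diag_gt0//.
  by apply: sumr_ge0 => i _; rewrite ltW// posdef_diag_gt0.
(* Cauchy-Schwarz: \tr ((x - Z') Z (x - Z')) >= 0 at x = p / z. *)
have cs : p ^+ 2 <= z * s.
  have sy : ((p / z)%:M - Z')^T = (p / z)%:M - Z' by rewrite linearB/= tr_scalar_mx sZ'.
  have := tr_conj_sym_ge0 pZ sy.
  rewrite mulmxBl mulmxBr !mulmxBl mul_scalar_mx !mul_mx_scalar -!scalemxAl.
  rewrite !raddfB/= !mxtraceZ -/z (mxtrace_mulC Z' Z) -/p -/s => h.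
  have := mulr_ge0 (ltW z0) h; set y := z * (_ + _).
  have -> : y = z * s - p ^+ 2 by rewrite /y; field; rewrite gt_eqF.
  by rewrite subr_ge0.
rewrite z'E sqE; split; first by rewrite addrC addKr mulr_gt0.
rewrite addrC addKr (_ : a * p * _ = p + a * (a * p ^+ 2)).
  rewrite lerD2l ler_pM2l//; apply: (@le_trans _ _ (p ^+ 2)).
    by rewrite ler_piMl// sqr_ge0.
  apply: (le_trans cs); rewrite ler_piMl//.
  by rewrite /s tr_conj_sym_ge0.
by field; rewrite gt_eqF.
Qed.

(* By the Sherman-Morrison formula, the trace of the resolvent does not exceed
   its old value exactly when c^-1 <= qform Q v. *)
Lemma lower_barrier_step n (X : 'M[R]_n.+1) : posdef X -> \tr (invmx X) <= 1 ->
  exists Q : 'M[R]_n.+1, 3 <= \tr Q /\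
    forall v c, 0 < c -> c^-1 <= qform Q v ->
      let X' := X - (4^-1)%:M + c *: (v *m v^T) in
      posdef X' /\ \tr (invmx X') <= 1.
Proof.
move=> pX trX; pose a : R := 4^-1.
have a01 : 0 < a <= 1 by rewrite /a; apply/andP; split; lra.
have [sX qX] := pX.
(* As tr X^-1 <= 1, the eigenvalues of X are at least 1, so a shift by 1/4 preserves positivity. *)
have pX' : posdef (X - a%:M).
  split=> [|v v0]; first by rewrite linearB/= tr_scalar_mx sX.
  rewrite qformD qformN (qform_scalar a) subr_gt0.
  have q0 := qform1_gt0 v0; set q := qform 1%:M v in q0 *.
  have h1 := posdef_cauchy v v pX.
  have h2 := posdef_tr_ge v (posdef_inv pX).
  have e : (v^T *m v) 0 0 = q by rewrite /q /qform mulmx1.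
  rewrite e in h1; rewrite -/q in h2.
  have h3 : qform (invmx X) v <= q by rewrite (le_trans h2)// ler_piMl// ltW.
  have h4 : q ^+ 2 <= qform X v * q.
    by rewrite (le_trans h1)// ler_wpM2l// posdef_ge0.
  rewrite expr2 ler_pM2r// in h4; apply: lt_le_trans h4.
  by rewrite gtr_pMl// /a; lra.
have uX := posdef_unit pX; have uX' := posdef_unit pX'.
set Z := invmx X; set Z' := invmx (X - a%:M).
have [|e c] := resolvent (a := a) uX uX'; first by rewrite subrK.
have [zp zle] := resolvent_square_trace (posdef_inv pX) (posdef_inv pX') a01 trX e c.
rewrite -/Z -/Z' in e c zp zle trX.
exists ((\tr Z' - \tr Z)^-1 *: (Z' *m Z') - Z'); split.
  rewrite raddfB/= mxtraceZ mulrC lerBrDr ler_pdivlMr// mulrC.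
  apply: le_trans zle; rewrite ler_pM2l// /a invrK; lra.
move=> v k k0; rewrite qformD qformN qformZ => kv; cbv zeta.
set b := qform Z' v in kv; have b0 : 0 <= b by apply: posdef_ge0; exact: posdef_inv.
have K0 : 0 < 1 + k * b by rewrite ltr_pwDl// mulr_ge0// ltW.
split; first by apply: posdef_add_outer => //; exact: ltW.
rewrite sherman_morrison// -/Z'; last by rewrite gt_eqF.
rewrite -/b raddfB/= mxtraceZ.
apply: le_trans trX; rewrite lerBlDr -lerBlDl.
have -> : \tr (Z' *m v *m v^T *m Z') = qform (Z' *m Z') v.
  by rewrite qformE mxtrace_mulC !mulmxA.
rewrite mulrAC ler_pdivlMr//.
move: kv; rewrite lerBrDr mulrC ler_pdivlMr// => kv.
have := ler_wpM2l (ltW k0) kv; rewrite mulrA (mulrDr k) mulfV ?gt_eqF// => h.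
by rewrite mulrC.
Qed.

(** The vector [d] stands for the second moments of the features u, so that tr (D Q) is the mean of
    qform Q (u x). Each summand of Q contributes at most 1 to the bound 2: tr (D M') <= tr (D M) <=
    1, and d <= t gives tr (D M' D M') <= t tr (D M' M') <= r. *)
Lemma upper_barrier_step n (Y : 'M[R]_n.+1) (d : 'rV[R]_n.+1) (t : R) :
  (forall i, 0 < d 0 i <= t) ->
  posdef Y -> \tr (diag_mx d *m invmx Y) <= 1 ->
  exists Q : 'M[R]_n.+1, [/\ \tr (diag_mx d *m Q) <= 2,
    forall v, 0 <= qform Q v &
    forall v c, 0 < c -> qform Q v < c^-1 ->
      let Y' := Y + t%:M - c *: (v *m v^T) in
      posdef Y' /\ \tr (diag_mx d *m invmx Y') <= 1].
Proof.
move=> dt pY trY; have [sY qY] := pY; set D := diag_mx d in trY *.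
have d0 i : 0 < d 0 i by case/andP: (dt i).
have t0 : 0 < t by case/andP: (dt 0) => /lt_le_trans; apply.
have pY' : posdef (Y + t%:M).
  split=> [|v v0]; first by rewrite linearD/= tr_scalar_mx sY.
  by rewrite qformD (qform_scalar t) addr_gt0 ?qY// mulr_gt0// qform1_gt0.
have uY := posdef_unit pY; have uY' := posdef_unit pY'.
have [e c] := resolvent (a := t) uY' uY (erefl _).
set M := invmx Y in e c trY; set M' := invmx (Y + t%:M) in e c.
have pM : posdef M by exact: posdef_inv.
have pM' : posdef M' by exact: posdef_inv.
have [sM' _] := pM'.
set q := \tr (D *m (M' *m M')).
have q0 : 0 < q by exact: tr_diag_sq_gt0.
set r := \tr (D *m M) - \tr (D *m M').
have rq : t * q <= r.
  rewrite /r {1}e mulmxDr mxtraceD -scalemxAr mxtraceZ addrC addKr ler_pM2l//.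
  rewrite c e mulmxDl mulmxDr mxtraceD -scalemxAl -scalemxAr mxtraceZ lerDl.
  apply: mulr_ge0; first exact: ltW.
  rewrite tr_diag_mul; apply: sumr_ge0 => i _.
  by apply: mulr_ge0; [exact: ltW|exact: posdef_conj_diag_ge0].
have r0 : 0 < r by apply: lt_le_trans rq; rewrite mulr_gt0.
have q2 : \tr (D *m (M' *m D *m M')) <= t * q.
  rewrite /q !tr_diag_mul mulr_sumr; apply: ler_sum => i _.
  rewrite mulrCA ler_pM2l// !mxE mulr_sumr; apply: ler_sum => j _.
  rewrite mul_mx_diag mxE mulrAC mulrC ler_wpM2r//; last by case/andP: (dt j).
  by rewrite -{2}sM' mxE -expr2 sqr_ge0.
exists (r^-1 *: (M' *m D *m M') + M'); split.
- rewrite mulmxDr mxtraceD -scalemxAr mxtraceZ.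
  have : r^-1 * \tr (D *m (M' *m D *m M')) <= 1.
    by rewrite mulrC ler_pdivrMr// mul1r (le_trans q2).
  have : \tr (D *m M') <= 1 by apply: le_trans trY; rewrite -subr_ge0 ltW.
  lra.
- move=> v; rewrite qformD qformZ addr_ge0//; last exact: posdef_ge0.
  apply: mulr_ge0; first by rewrite invr_ge0 ltW.
  rewrite -{1}sM' qform_conj qform_sum.
  set w := M' *m v; rewrite (eq_bigr (fun i => d 0 i * (w i 0) ^+ 2)).
    by apply: sumr_ge0 => i _; rewrite mulr_ge0 ?sqr_ge0// ltW.
  move=> i _; rewrite (bigD1 i)//= big1 ?addr0.
    by rewrite !mxE eqxx mulr1n expr2.
  by move=> j ji; rewrite !mxE eq_sym (negbTE ji) mulr0n mul0r.
move=> v k k0; rewrite qformD qformZ => kv; cbv zeta.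
set b := qform M' v in kv; have b0 : 0 <= b by apply: posdef_ge0.
set g := qform _ v in kv.
have kk : k * (r^-1 * g + b) < 1.
  by rewrite mulrC -ltr_pdivlMr// div1r.
have g0 : 0 <= g.
  rewrite /g -{1}sM' qform_conj qform_sum.
  set w := M' *m v; rewrite (eq_bigr (fun i => d 0 i * (w i 0) ^+ 2)).
    by apply: sumr_ge0 => i _; rewrite mulr_ge0 ?sqr_ge0// ltW.
  move=> i _; rewrite (bigD1 i)//= big1 ?addr0.
    by rewrite !mxE eqxx mulr1n expr2.
  by move=> j ji; rewrite !mxE eq_sym (negbTE ji) mulr0n mul0r.
have kb : k * b < 1.
  apply: le_lt_trans kk; rewrite ler_pM2l// lerDr mulr_ge0// invr_ge0 ltW//.
split; first exact: posdef_sub_outer.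
have K0 : 0 < 1 + - k * b by rewrite mulNr subr_gt0.
rewrite -scaleNr sherman_morrison// -/M' -/b; last by rewrite gt_eqF.
set K := 1 + - k * b in K0 *.
rewrite mulmxBr raddfB/= -scalemxAr mxtraceZ mulNr mulNr opprK.
have -> : \tr (D *m (M' *m v *m v^T *m M')) = g.
  rewrite /g qformE !mulmxA mxtrace_mulC !mulmxA; congr (\tr _).
rewrite -lerBrDl; apply: (@le_trans _ _ r).
  rewrite mulrAC ler_pdivrMr//.
  have E : k * (r^-1 * g + b) * r = k * g + k * b * r by field; rewrite gt_eqF.
  have := ltW kk; rewrite -(ler_pM2r r0) E mul1r.
  by rewrite /K; clear; move: (k * g) => y; move: r => r' h; lra.
by rewrite /r lerD2r.
Qed.

End posdef.

(** * Selection of points by two barriers, and weighted least squares *)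

Section barrier.
Context {R : realFieldType}.

Lemma scalar_tr_le n (d : 'rV[R]_n) (T : R) : 0 < T -> \sum_i d 0 i <= T ->
  \tr (diag_mx d *m invmx T%:M) <= 1.
Proof.
move=> T0 dT; rewrite invmx_scalar mul_mx_scalar mxtraceZ mulrC ler_pdivrMr// mul1r.
by rewrite mxtrace_diag.
Qed.

Lemma posdef_scalar n (a : R) : 0 < a -> posdef (a%:M : 'M[R]_n).
Proof.
move=> a0; split=> [|v v0]; first by rewrite tr_scalar_mx.
by rewrite qform_scalar mulr_gt0// qform1_gt0.
Qed.

(** [List.In] stands in for boolean membership because the points form a bare [Type]. *)
Lemma List_In_tnth (X : Type) n (s : n.-tuple X) i : List.In (tnth s i) s.
Proof.
rewrite (tnth_nth (tnth s i)); move: (tnth s i) => x0.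
have : (i < size s)%N by rewrite size_tuple.
elim: (val s) (nat_of_ord i) => [//|y s' IH] [|k] /= h; first by left.
by right; exact: IH.
Qed.

(* Each of the n steps moves the lower barrier n/4 - a by 1/4 and the upper
   barrier T + n t by t, and keeps the trace of the lower resolvent and the
   d-weighted trace of the upper resolvent at most 1. *)
Lemma barrier_selection (X : Type) m M (v : X -> 'cV[R]_m.+1) (u : X -> 'cV[R]_M.+1)
    (d : 'rV[R]_M.+1) (G : X -> R -> Prop) (t a T : R) n :
  (forall (Q1 : 'M[R]_m.+1) (Q2 : 'M[R]_M.+1),
     \tr (diag_mx d *m Q2) + 2^-1 < \tr Q1 ->
     exists x r, [/\ 0 <= r, G x r & qform Q2 (u x) + r < qform Q1 (v x)]) ->
  (forall i, 0 < d 0 i <= t) -> m.+1%:R <= a ->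
  0 < T -> \sum_i d 0 i <= T ->
  exists (x : 'I_n -> X) (c : 'I_n -> R),
    [/\ forall i, 0 < c i /\ exists2 r, G (x i) r & c i * r <= 1,
        posdef (a%:M - (n%:R / 4)%:M + \sum_i c i *: (v (x i) *m (v (x i))^T)) &
        posdef ((T + n%:R * t)%:M - \sum_i c i *: (u (x i) *m (u (x i))^T))].
Proof.
move=> H dt ma T0 dT.
have a0 : 0 < a by apply: lt_le_trans ma; rewrite ltr0n.
(* The induction carries the two trace bounds along, and a tuple of pairs lets each step prepend its
   point and weight. *)
suff [s [h1 h2 _ h3 _]] : exists s : n.-tuple (X * R),
    [/\ forall p, List.In p s -> 0 < p.2 /\ exists2 r, G p.1 r & p.2 * r <= 1,
        posdef (a%:M - (n%:R / 4)%:M + \sum_(p <- s) p.2 *: (v p.1 *m (v p.1)^T)),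
        \tr (invmx (a%:M - (n%:R / 4)%:M + \sum_(p <- s) p.2 *: (v p.1 *m (v p.1)^T))) <= 1,
        posdef ((T + n%:R * t)%:M - \sum_(p <- s) p.2 *: (u p.1 *m (u p.1)^T)) &
        \tr (diag_mx d *m invmx ((T + n%:R * t)%:M - \sum_(p <- s) p.2 *: (u p.1 *m (u p.1)^T))) <= 1].
  exists (fun i => (tnth s i).1), (fun i => (tnth s i).2); split.
  - by move=> i; apply: h1; exact: List_In_tnth.
  - by rewrite big_tuple in h2.
  - by rewrite big_tuple in h3.
elim: n => [|n [s [h1 h2 h3 h4 h5]]].
  exists [tuple]; rewrite !big_nil !mul0r !raddf0 !addr0; split => //.
  - exact: posdef_scalar.
  - rewrite invmx_scalar mxtrace_scalar -mulr_natr mulrC ler_pdivrMr// mul1r//.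
  - exact: posdef_scalar.
  - exact: scalar_tr_le.
have [Q1 [tQ1 lstep]] := lower_barrier_step h2 h3.
have [Q2 [tQ2 Q20 ustep]] := upper_barrier_step dt h4 h5.
have [|x [r [r0 Gxr xr]]] := H Q1 Q2; first by lra.
(* The inverse weight is set to the lower form, the largest value of c^-1 that the lower barrier
   admits. It exceeds both the upper form and r, since these are nonnegative and their sum is below
   it. *)
set k := qform Q1 (v x) in xr.
have k0 : 0 < k by apply: le_lt_trans xr; rewrite addr_ge0.
have ki0 : 0 < k^-1 by rewrite invr_gt0.
have eL p (S V : 'M[R]_p) :
    a%:M - (n%:R / 4)%:M + S - (4^-1)%:M + V = a%:M - (n.+1%:R / 4)%:M + (V + S).
  by apply/matrixP => i j; rewrite !mxE -mulrnBl -(natr1 n); case: (i == j); ring.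
have eU p (S V : 'M[R]_p) :
    (T + n%:R * t)%:M - S + t%:M - V = (T + n.+1%:R * t)%:M - (V + S).
  by apply/matrixP => i j; rewrite !mxE -(natr1 n); case: (i == j); ring.
exists [tuple of (x, k^-1) :: s]; split.
- move=> p /= [<-/=|]; last exact: h1.
  split=> //; exists r => //; rewrite mulrC ler_pdivrMr// mul1r.
  by apply: ltW; apply: le_lt_trans xr; rewrite lerDr.
- have [] := lstep (v x) k^-1 ki0; first by rewrite invrK.
  by rewrite big_cons/= eL.
- have [] := lstep (v x) k^-1 ki0; first by rewrite invrK.
  by rewrite big_cons/= eL.
- have [] := ustep (u x) k^-1 ki0; last by rewrite big_cons/= eU.
  by rewrite invrK; apply: le_lt_trans xr; rewrite lerDl.
- have [] := ustep (u x) k^-1 ki0; last by rewrite big_cons/= eU.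
  by rewrite invrK; apply: le_lt_trans xr; rewrite lerDl.
Qed.

(** Exact data reproduce b, so the error z is the fit to the perturbation q alone. With w_i the
    value of z at v_i, the normal equations give sum c w^2 = sum c q w, hence z^T A z <= sum c q^2,
    and A dominates l times the identity. *)
Lemma weighted_least_squares n m (c : 'I_n -> R) (v : 'I_n -> 'cV[R]_m) (l : R) :
  0 < l -> (forall i, 0 <= c i) ->
  posdef (\sum_i c i *: (v i *m (v i)^T) - l%:M) ->
  exists G : 'I_n -> 'cV[R]_m, forall (b : 'cV[R]_m) (q : 'I_n -> R),
    qform 1%:M (\sum_i (((v i)^T *m b) 0 0 + q i) *: G i - b) <=
      l^-1 * \sum_i c i * q i ^+ 2.
Proof.
move=> l0 c0; set A := \sum_i _ => pAl.
have pA : posdef A.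
  have [sA qA] := pAl; split.
    rewrite -[A](subrK l%:M) linearD/= sA tr_scalar_mx//.
  move=> w w0; rewrite -[A](subrK l%:M) qformD qform_scalar addr_gt0 ?qA//.
  by rewrite mulr_gt0// qform1_gt0.
have uA := posdef_unit pA.
exists (fun i => c i *: (invmx A *m v i)) => b q.
set z := (X in qform _ X).
have zE : z = \sum_i (q i * c i) *: (invmx A *m v i).
  rewrite /z; apply/eqP; rewrite subr_eq; apply/eqP.
  have {2}-> : b = \sum_i (((v i)^T *m b) 0 0 * c i) *: (invmx A *m v i).
    rewrite -{1}(mulKmx uA b) /A mulmx_suml mulmx_sumr; apply: eq_bigr => i _.
    rewrite -scalemxAl -scalemxAr mulrC -scalerA; congr (_ *: _).
    by rewrite -(mulmxA (v i)) {1}[(v i)^T *m b]mx11_scalar mul_mx_scalar -scalemxAr.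
  by rewrite -big_split/=; apply: eq_bigr => i _; rewrite scalerA mulrDl scalerDl addrC.
pose w i := ((v i)^T *m z) 0 0.
have AzE : A *m z = \sum_i (q i * c i) *: v i.
  rewrite zE mulmx_sumr; apply: eq_bigr => i _.
  by rewrite -scalemxAr mulKVmx.
have zAz1 : qform A z = \sum_i c i * w i ^+ 2.
  rewrite qformE /A mulmx_suml raddf_sum/=; apply: eq_bigr => i _.
  by rewrite -scalemxAl mxtraceZ -qformE qform_outer.
have zAz2 : qform A z = \sum_i c i * (q i * w i).
  rewrite /qform -mulmxA AzE mulmx_sumr summxE; apply: eq_bigr => i _.
  rewrite -scalemxAr mxE (mulrC (q i)) -mulrA; congr (_ * (_ * _)).
  have -> : z^T *m v i = ((v i)^T *m z)^T by rewrite trmx_mul trmxK.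
  by rewrite mxE.
rewrite mulrC ler_pdivlMr// mulrC -qform_scalar.
apply: (@le_trans _ _ (qform A z)).
  have := posdef_ge0 z pAl; rewrite qformD qformN subr_ge0//.
have : 0 <= \sum_i c i * (q i - w i) ^+ 2.
  by apply: sumr_ge0 => i _; rewrite mulr_ge0// sqr_ge0.
have -> : \sum_i c i * (q i - w i) ^+ 2 =
    \sum_i c i * q i ^+ 2 - 2 * (\sum_i c i * (q i * w i)) + \sum_i c i * w i ^+ 2.
  by rewrite mulr_sumr -sumrB -big_split/=; apply: eq_bigr => i _; ring.
rewrite -zAz1 -zAz2; lra.
Qed.

End barrier.

(** * Sampling in an orthonormal system *)

Lemma cauchy_schwarz_sum (R : realFieldType) (I : Type) (r : seq I) (a b : I -> R) :
  (\sum_(i <- r) a i * b i) ^+ 2 <= (\sum_(i <- r) a i ^+ 2) * (\sum_(i <- r) b i ^+ 2).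
Proof.
have : 0 <= \sum_(i <- r) \sum_(j <- r) (a i * b j - a j * b i) ^+ 2.
  by apply: sumr_ge0 => i _; apply: sumr_ge0 => j _; rewrite sqr_ge0.
have -> : \sum_(i <- r) \sum_(j <- r) (a i * b j - a j * b i) ^+ 2 =
   (\sum_(i <- r) a i ^+ 2) * (\sum_(i <- r) b i ^+ 2) +
   (\sum_(i <- r) b i ^+ 2) * (\sum_(i <- r) a i ^+ 2) -
   2 * ((\sum_(i <- r) a i * b i) * (\sum_(i <- r) a i * b i)).
  rewrite !big_distrlr mulr_sumr -sumrN -!big_split/=; apply: eq_bigr => i _.
  rewrite mulr_sumr -sumrN -!big_split/=; apply: eq_bigr => j _; ring.
rewrite expr2; lra.
Qed.

Lemma sqrD_le (R : realFieldType) (x y : R) : (x + y) ^+ 2 <= 2 * x ^+ 2 + 2 * y ^+ 2.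
Proof. by have := sqr_ge0 (x - y); nra. Qed.

Section sampling.
Context d (T : measurableType d) (R : realType) (mu : {measure set T -> \bar R}).
Variables (om : T -> R) (h : nat -> T -> R).
Hypothesis om_ge0 : forall x, 0 <= om x.
Hypothesis mom : measurable_fun setT om.
Hypothesis mh : forall k, measurable_fun setT (h k).
Hypothesis orth_int : forall k l,
  mu.-integrable setT (fun x => (h k x * h l x * om x)%:E).
Hypothesis orth : forall k l,
  (\int[mu]_x (h k x * h l x * om x)%:E = (k == l)%:R%:E)%E.

Definition feature n (e : 'I_n -> nat) (a : 'I_n -> R) x : 'cV[R]_n :=
  \col_i (a i * h (e i) x).

Lemma qform_featureE n (e : 'I_n -> nat) (a : 'I_n -> R) Q :
  (fun x => (qform Q (feature e a x) * om x)%:E) =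
  (fun x => \sum_i \sum_j ((Q i j * a i * a j)%:E * (h (e i) x * h (e j) x * om x)%:E))%E.
Proof.
apply/funext => x; rewrite qform_sum mulr_suml -sumEFin; apply: eq_bigr => i _.
rewrite mulr_suml -sumEFin; apply: eq_bigr => j _.
by rewrite -EFinM !mxE; congr EFin; ring.
Qed.

Lemma qform_feature_integrable n (e : 'I_n -> nat) (a : 'I_n -> R) Q :
  mu.-integrable setT (fun x => (qform Q (feature e a x) * om x)%:E).
Proof.
rewrite qform_featureE; apply: integrable_sum => // i _.
apply: integrable_sum => // j _; exact: integrableZl.
Qed.

Lemma qform_feature_integral n (e : 'I_n -> nat) (a : 'I_n -> R) Q :
  injective e ->
  (\int[mu]_x (qform Q (feature e a x) * om x)%:E = (\sum_i Q i i * a i ^+ 2)%:E)%E.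
Proof.
move=> inje; rewrite qform_featureE integral_sum//; last first.
  by move=> i; apply: integrable_sum => // j _; exact: integrableZl.
rewrite -sumEFin; apply: eq_bigr => i _; rewrite integral_sum//; last first.
  by move=> j; exact: integrableZl.
rewrite (bigD1 i)//= big1 ?adde0.
  by rewrite integralZl// orth eqxx mule1 expr2 mulrA.
move=> j ji; rewrite integralZl// orth (inj_eq inje) eq_sym (negbTE ji) mule0//.
Qed.

(** The diagonal of the reproducing kernel restricted to the indices from N on. It is extended-real
    because only its integral is controlled, and it may be infinite at single points. *)
Definition tail_kernel (Rw : nat -> R) N x : \bar R :=
  (\sum_(k <oo) (Rw (k + N)%N * h (k + N)%N x ^+ 2)%:E)%E.

Lemma tail_kernel_ge0 (Rw : nat -> R) N x : (forall k, 0 < Rw k) -> (0 <= tail_kernel Rw N x)%E.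
Proof.
by move=> R0; apply: nneseries_ge0 => k _ _; rewrite lee_fin mulr_ge0// ?sqr_ge0// ltW.
Qed.

Lemma measurable_tail_kernel (Rw : nat -> R) N : (forall k, 0 < Rw k) ->
  measurable_fun setT (tail_kernel Rw N : T -> \bar R).
Proof.
move=> R0; apply: ge0_emeasurable_sum => k.
  by move=> x _ _; rewrite lee_fin mulr_ge0// ?sqr_ge0// ltW.
move=> _; apply/measurable_EFinP; apply: measurable_funM => //.
exact: measurable_funX.
Qed.

Lemma tail_kernel_integral (Rw : nat -> R) N : (forall k, 0 < Rw k) ->
  (\int[mu]_x (tail_kernel Rw N x * (om x)%:E) = \sum_(N <= k <oo) (Rw k)%:E)%E.
Proof.
move=> R0; rewrite -nneseries_addn; last by move=> k; rewrite lee_fin ltW.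
transitivity (\int[mu]_x \sum_(k <oo) ((Rw (k + N)%N)%:E * (h (k + N)%N x * h (k + N)%N x * om x)%:E))%E.
  apply: eq_integral => x _; rewrite muleC -nneseriesZl.
    by apply: eq_eseriesr => k _; rewrite -!EFinM; congr EFin; ring.
  by move=> k _; rewrite lee_fin mulr_ge0// ?sqr_ge0// ltW.
rewrite integral_nneseries//.
- apply: eq_eseriesr => k _.
  by rewrite integralZl// orth eqxx mule1.
- move=> k; apply/measurable_EFinP; apply: measurable_funM => //.
  by apply: measurable_funM => //; exact: measurable_funM.
- move=> k x _; rewrite -EFinM lee_fin mulr_ge0//; first exact: ltW.
  by rewrite -expr2 mulr_ge0// sqr_ge0.
Qed.

Lemma tail_kernel_integrable (Rw : nat -> R) N : (forall k, 0 < Rw k) ->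
  (\sum_(N <= k <oo) (Rw k)%:E < +oo)%E ->
  mu.-integrable setT (fun x => tail_kernel Rw N x * (om x)%:E)%E.
Proof.
move=> R0 fin; apply/integrableP; split.
  apply: emeasurable_funM; first exact: measurable_tail_kernel.
  exact/measurable_EFinP.
under eq_integral => x _.
  by rewrite gee0_abs; [over|rewrite mule_ge0// ?lee_fin// tail_kernel_ge0].
by rewrite tail_kernel_integral.
Qed.

(** Cauchy-Schwarz with c h written as (c / sqrt R) (sqrt R h), on finite sums from N on and then in
    the limit. Where the kernel is infinite the bound is trivial. *)
Lemma tail_bound (Rw : nat -> R) N (c : nat -> R) (y : T) (fy : R) : (forall k, 0 < Rw k) ->
  (forall n, \sum_(k < n) c k ^+ 2 / Rw k <= 1) ->
  (\sum_(k < n) c k * h k y @[n --> \oo] --> fy) ->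
  (((fy - \sum_(k < N) c k * h k y) ^+ 2)%:E <= tail_kernel Rw N y)%E.
Proof.
move=> R0 c1 cf; have g0 := tail_kernel_ge0 N y R0.
move: g0; case E : (tail_kernel Rw N y) => [g| |]; [|by move=> _; rewrite leey|by []].
rewrite !lee_fin => g0.
have shift n (F : nat -> R) : \sum_(N <= k < n + N) F k = \sum_(0 <= k < n) F (k + N)%N.
  by rewrite -{1}(add0n N) big_addn addnK.
have part n : (\sum_(k < n + N) c k * h k y - \sum_(k < N) c k * h k y) ^+ 2 <= g.
  have -> : \sum_(k < n + N) c k * h k y - \sum_(k < N) c k * h k y =
      \sum_(0 <= k < n) (c (k + N)%N / Num.sqrt (Rw (k + N)%N)) *
                        (Num.sqrt (Rw (k + N)%N) * h (k + N)%N y).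
    rewrite -!(big_mkord xpredT (fun k => c k * h k y)).
    rewrite (big_cat_nat (n := N)) ?leq_addl//= addrAC subrr add0r.
    rewrite shift; apply: eq_bigr => k _.
    by rewrite mulrA divfK// gt_eqF// sqrtr_gt0.
  apply: (le_trans (cauchy_schwarz_sum _ _ _)).
  have h1 : \sum_(0 <= k < n) (c (k + N)%N / Num.sqrt (Rw (k + N)%N)) ^+ 2 <= 1.
    apply: le_trans (c1 (n + N)%N).
    rewrite -(big_mkord xpredT (fun k => c k ^+ 2 / Rw k)).
    rewrite [leRHS](big_cat_nat (n := N)) ?leq_addl//=.
    rewrite shift ler_wpDl//.
      by apply: sumr_ge0 => k _; rewrite divr_ge0 ?sqr_ge0// ltW.
    apply: ler_sum => k _; rewrite expr_div_n sqr_sqrtr//; exact: ltW.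
  have h2 : \sum_(0 <= k < n) (Num.sqrt (Rw (k + N)%N) * h (k + N)%N y) ^+ 2 <= g.
    rewrite -lee_fin -E /tail_kernel -sumEFin.
    rewrite (eq_bigr (fun k => (Rw (k + N)%N * h (k + N)%N y ^+ 2)%:E)).
      apply: nneseries_lim_ge => k _ _; rewrite lee_fin mulr_ge0// ?sqr_ge0// ltW//.
    by move=> k _; rewrite exprMn sqr_sqrtr//; exact: ltW.
  apply: le_trans h2; rewrite ler_piMl//.
  by apply: sumr_ge0 => k _; exact: sqr_ge0.
apply: (@cvgr_to_le _ \oo _ _ (fun n => (\sum_(k < n + N) c k * h k y - \sum_(k < N) c k * h k y) ^+ 2)).
  rewrite !expr2; under eq_fun do rewrite expr2.
  have cs : \sum_(k < n + N) c k * h k y @[n --> \oo] --> fy.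
    by move: cf; rewrite -(cvg_shiftn N).
  by apply: cvgM; apply: cvgB => //; exact: cvg_cst.
by apply: nearW => n; exact: part.
Qed.


Lemma tail_le (Rw : nat -> R) (e : R) : (forall k, 0 < Rw k) -> 0 < e ->
  (\sum_(k <oo) (Rw k)%:E < +oo)%E ->
  exists N, (\sum_(N <= k <oo) (Rw k)%:E <= e%:E)%E.
Proof.
move=> R0 e0 fin.
have /fine_cvgP[fn /cvgrPdist_le/(_ _ e0) cv] : ((\sum_(N <= k <oo) (Rw k)%:E)%E @[N --> \oo] --> 0%E).
  by apply: nneseries_tail_cvg => // k _; rewrite lee_fin ltW.
near \oo => N; exists N.
have fN : (\sum_(N <= k <oo) (Rw k)%:E)%E \is a fin_num by near: N.
rewrite -(fineK fN) lee_fin; apply: le_trans (ler_norm _) _.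
rewrite -normrN -sub0r; near: N; exact: cv.
Unshelve. all: by end_near. Qed.

(** With the all-ones matrix, [qform_feature_integral] becomes Parseval's identity for finite
    combinations of the h k. *)
Lemma qform_const1 n (V : 'cV[R]_n) : qform (const_mx 1) V = (\sum_i V i 0) ^+ 2.
Proof.
rewrite qform_sum expr2 big_distrlr/=; apply: eq_bigr => i _.
by apply: eq_bigr => j _; rewrite mxE mul1r.
Qed.

(** An averaging argument. If no x worked, the choice r = tail kernel / t would give the reverse
    inequality after multiplication by [om], and integration would yield tr Q1 - tr (D Q2) <= 1/2:
    by orthonormality the second moments of the two features are the identity and D. *)
Lemma sample_exists m M (e : 'I_m.+1 -> nat) (Rw dw : nat -> R) (t : R)
   (Q1 : 'M[R]_m.+1) (Q2 : 'M[R]_M.+1) :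
  (forall k, 0 < Rw k) -> (forall k, 0 <= dw k) -> 0 < t -> injective e ->
  (\sum_(M.+1 <= k <oo) (Rw k)%:E <= (t / 2)%:E)%E ->
  \tr (diag_mx (\row_(i < M.+1) dw i) *m Q2) + 2^-1 < \tr Q1 ->
  exists x r, [/\ 0 <= r, (tail_kernel Rw M.+1 x <= (t * r)%:E)%E &
     qform Q2 (feature (@nat_of_ord M.+1) (fun i => Num.sqrt (dw i)) x) + r <
     qform Q1 (feature e (fun=> 1) x)].
Proof.
move=> R0 d0 t0 inje tl tQ; apply: contrapT => hno.
set u := feature _ _ in hno; set v := feature _ _ in hno.
have key x : (((qform Q1 (v x) - qform Q2 (u x)) * om x)%:E <=
    t^-1%:E * (tail_kernel Rw M.+1 x * (om x)%:E))%E.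
  have tk0 := tail_kernel_ge0 M.+1 x R0.
  have [omx|omx] := eqVneq (om x) 0; first by rewrite omx mulr0 !mule0.
  have omx0 : 0 < om x by rewrite lt_neqAle eq_sym omx om_ge0.
  case E : (tail_kernel Rw M.+1 x) tk0 => [g| |]// g0; last first.
    by rewrite mulyr gtr0_sg// mul1e mulry gtr0_sg ?invr_gt0// mul1e leey.
  rewrite -!EFinM lee_fin mulrA ler_pM2r// leNgt; apply/negP => lt.
  apply: hno; exists x, (t^-1 * g); split.
  - by rewrite mulr_ge0// invr_ge0 ltW.
  - by rewrite E mulrA divff ?gt_eqF// mul1r.
  - by rewrite addrC -ltrBrDr.
have I1 := qform_feature_integrable e (fun=> 1) Q1.
have I2 := qform_feature_integrable (@nat_of_ord M.+1) (fun i => Num.sqrt (dw i)) Q2.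
have IT := tail_kernel_integral M.+1 R0.
have IT' := tail_kernel_integrable R0 (le_lt_trans tl (ltry _)).
have : (\int[mu]_x ((qform Q1 (v x) - qform Q2 (u x)) * om x)%:E <=
    \int[mu]_x (t^-1%:E * (tail_kernel Rw M.+1 x * (om x)%:E)))%E.
  apply: le_integral => //; last exact: integrableZl.
  under eq_fun do rewrite mulrBl EFinB.
  exact: integrableB.
under eq_integral do rewrite mulrBl EFinB.
rewrite integralB// integralZl// IT.
rewrite (qform_feature_integral (e := e))//.
rewrite (qform_feature_integral (e := @nat_of_ord M.+1))//; last exact: ord_inj.
rewrite leNgt => /negP; apply.
apply: (@le_lt_trans _ _ (2^-1)%:E).
  apply: (@le_trans _ _ (t^-1%:E * (t / 2)%:E)%E).
    by rewrite lee_pmul2l// lte_fin invr_gt0.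
  by rewrite -EFinM lee_fin mulrA mulVf ?gt_eqF// mul1r.
rewrite -EFinB lte_fin ltrBrDr addrC; apply: le_lt_trans (lt_le_trans tQ _).
  rewrite lerD2r tr_diag_mul; apply: ler_sum => i _.
  by rewrite sqr_sqrtr// mxE mulrC.
by apply: ler_sum => i _; rewrite expr1n mulr1.
Qed.


(** One index with t < R k makes the dimension a successor, as the barrier matrices require. *)
Lemma head_indices (Rw : nat -> R) (t a : R) N : 0 < t -> (forall k, 0 < Rw k) ->
  (exists2 k, (k < N)%N & t < Rw k) ->
  (\sum_(k <oo) (Num.min (Rw k) t)%:E <= (a * t)%:E)%E ->
  exists m (e : 'I_m.+1 -> nat), [/\ injective e, m.+1%:R <= a &
    forall F : nat -> R, \sum_(k < N) F k =
      \sum_i F (e i) + \sum_(k < N) (if Rw k <= t then F k else 0)].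
Proof.
move=> t0 R0 [k0 k0N k0t] Ra.
pose s := [seq k <- iota 0 N | t < Rw k].
have us : uniq s by rewrite filter_uniq// iota_uniq.
have k0s : k0 \in s by rewrite mem_filter k0t mem_iota add0n.
have [m sm] : exists m, size s = m.+1 by case: s {us} k0s => [//|x s' _]; exists (size s').
have sumE (F : nat -> R) : \sum_(i < m.+1) F (nth 0%N s i) = \sum_(k < N | t < Rw k) F k.
  rewrite -(big_mkord (fun k => t < Rw k)) /index_iota subn0 -[RHS]big_filter -/s.
  by rewrite (big_nth 0%N) sm big_mkord.
exists m, (fun i => nth 0%N s i); split.
- by move=> i j /eqP; rewrite nth_uniq ?sm// => /eqP/ord_inj.
- rewrite -(ler_pM2r t0) -lee_fin; apply: le_trans Ra.
  have -> : m.+1%:R * t = \sum_(i < m.+1) Num.min (Rw (nth 0%N s i)) t.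
    rewrite mulr_natl -[X in _ *+ X](card_ord m.+1) -sumr_const; apply: eq_bigr => i _.
    rewrite minElt ifF//; apply/negbTE; rewrite -leNgt ltW//.
    have : nth 0%N s i \in s by rewrite mem_nth// sm.
    by rewrite mem_filter => /andP[].
  rewrite (sumE (fun k => Num.min (Rw k) t)).
  apply: (@le_trans _ _ (\sum_(0 <= k < N) (Num.min (Rw k) t)%:E)%E).
    rewrite sumEFin lee_fin big_mkord [leRHS](bigID (fun k : 'I_N => t < Rw k))/=.
    by rewrite lerDl sumr_ge0// => k _; rewrite le_min !ltW.
  by apply: nneseries_lim_ge => k _ _; rewrite lee_fin le_min !ltW.
move=> F; rewrite sumE (bigID (fun k : 'I_N => t < Rw k))/=; congr (_ + _).
by rewrite big_mkcond/=; apply: eq_bigr => k _; rewrite leNgt.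
Qed.

(* The hypothesis on a bounds both the number of k with t < Rw k (by a) and the
   trace of the remaining part (by a * t). *)
Lemma sampling_error (Rw : nat -> R) (t a : R) n :
  (forall k, 0 < Rw k) -> (\sum_(k <oo) (Rw k)%:E < +oo)%E -> 0 < t ->
  (exists k, t < Rw k) ->
  (\sum_(k <oo) (Num.min (Rw k) t)%:E <= (a * t)%:E)%E ->
  8 * a <= n%:R ->
  exists (x : 'I_n -> T) m (e : 'I_m -> nat) (G : 'I_n -> 'I_m -> R),
  forall (f : T -> R) (c : nat -> R), measurable_fun setT f ->
    (forall N, \sum_(k < N) c k ^+ 2 / Rw k <= 1) ->
    (forall y, \sum_(k < N) c k * h k y @[N --> \oo] --> f y) ->
    (\int[mu]_y ((f y - \sum_i f (x i) * \sum_j G i j * h (e j) y) ^+ 2 * om y)%:E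
       <= (74 * t)%:E)%E.
Proof.
move=> R0 finR t0 [k0 k0t] Ra an.
(* The level t / 2 matches the slack 1/2 in [sample_exists]. Since R k0 > t, the index k0 cannot lie
   in the tail, so the cutoff is beyond it. *)
have t20 : 0 < t / 2 by rewrite divr_gt0.
have [N tlN] := tail_le R0 t20 finR.
have k0N : (k0 < N)%N.
  rewrite ltnNge; apply/negP => Nk0; move: tlN; rewrite leNgt => /negP; apply.
  apply: (@lt_le_trans _ _ (Rw k0)%:E); first by rewrite lte_fin; lra.
  apply: (@le_trans _ _ (\sum_(N <= k < k0.+1) (Rw k)%:E)%E).
    rewrite sumEFin lee_fin big_nat_recr//= lerDr sumr_ge0// => k _; exact: ltW.
  by apply: nneseries_lim_ge => k _ _; rewrite lee_fin ltW.
case: N tlN k0N => // M tlN k0N.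
have [m [e [inje ma split]]] := head_indices t0 R0 (ex_intro2 _ _ k0 k0N k0t) Ra.
pose dw k := Num.min (Rw k) t.
have d0 k : 0 < dw k by rewrite lt_min R0.
pose u := feature (@nat_of_ord M.+1) (fun i => Num.sqrt (dw i)).
pose v := feature e (fun=> 1).
have a0 : 0 < a by apply: lt_le_trans ma.
have n0 : 0 < n%:R :> R by apply: lt_le_trans an; rewrite mulr_gt0.
have [||||x [c [c1 c2 c3]]] := @barrier_selection _ _ m M v u (\row_(i < M.+1) dw i)
   (fun x r => (tail_kernel Rw M.+1 x <= (t * r)%:E)%E) t a (a * t) n _ _ ma.
- move=> Q1 Q2 tQ; apply: sample_exists tQ => //.
  by move=> k; exact: ltW.
- by move=> i; rewrite mxE d0/= ge_min lexx orbT.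
- by rewrite mulr_gt0.
- rewrite -lee_fin; apply: le_trans Ra.
  rewrite -sumEFin (eq_bigr (fun i : 'I_M.+1 => (Num.min (Rw i) t)%:E)); last first.
    by move=> i _; rewrite mxE.
  rewrite -(big_mkord xpredT (fun i => (Num.min (Rw i) t)%:E)).
  by apply: nneseries_lim_ge => k _ _; rewrite lee_fin le_min !ltW.
pose l : R := n%:R / 4 - a.
have l8 : n%:R / 8 <= l by rewrite /l; lra.
have l0 : 0 < l by apply: lt_le_trans l8; rewrite divr_gt0.
have [||G HG] := @weighted_least_squares _ n m.+1 c (fun i => v (x i)) l l0.
- by move=> i; apply: ltW; case: (c1 i).
- by move: c2; rewrite /l raddfB/= opprB addrC.
exists x, m.+1, e, (fun i j => G i j 0) => f cf mf cf1 cff.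
pose b : 'cV[R]_m.+1 := \col_j cf (e j).
(* Here f splits into a head in the span to be recovered, the part [mid] below the cutoff with R k
   <= t, and the part [far] beyond the cutoff. The last two act as noise in the least squares
   fit. *)
pose al k := if Rw k <= t then cf k else 0.
pose mid y := \sum_(k < M.+1) al k * h k y.
pose far y := f y - \sum_(k < M.+1) cf k * h k y.
have fE y : f y = ((v y)^T *m b) 0 0 + (mid y + far y).
  rewrite /far (split (fun k => cf k * h k y)).
  rewrite (_ : ((v y)^T *m b) 0 0 = \sum_i cf (e i) * h (e i) y); last first.
    by rewrite mxE; apply: eq_bigr => i _; rewrite !mxE mul1r mulrC.
  rewrite /mid (eq_bigr (fun k : 'I_M.+1 => if Rw k <= t then cf k * h k y else 0)).
    by ring.
  by move=> k _; rewrite /al; case: ifP => _//; rewrite mul0r.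
have far2 y : (((far y) ^+ 2)%:E <= tail_kernel Rw M.+1 y)%E.
  exact: (tail_bound M.+1 R0 cf1 (cff y)).
have al1 : \sum_(k < M.+1) al k ^+ 2 / dw k <= 1.
  apply: le_trans (cf1 M.+1); apply: ler_sum => k _.
  rewrite /al /dw; case: (leP (Rw k) t) => h1; first by [].
  by rewrite expr0n mul0r divr_ge0// ?sqr_ge0// ltW.
have al2 : \sum_(k < M.+1) al k ^+ 2 <= t.
  apply: (@le_trans _ _ (t * \sum_(k < M.+1) al k ^+ 2 / dw k)).
    rewrite mulr_sumr; apply: ler_sum => k _.
    by rewrite mulrCA ler_peMr ?sqr_ge0// ler_pdivlMr// mul1r ge_min lexx orbT.
  by rewrite ler_piMr// ltW.
(* This is the side condition kept by the selection: far^2 <= t r at the point, and c r <= 1. *)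
have sfar i : c i * far (x i) ^+ 2 <= t.
  have [ci0 [r hr cr]] := c1 i.
  have /le_trans/(_ hr) := far2 (x i); rewrite lee_fin => h1.
  apply: (@le_trans _ _ (c i * (t * r))); first by rewrite ler_pM2l.
  by rewrite mulrCA ler_piMr// ltW.
(* The upper barrier bounds this sum by (a + n) t times the squared norm of [be], the coefficient
   vector of [mid] in the features u. *)
have smid : \sum_i c i * mid (x i) ^+ 2 <= a * t + n%:R * t.
  pose be : 'cV[R]_M.+1 := \col_k (al k / Num.sqrt (dw k)).
  have be1 : qform 1%:M be <= 1.
    rewrite qform1; apply: le_trans al1; apply: ler_sum => k _.
    by rewrite mxE expr_div_n sqr_sqrtr// ltW.
  have midE y : mid y = ((u y)^T *m be) 0 0.
    rewrite mxE; apply: eq_bigr => k _; rewrite !mxE; field.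
    by rewrite gt_eqF// sqrtr_gt0.
  have := posdef_ge0 be c3; rewrite qformD qformN subr_ge0 qform_scalar.
  rewrite qformE mulmx_suml raddf_sum/= => h1.
  have h2 : (a * t + n%:R * t) * qform 1%:M be <= a * t + n%:R * t.
    by rewrite ler_piMr// addr_ge0// mulr_ge0// ltW.
  apply: le_trans (le_trans h1 h2); apply: ler_sum => i _.
  by rewrite -scalemxAl mxtraceZ -qformE qform_outer midE.
(* The sum is at most 2 (a + n) t + 2 n t, and a <= n / 8 <= l, so the factor is 8 (2 (1/8 + 1) + 2)
   = 34. *)
have sq : l^-1 * \sum_i c i * (mid (x i) + far (x i)) ^+ 2 <= 34 * t.
  have h1 : \sum_i c i * (mid (x i) + far (x i)) ^+ 2 <= 2 * (a * t + n%:R * t) + 2 * (n%:R * t).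
    apply: (@le_trans _ _ (2 * (\sum_i c i * mid (x i) ^+ 2) + 2 * (\sum_i c i * far (x i) ^+ 2))).
      rewrite !mulr_sumr -big_split/=; apply: ler_sum => i _.
      rewrite !(mulrCA 2 (c i)) -mulrDr ler_wpM2l ?sqrD_le//.
      by apply: ltW; case: (c1 i).
    rewrite lerD// ler_pM2l//.
    rewrite mulr_natl -[X in _ *+ X](card_ord n) -sumr_const.
    by apply: ler_sum => i _; exact: sfar.
  rewrite mulrC ler_pdivrMr//; apply: (le_trans h1).
  have : 34 * t * (n%:R / 8) <= 34 * t * l by rewrite ler_pM2l// mulr_gt0.
  apply: le_trans.
  have : 8 * a * t <= n%:R * t by rewrite ler_pM2r.
  by set nt := n%:R * t; rewrite (_ : 34 * t * _ = 34 / 8 * nt); [lra|rewrite /nt; field].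
pose z : 'cV[R]_m.+1 := \sum_i f (x i) *: G i - b.
have zn : qform 1%:M z <= 34 * t.
  apply: le_trans sq; have := HG b (fun i => mid (x i) + far (x i)).
  by under eq_bigr do rewrite -fE.
pose w y := \sum_j z j 0 * h (e j) y.
have errE y : f y - \sum_i f (x i) * \sum_j G i j 0 * h (e j) y = (mid y + far y) - w y.
  have -> : \sum_i f (x i) * \sum_j G i j 0 * h (e j) y = w y + ((v y)^T *m b) 0 0.
    rewrite /w mxE -big_split/=.
    under eq_bigr do rewrite mulr_sumr.
    rewrite exchange_big/=; apply: eq_bigr => j _.
    rewrite !mxE mul1r summxE mulrBl (mulrC (h _ _)) subrK mulr_suml.
    by apply: eq_bigr => i _; rewrite mxE mulrA.
  by rewrite fE; ring.
have I1 := qform_feature_integrable (@nat_of_ord M.+1) al (const_mx 1).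
have I2 := qform_feature_integrable e (fun j => z j 0) (const_mx 1).
have E1 := qform_feature_integral al (const_mx 1) (@ord_inj M.+1).
have E2 := qform_feature_integral (fun j => z j 0) (const_mx 1) inje.
have I3 := tail_kernel_integrable R0 (le_lt_trans tlN (ltry _)).
have E3 := tail_kernel_integral M.+1 R0.
have q1 y : qform (const_mx 1) (feature (@nat_of_ord M.+1) al y) = mid y ^+ 2.
  by rewrite qform_const1; congr (_ ^+ 2); apply: eq_bigr => k _; rewrite mxE.
have q2 y : qform (const_mx 1) (feature e (fun j => z j 0) y) = w y ^+ 2.
  by rewrite qform_const1; congr (_ ^+ 2); apply: eq_bigr => k _; rewrite mxE.
rewrite (_ : (fun _ => _) = (fun y => (mid y ^+ 2 * om y)%:E)) in I1 E1; last first.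
  by apply/funext => y; rewrite q1.
rewrite (_ : (fun _ => _) = (fun y => (w y ^+ 2 * om y)%:E)) in I2 E2; last first.
  by apply/funext => y; rewrite q2.
have mw : measurable_fun setT w.
  by apply: measurable_sum => j; apply: measurable_funM.
have me : measurable_fun setT (fun y => f y - \sum_i f (x i) * \sum_j G i j 0 * h (e j) y).
  apply: measurable_funB => //; apply: measurable_sum => i.
  apply: measurable_funM => //; apply: measurable_sum => j.
  exact: measurable_funM.
have ge0 y : (0 <= 4%:E * (mid y ^+ 2 * om y)%:E +
    (4%:E * (tail_kernel Rw M.+1 y * (om y)%:E) + 2%:E * (w y ^+ 2 * om y)%:E))%E.
  have h1 := tail_kernel_ge0 M.+1 y R0.
  apply: adde_ge0; [|apply: adde_ge0]; apply: mule_ge0; rewrite ?lee_fin//.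
  - by rewrite mulr_ge0 ?sqr_ge0.
  - by rewrite mule_ge0 ?lee_fin.
  - by rewrite mulr_ge0 ?sqr_ge0.
have I4 : mu.-integrable setT (fun y => 4%:E * (mid y ^+ 2 * om y)%:E +
    (4%:E * (tail_kernel Rw M.+1 y * (om y)%:E) + 2%:E * (w y ^+ 2 * om y)%:E))%E.
  by apply: integrableD => //; [|apply: integrableD => //]; exact: integrableZl.
(* From (mid + far - w)^2 <= 4 mid^2 + 4 far^2 + 2 w^2, with far^2 replaced by the tail kernel. *)
apply: (@le_trans _ _ (\int[mu]_y (4%:E * (mid y ^+ 2 * om y)%:E +
    (4%:E * (tail_kernel Rw M.+1 y * (om y)%:E) + 2%:E * (w y ^+ 2 * om y)%:E)))%E).
  apply: ge0_le_integral => //.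
  - by move=> y _; rewrite lee_fin mulr_ge0// sqr_ge0.
  - apply/measurable_EFinP; apply: measurable_funM => //; exact: measurable_funX.
  - exact: measurable_int I4.
  - move=> y _; rewrite errE.
    have [omy|omy] := eqVneq (om y) 0.
      by apply: le_trans (ge0 y); rewrite omy mulr0.
    have omy0 : 0 < om y by rewrite lt_neqAle eq_sym omy om_ge0.
    have := far2 y; have := tail_kernel_ge0 M.+1 y R0.
    case: (tail_kernel Rw M.+1 y) => [g| |]// g0 fg; last first.
      rewrite mulyr gtr0_sg// mul1e mulry gtr0_sg// mul1e -!EFinM.
      by rewrite addye// addey// leey.
    rewrite -!EFinM -!EFinD !lee_fin in g0 fg *.
    rewrite !mulrA -!mulrDl ler_wpM2r//.
    have := sqrD_le (mid y + far y) (- w y); have := sqrD_le (mid y) (far y).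
    rewrite sqrrN; lra.
rewrite integralD//; last 2 first.
  exact: integrableZl.
  by apply: integrableD => //; exact: integrableZl.
rewrite integralD//; [|exact: integrableZl|exact: integrableZl].
rewrite !integralZl// E1 E2 E3.
apply: (@le_trans _ _ (4%:E * t%:E + (4%:E * (t / 2)%:E + 2%:E * (34 * t)%:E))%E).
  apply: leeD; first (rewrite lee_pmul2l// lee_fin; apply: le_trans al2).
    by apply: ler_sum => k _; rewrite mxE mul1r.
  apply: leeD; first by rewrite lee_pmul2l.
  rewrite lee_pmul2l// lee_fin; apply: le_trans zn; rewrite qform1.
  by apply: ler_sum => j _; rewrite mxE mul1r.
rewrite -!EFinM -!EFinD lee_fin; lra.
Qed.

End sampling.

(** * Hermite polynomials and Gaussian integrals *)

Section gauss_integrals.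
Context {R : realType}.
Local Notation mu := (@lebesgue_measure R).

(** Used twice: for Gaussian integration by parts on the line, and for the functional equation of
    Gamma on the half-line. The fundamental theorem applies on each compact interval, and dominated
    convergence with majorant |f| passes to D. *)
Lemma integral_derivative_eq0 (D : set R) (F f : R -> R) (a b : nat -> R) :
  measurable D -> (forall n, a n < b n) -> (forall n, `[a n, b n]%classic `<=` D) ->
  (forall x, D x -> \forall n \near \oo, a n <= x <= b n) ->
  (forall x, D x -> is_derive x (1 : R) F (f x)) ->
  {in D, continuous f} ->
  mu.-integrable D (EFin \o f) ->
  F (a n) @[n --> \oo] --> (0 : R) -> F (b n) @[n --> \oo] --> (0 : R) ->
  (\int[mu]_(x in D) (f x)%:E = 0)%E.
Proof.
move=> mD ab abD nearD dF cf fint Fa Fb.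
have Fc x : D x -> {for x, continuous F}.
  move=> Dx; apply: differentiable_continuous; apply/derivable1_diffP.
  by have [] := dF x Dx.
have inD n x : a n <= x <= b n -> D x by move=> h; apply: (abD n); rewrite /= in_itv.
have part n : (\int[mu]_(x in `[a n, b n]) (f x)%:E = (F (b n) - F (a n))%:E)%E.
  rewrite EFinB; apply: continuous_FTC2 => //.
  - apply: continuous_in_subspaceT => x; rewrite inE/= in_itv/= => h.
    by apply: cf; rewrite inE; exact: inD h.
  - split.
    + by move=> x; rewrite in_itv/= => /andP[h1 h2]; have [] := dF x (inD n _ _); rewrite ?(ltW h1) ?(ltW h2).
    + by apply: cvg_at_right_filter; apply: Fc; apply: (inD n); rewrite lexx ltW.
    + by apply: cvg_at_left_filter; apply: Fc; apply: (inD n); rewrite lexx ltW.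
  - move=> x; rewrite in_itv/= => /andP[h1 h2]; rewrite derive1E.
    by have [] := dF x (inD n _ _); rewrite ?(ltW h1) ?(ltW h2).
pose g n x := ((f \_ `[a n, b n]) x)%:E.
have mf : measurable_fun D f by apply/measurable_EFinP; exact: measurable_int fint.
have lim1 : (\int[mu]_(x in D) g n x)%E @[n --> \oo] --> (\int[mu]_(x in D) (f x)%:E)%E.
  have := @dominated_convergence _ _ _ mu D mD g (EFin \o f)
    (fun x => `|f x|%:E).
  case => //.
  - move=> n; apply/measurable_EFinP; apply/measurable_restrict => //.
    by apply: measurable_funS mf.
  - by apply/measurable_EFinP.
  - apply: aeW => x Dx; apply: cvg_near_cst.
    apply: filterS (nearD x Dx) => n /= xn; rewrite /g patchE ifT//.
    by rewrite inE/= in_itv/=.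
  - by have := integrable_abse fint.
  - apply: aeW => x n _; rewrite /g lee_fin patchE.
    by case: ifP => // _; rewrite normr0.
have lim2 : (\int[mu]_(x in D) g n x)%E @[n --> \oo] --> 0%E.
  have -> : (fun n => \int[mu]_(x in D) g n x)%E = EFin \o (fun n => F (b n) - F (a n)).
    apply/funext => n /=; rewrite -part [in RHS]integral_mkcond.
    rewrite [LHS]integral_mkcond; apply: eq_integral => x _; rewrite /g /= !patchE.
    case: ifPn => // /negP xD; case: ifPn => // xab; exfalso; apply: xD.
    by move: xab; rewrite !inE; exact: abD.
  apply: cvg_EFin; first by apply: nearW.
  rewrite -[X in _ --> X](subrr 0).
  by apply: cvgB.
exact: cvg_unique lim1 lim2.
Qed.

(** A single term of the exponential series at x^2 / 4 is enough. Raising the exponent to 2 (n + 1)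
    produces a power of x^2 when |x| > 1, and the summand 1 covers |x| <= 1. *)
Lemma exprn_le_expR n (x : R) :
  `|x| ^+ n <= (1 + 4 ^+ n.+1 * n.+1`!%:R) * expR (x ^+ 2 / 4).
Proof.
have y0 : 0 <= x ^+ 2 / 4 by rewrite divr_ge0// sqr_ge0.
have e1 : 1 <= expR (x ^+ 2 / 4) by rewrite -[leLHS]expR0 ler_expR.
have h1 : `|x| ^+ n <= 1 + (x ^+ 2) ^+ n.+1.
  have [x1|x1] := leP `|x| 1.
    by apply: ler_wpDr; [rewrite exprn_ge0 ?sqr_ge0|apply: exprn_ile1].
  rewrite ler_wpDl// -(real_normK (num_real x)) -exprM ler_weXn2l ?(ltW x1)//.
  by rewrite mul2n -addnn; exact: leq_trans (leqnSn n) (leq_addr _ _).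
apply: (le_trans h1); rewrite mulrDl mul1r lerD// -mulrA.
have := expR_ge1Dxn n y0 => h2.
have h3 : (x ^+ 2 / 4) ^+ n.+1 <= n.+1`!%:R * expR (x ^+ 2 / 4).
  rewrite [leRHS]mulrC -ler_pdivrMr ?ltr0n ?fact_gt0//; apply: le_trans h2.
  by rewrite lerDr.
rewrite -[X in X ^+ n.+1 <= _](@divfK _ 4)// mulrC exprMn ler_pM2l//. 
Qed.

Lemma horner_le_expR (p : {poly R}) :
  exists2 C, 0 <= C & forall x : R, `|p.[x]| <= C * expR (x ^+ 2 / 4).
Proof.
exists (\sum_(i < size p) `|p`_i| * (1 + 4 ^+ i.+1 * i.+1`!%:R)).
  by apply: sumr_ge0 => i _; rewrite mulr_ge0// addr_ge0// mulr_ge0// exprn_ge0.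
move=> x; rewrite horner_coef mulr_suml; apply: le_trans (ler_norm_sum _ _ _) _.
apply: ler_sum => i _; rewrite normrM normrX -mulrA ler_wpM2l//.
exact: exprn_le_expR.
Qed.

Lemma gauss_gt0 (x : R) : 0 < gauss x.
Proof.
by rewrite mulr_gt0 ?expR_gt0// invr_gt0 sqrtr_gt0 mulr_gt0// pi_gt0.
Qed.

Lemma gauss_normal : @gauss R = normal_pdf 0 1.
Proof.
apply/funext => x; rewrite normal_pdfE ?oner_eq0// /gauss /normal_peak /normal_fun.
congr (_^-1 * expR _); last by rewrite subr0 expr1n mulNr.
by rewrite expr1n mul1r mulr_natl.
Qed.

Lemma continuous_gauss : continuous (@gauss R).
Proof. by rewrite gauss_normal; apply: continuous_normal_pdf; rewrite oner_eq0. Qed.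

Lemma horner_gauss_le (p : {poly R}) :
  exists2 C, 0 <= C & forall x : R, `|p.[x] * gauss x| <= C * expR (- (x ^+ 2 / 4)).
Proof.
have [C C0 pC] := horner_le_expR p.
have s0 : 0 <= (Num.sqrt (2 * pi : R))^-1 by rewrite invr_ge0 sqrtr_ge0.
exists (C * (Num.sqrt (2 * pi))^-1); first by rewrite mulr_ge0.
move=> x; rewrite normrM (gtr0_norm (gauss_gt0 x)) /gauss.
apply: (@le_trans _ _ (C * expR (x ^+ 2 / 4) * ((Num.sqrt (2 * pi))^-1 * expR (- (x ^+ 2 / 2))))).
  by rewrite ler_wpM2r// mulr_ge0// expR_ge0.
rewrite mulrACA -expRD; set e1 := expR _; set e2 := expR _.
by have -> : e1 = e2 by rewrite /e1 /e2; congr expR; field.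
Qed.

Lemma continuous_horner_gauss (p : {poly R}) : continuous (fun x : R => p.[x] * gauss x).
Proof.
move=> x; apply: cvgM; first exact: continuous_horner.
exact: continuous_gauss.
Qed.

Lemma integrable_horner_gauss (p : {poly R}) :
  mu.-integrable setT (fun x => (p.[x] * gauss x)%:E).
Proof.
have [C C0 pC] := horner_gauss_le p.
(* The majorant exp (- x^2 / 4) is a multiple of the normal density of variance 2. *)
pose s : R := Num.sqrt 2.
have s0 : s != 0 by rewrite gt_eqF// sqrtr_gt0.
have I : mu.-integrable setT (fun x => (C * (normal_peak s)^-1)%:E * (normal_pdf 0 s x)%:E)%E.
  by apply: integrableZl => //; exact: integrable_normal_pdf.
apply: le_integrable I => //.
  apply/measurable_EFinP; apply: continuous_measurable_fun.
  exact: continuous_horner_gauss.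
move=> x _; rewrite -EFinM !abse_EFin lee_fin; apply: le_trans (pC x) _.
rewrite normal_pdfE// mulrA divfK ?gt_eqF ?normal_peak_gt0//.
rewrite ger0_norm ?mulr_ge0 ?expR_ge0// /normal_fun subr0 sqr_sqrtr//.
have -> // : - (x ^+ 2 / 4) = - x ^+ 2 / (2 *+ 2) by rewrite -mulr_natr; field.
Qed.

Definition gauss_expect (p : {poly R}) : R := \int[mu]_x (p.[x] * gauss x).

Lemma gauss_expectE p : (\int[mu]_x (p.[x] * gauss x)%:E = (gauss_expect p)%:E)%E.
Proof.
by rewrite fineK//; apply: integrable_fin_num => //; exact: integrable_horner_gauss.
Qed.

Lemma gauss_expectB p q : gauss_expect (p - q) = gauss_expect p - gauss_expect q.
Proof.
rewrite /gauss_expect -RintegralB//; try exact: integrable_horner_gauss.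
by apply: eq_Rintegral => x _; rewrite hornerD hornerN mulrBl.
Qed.

Lemma gauss_expectZ a p : gauss_expect (a *: p) = a * gauss_expect p.
Proof.
rewrite /gauss_expect -RintegralZl//; last exact: integrable_horner_gauss.
by apply: eq_Rintegral => x _; rewrite hornerZ -mulrA.
Qed.

Lemma gauss_expect1 : gauss_expect 1 = 1.
Proof.
suff [] : (gauss_expect 1)%:E = 1%E by [].
rewrite -gauss_expectE -[RHS](integral_normal_pdf 0 1).
by apply: eq_integral => x _; rewrite hornerC mul1r gauss_normal.
Qed.

Lemma is_derive_gauss (x : R) : is_derive x 1 (@gauss R) (- x * gauss x).
Proof.
apply: trigger_derive; rewrite /gauss /GRing.scale/=; field.
by rewrite gt_eqF// sqrtr_gt0 mulr_gt0// pi_gt0.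
Qed.

Lemma is_derive_horner_gauss (p : {poly R}) (x : R) :
  is_derive x 1 (fun y => p.[y] * gauss y) ((p^`() - 'X * p).[x] * gauss x).
Proof.
have dg := is_derive_gauss x.
apply: (@trigger_derive _ (horner p * @gauss R)).
rewrite /GRing.scale/=; move: (gauss x) => g; rewrite hornerD hornerN hornerM hornerX; ring.
Qed.

(** Stein's identity: (p' - X p) gauss is the derivative of p gauss, which vanishes at both
    infinities. *)
Lemma gauss_expect_by_parts p : gauss_expect p^`() = gauss_expect ('X * p).
Proof.
apply/eqP; rewrite -subr_eq0 -gauss_expectB; apply/eqP.
suff [] : (gauss_expect (p^`() - 'X * p))%:E = 0%E by [].
rewrite -gauss_expectE; apply: (@integral_derivative_eq0 _ (fun y => p.[y] * gauss y) _
  (fun n => - n.+1%:R) (fun n => n.+1%:R)) => //.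
- by move=> n; rewrite gtrN.
- move=> x _; exists (Num.truncn `|x|) => // n /= xn.
  rewrite -ler_norml; apply: ltW; apply: lt_le_trans (truncnS_gt _) _.
  by rewrite ler_nat.
- by move=> x _; exact: is_derive_horner_gauss.
- by move=> x _; exact: continuous_horner_gauss.
- exact: integrable_horner_gauss.
all: have [C C0 pC] := horner_gauss_le p.
all: have cC : 4 * C * n.+1%:R^-1 @[n --> \oo] --> (0 : R).
1,3: by rewrite -[X in _ --> X](mulr0 (4 * C)); apply: cvgM; [exact: cvg_cst|exact: cvg_harmonic].
(* The factor 4 comes from exp (y^2 / 4) >= 1 + y^2 / 4 >= y / 4 at y = n + 1. *)
all: have b (n : nat) (x : R) : x ^+ 2 = n.+1%:R ^+ 2 -> `|p.[x] * gauss x| <= 4 * C * n.+1%:R^-1.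
1,3: move=> xn; apply: (le_trans (pC x)); rewrite xn (mulrC 4 C) -(mulrA C) ler_wpM2l// expRN.
1,2: rewrite -ler_pdivrMl// -invfM lef_pV2 ?posrE ?expR_gt0// ?mulr_gt0//.
1,2: have := expR_ge1Dx (n.+1%:R ^+ 2 / 4 : R); have := sqr_ge0 (n.+1%:R - 2^-1 : R); nra.
- apply/norm_cvg0P; apply: (@squeeze_cvgr _ _ _ _ (cst 0) (fun n => 4 * C * n.+1%:R^-1)) => //.
    by apply: nearW => n; rewrite normr_ge0 (b n)// sqrrN.
  exact: cvg_cst.
- apply/norm_cvg0P; apply: (@squeeze_cvgr _ _ _ _ (cst 0) (fun n => 4 * C * n.+1%:R^-1)) => //.
    by apply: nearW => n; rewrite normr_ge0 (b n).
  exact: cvg_cst.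
Qed.

(** The monic probabilists' Hermite polynomials. The recursion records, up to sign, one
    differentiation of exp (- x^2 / 2); [hermite k] is this polynomial divided by sqrt k!. *)
Fixpoint hermite_poly (k : nat) : {poly R} :=
  if k is k'.+1 then 'X * hermite_poly k' - (hermite_poly k')^`() else 1.

Lemma hermite_poly_monic_size k : hermite_poly k \is monic /\ size (hermite_poly k) = k.+1.
Proof.
elim: k => [|k [m sk]] /=; first by rewrite monic1 size_poly1.
have s1 : size ('X * hermite_poly k) = k.+2 by rewrite mulrC size_mulX ?sk// -size_poly_gt0 sk.
have s2 : (size (- (hermite_poly k)^`())%R < size ('X * hermite_poly k)%R)%N.
  by rewrite size_polyN s1 (ltn_trans (lt_size_deriv _))// ?sk// -size_poly_gt0 sk.
split; last by rewrite size_polyDl// s1.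
by rewrite monicE lead_coefDl// lead_coefM lead_coefX mul1r -monicE.
Qed.

(** The operator X - d/dx that raises the index is adjoint to d/dx under the Gaussian weight. *)
Lemma gauss_expect_hermiteS p k :
  gauss_expect (p * hermite_poly k.+1) = gauss_expect (p^`() * hermite_poly k).
Proof.
rewrite /= mulrBr mulrCA gauss_expectB -gauss_expect_by_parts derivM -gauss_expectB.
by rewrite addrK.
Qed.

Lemma gauss_expect_hermite p k : gauss_expect (p * hermite_poly k) = gauss_expect (p^`(k)).
Proof.
elim: k p => [|k IH] p; first by rewrite mulr1.
by rewrite gauss_expect_hermiteS IH derivSn.
Qed.

(** For k <= l, all l derivatives move onto a monic polynomial of degree k, which leaves k! if k = l
    and 0 otherwise. *)
Lemma gauss_expect_hermite2 k l :
  gauss_expect (hermite_poly k * hermite_poly l) = if k == l then k`!%:R else 0.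
Proof.
wlog kl : k l / (k <= l)%N.
  move=> H; have [/H//|/ltnW/H] := leqP k l.
  by rewrite mulrC eq_sym; case: eqP => [->|].
rewrite gauss_expect_hermite; have [m sk] := hermite_poly_monic_size k.
case: eqVneq => [<-|nkl].
  have -> : (hermite_poly k)^`(k) = k`!%:R *: 1.
    apply/polyP => i; rewrite coef_derivn coefZ coef1.
    case: i => [|i]; last first.
      by rewrite nth_default ?mul0rn ?mulr0// sk addnS ltnS leq_addr.
    rewrite addn0 ffactnn mulr1.
    by move/eqP: m; rewrite /lead_coef sk/= => ->.
  by rewrite gauss_expectZ gauss_expect1 mulr1.
rewrite (_ : (hermite_poly k)^`(l) = 0) ?derivn_poly0 ?sk//; last by rewrite ltn_neqAle nkl.
by rewrite -[0](scale0r (0 : {poly R})) gauss_expectZ mul0r.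
Qed.

Lemma derive1n_gauss_exp k :
  derive1n k (fun t : R => expR (- (t ^+ 2 / 2))) =
  (fun t => (-1) ^+ k * (hermite_poly k).[t] * expR (- (t ^+ 2 / 2))).
Proof.
elim: k => [|k IH].
  by rewrite derive1n0; apply/funext => t; rewrite expr0 mul1r hornerC mul1r.
rewrite derive1nS IH; apply/funext => t; rewrite derive1E.
set g := fun t : R => expR (- (t ^+ 2 / 2)).
have dg : is_derive t (1 : R) g (- t * g t).
  by apply: trigger_derive; rewrite /g /GRing.scale/=; field.
have dP : is_derive t (1 : R) (fun t => (-1) ^+ k * (hermite_poly k).[t] * g t)
   ((-1) ^+ k.+1 * (hermite_poly k.+1).[t] * g t).
  apply: (@trigger_derive _ (cst ((-1) ^+ k) * horner (hermite_poly k) * g)).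
  rewrite /GRing.scale/=; move: (g t) => gt.
  rewrite (_ : (cst _ * horner _) t = (-1) ^+ k * (hermite_poly k).[t])//.
  rewrite hornerD hornerN hornerM hornerX exprS; ring.
by have [] := dP.
Qed.

Lemma hermiteE k (x : R) : hermite k x = (hermite_poly k).[x] / Num.sqrt k`!%:R.
Proof.
rewrite /hermite derive1n_gauss_exp.
have -> : (-1) ^+ k / Num.sqrt k`!%:R * expR (x ^+ 2 / 2) *
  ((-1) ^+ k * (hermite_poly k).[x] * expR (- (x ^+ 2 / 2))) =
  ((-1) ^+ k * (-1) ^+ k) * (expR (x ^+ 2 / 2) * expR (- (x ^+ 2 / 2))) *
  ((hermite_poly k).[x] / Num.sqrt k`!%:R) by ring.
by rewrite -expRD subrr expR0 -exprMn mulrNN !mulr1 expr1n !mul1r.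
Qed.

Lemma hermite_prodE k l : (fun x : R => hermite k x * hermite l x * gauss x) =
  (fun x => ((Num.sqrt k`!%:R * Num.sqrt l`!%:R)^-1 *:
    (hermite_poly k * hermite_poly l)).[x] * gauss x).
Proof.
apply/funext => x; rewrite !hermiteE hornerZ hornerM invfM.
by move: (gauss x) => g; ring.
Qed.

Lemma hermite_orth_integrable k l :
  mu.-integrable setT (fun x => (hermite k x * hermite l x * gauss x)%:E).
Proof.
pose p : {poly R} := (Num.sqrt k`!%:R * Num.sqrt l`!%:R)^-1 *: (hermite_poly k * hermite_poly l).
rewrite (_ : (fun x => _) = (fun x => (p.[x] * gauss x)%:E)).
  exact: integrable_horner_gauss.
by apply/funext => x; rewrite (congr1 (@^~ x) (hermite_prodE k l)).
Qed.

Lemma hermite_orth k l :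
  (\int[mu]_x (hermite k x * hermite l x * gauss x)%:E = (k == l)%:R%:E)%E.
Proof.
under eq_integral => x _ do rewrite (congr1 (@^~ x) (hermite_prodE k l)).
rewrite gauss_expectE gauss_expectZ gauss_expect_hermite2; case: eqP => [->|_]; last by rewrite mulr0.
have f0 : 0 < l`!%:R :> R by rewrite ltr0n fact_gt0.
by rewrite -expr2 sqr_sqrtr ?ltW// mulVf// gt_eqF.
Qed.

Lemma measurable_hermite k : measurable_fun setT (@hermite R k).
Proof.
rewrite (_ : hermite k = fun x => (hermite_poly k).[x] / Num.sqrt k`!%:R); last first.
  by apply/funext => x; rewrite hermiteE.
apply: measurable_funM => //; apply: continuous_measurable_fun.
exact: continuous_horner.
Qed.

End gauss_integrals.

(** * Products of integrals and orthonormality in several variables *)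

Section separated_product.
Context d1 d2 (T1 : measurableType d1) (T2 : measurableType d2) (R : realType).
Variables (m1 : {sigma_finite_measure set T1 -> \bar R})
  (m2 : {sigma_finite_measure set T2 -> \bar R}) (f : T1 -> R) (g : T2 -> R).
Hypothesis intf : m1.-integrable setT (EFin \o f).
Hypothesis intg : m2.-integrable setT (EFin \o g).

Let mf : measurable_fun setT f.
Proof. by apply/measurable_EFinP; exact: measurable_int intf. Qed.

Let mg : measurable_fun setT g.
Proof. by apply/measurable_EFinP; exact: measurable_int intg. Qed.

Let mfg : measurable_fun setT (fun z : T1 * T2 => (f z.1 * g z.2)%:E).
Proof.
apply/measurable_EFinP; apply: measurable_funM.
  exact: (measurableT_comp mf).
exact: (measurableT_comp mg).
Qed.

Lemma integrable_separated :
  (m1 \x m2)%E.-integrable setT (fun z => (f z.1 * g z.2)%:E).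
Proof.
apply: (iffRL (@integrable12ltyP _ _ _ _ _ m1 m2 _ mfg)).
have fing : (\int[m2]_y `|(g y)%:E|)%E \is a fin_num.
  by apply: integrable_fin_num => //; exact: integrable_abse intg.
under eq_integral => x _.
  under eq_integral => y _ do rewrite [(_, _).1]/= EFinM abseM.
  rewrite ge0_integralZl//; last first.
    by apply: measurableT_comp => //; exact/measurable_EFinP.
  rewrite -(fineK fing) muleC; over.
rewrite integralZl//; last exact: integrable_abse intf.
apply: lte_mul_pinfty; rewrite ?lee_fin ?fine_ge0 ?integral_ge0//.
by case/integrableP : intf.
Qed.

Lemma integral_separated :
  (\int[m1 \x m2]_z (f z.1 * g z.2)%:E =
   (\int[m1]_x (f x)%:E) * (\int[m2]_y (g y)%:E))%E.
Proof.
rewrite -integral12_prod_meas1; last exact: integrable_separated.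
have fing : (\int[m2]_y (g y)%:E)%E \is a fin_num by exact: integrable_fin_num.
rewrite /fubini_F; under eq_integral => x _.
  under eq_integral => y _ do rewrite [(_, _).1]/= EFinM.
  rewrite integralZl// -(fineK fing) muleC; over.
by rewrite integralZl// muleC fineK.
Qed.

End separated_product.

Section product_lebesgue.
Context {R : realType}.
Local Notation mu := (@lebesgue_measure R).

Definition consv n (p : measurableTypeR R * Rvec R n) : Rvec R n.+1 := [tuple of p.1 :: p.2].

Lemma measurable_consv n : measurable_fun setT (@consv n).
Proof. exact: measurable_cons. Qed.

(** Fubini by induction on s: the measure on s + 1 coordinates is by definition the pushforward
    under [consv] of a product measure. *)
Lemma lebesgueRs_prod s (F : nat -> R -> R) :
  (forall j, mu.-integrable setT (EFin \o F j)) ->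
  (lebesgueRs R s).-integrable setT (fun x => (\prod_(j < s) F j (tnth x j))%:E) /\
  (\int[lebesgueRs R s]_x (\prod_(j < s) F j (tnth x j))%:E =
   (\prod_(j < s) fine (\int[mu]_x (F j x)%:E))%:E)%E.
Proof.
elim: s F => [|s IH] F intF.
  have -> : (fun x : Rvec R 0 => (\prod_(j < 0) F j (tnth x j))%:E) = cst 1%:E.
    by apply/funext => x; rewrite big_ord0.
  split; last by rewrite integral_dirac// diracT mul1e big_ord0.
  apply/integrableP; split; first exact: measurable_cst.
  by rewrite integral_dirac//= diracT mul1e normr1 ltry.
pose G (y : Rvec R s) := \prod_(j < s) F j.+1 (tnth y j).
have [IH1 IH2] := IH (fun j => F j.+1) (fun j => intF j.+1).
have mF j : measurable_fun setT (F j).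
  by apply/measurable_EFinP; exact: measurable_int (intF j).
pose H (x : Rvec R s.+1) := (\prod_(j < s.+1) F j (tnth x j))%:E.
have HE : H \o @consv s = fun z => (F 0%N z.1 * G z.2)%:E.
  apply/funext => -[x y] /=; rewrite /H big_ord_recl tnth0; congr (_ * _)%:E.
  by apply: eq_bigr => j _; rewrite tnthS.
have mH : measurable_fun setT H.
  apply/measurable_EFinP; apply: measurable_prod => j _.
  apply: (measurableT_comp (mF j)); exact: measurable_tnth.
have iH : (mu \x lebesgueRs R s)%E.-integrable (@consv s @^-1` setT) (H \o @consv s).
  by rewrite preimage_setT HE; exact: (integrable_separated (intF 0%N) IH1).
split.
  have := integrable_pushforward (@measurable_consv s) mH iH measurableT.
  move=> /integrableP[_ h]; apply/integrableP; split => //.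
rewrite -/H.
have := integral_pushforward (@measurable_consv s) mH iH measurableT.
rewrite preimage_setT HE (integral_separated (intF 0%N) IH1) IH2.
have fF : (\int[mu]_x (F 0%N x)%:E)%E \is a fin_num by exact: integrable_fin_num (intF 0%N).
by rewrite big_ord_recl EFinM fineK.
Qed.

Variable s : nat.
Implicit Types (k l : s.-tuple nat).

Lemma mhermite_prodE k l : (fun x : Rvec R s => (mhermite k x * mhermite l x * mgauss x)%:E) =
  (fun x : Rvec R s => (\prod_(j < s)
    (fun y => hermite (nth 0%N k j) y * hermite (nth 0%N l j) y * gauss y) (tnth x j))%:E).
Proof.
apply/funext => x; rewrite /mhermite /mgauss -!big_split/=; congr EFin.
by apply: eq_bigr => j _; rewrite !(tnth_nth 0%N).
Qed.

Lemma mhermite_orth_integrable k l :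
  (lebesgueRs R s).-integrable setT (fun x => (mhermite k x * mhermite l x * mgauss x)%:E).
Proof.
rewrite mhermite_prodE.
apply: (lebesgueRs_prod s (F := fun j y => hermite (nth 0%N k j) y * hermite (nth 0%N l j) y * gauss y) _).1.
by move=> j; exact: hermite_orth_integrable.
Qed.

Lemma mhermite_orth k l :
  (\int[lebesgueRs R s]_x (mhermite k x * mhermite l x * mgauss x)%:E = (k == l)%:R%:E)%E.
Proof.
rewrite mhermite_prodE.
rewrite (lebesgueRs_prod s (F := fun j y => hermite (nth 0%N k j) y * hermite (nth 0%N l j) y * gauss y) _).2; last first.
  by move=> j; exact: hermite_orth_integrable.
congr EFin; under eq_bigr do rewrite hermite_orth/=.
have [->|kl] := eqVneq k l; first by rewrite big1// => i _; rewrite eqxx.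
have [i ki] : exists i, tnth k i != tnth l i.
  apply/existsP; rewrite -negb_forall; apply: contra kl => /forallP h.
  by apply/eqP/eq_from_tnth => i; exact/eqP/h.
by rewrite (bigD1 i)//= -!(tnth_nth 0%N) (negbTE ki) mul0r.
Qed.

Lemma mgauss_gt0 (x : Rvec R s) : 0 < mgauss x.
Proof. by apply: prodr_gt0 => j _; exact: gauss_gt0. Qed.

Lemma measurable_mgauss : measurable_fun setT (@mgauss R s).
Proof.
apply: measurable_prod => j _.
apply: (measurableT_comp (f := @gauss R)); last exact: measurable_tnth.
apply: continuous_measurable_fun; exact: continuous_gauss.
Qed.

Lemma measurable_mhermite k : measurable_fun setT (@mhermite R s k).
Proof.
apply: measurable_prod => j _.
apply: (measurableT_comp (f := @hermite R _)); last exact: measurable_tnth.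
exact: measurable_hermite.
Qed.

End product_lebesgue.

(** * Upper and lower bounds for the information complexity *)

(** An enumeration turns sums over multi-indices into the series of [sampling_error]. Length 0 has a
    single tuple and so admits none. *)
Lemma tuple_nat_enum s : (0 < s)%N -> exists b : nat -> s.-tuple nat, set_bij setT setT b.
Proof.
case: s => // s _.
have : ([set: nat] #= [set: s.+1.-tuple nat])%card.
  rewrite card_eq_sym; apply: eq_card_nat => //.
  apply/infiniteP; apply/pcard_injP.
  exists (fun n : nat => nseq_tuple s.+1 n) => x y _ _ /(congr1 (fun t => tnth t ord0)).
  by rewrite !(tnth_nth 0%N).
by move/card_set_bijP.
Qed.

Section L2_norm.
Context {R : realType} {s : nat}.

Lemma L2norm_le (f : Rvec R s -> R) (e : R) : 0 <= e ->
  (\int[lebesgueRs R s]_x (f x ^+ 2 * mgauss x)%:E <= (e ^+ 2)%:E)%E ->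
  (L2norm f <= e%:E)%E.
Proof.
move=> e0 h; rewrite /L2norm.
have i0 : (0 <= \int[lebesgueRs R s]_x (f x ^+ 2 * mgauss x)%:E)%E.
  by apply: integral_ge0 => x _; rewrite lee_fin mulr_ge0 ?sqr_ge0// ltW// mgauss_gt0.
have -> : e%:E = ((e ^+ 2)%:E `^ 2^-1)%E.
  by rewrite poweR_EFin -powR_mulrn// -powRrM mulfV// powRr1.
by apply: gt0_ler_poweR => //; rewrite in_itv/= ?leey ?andbT// lee_fin sqr_ge0.
Qed.

Lemma L2norm_ge (f : Rvec R s -> R) (e : R) : 0 <= e ->
  ((e ^+ 2)%:E <= \int[lebesgueRs R s]_x (f x ^+ 2 * mgauss x)%:E)%E ->
  (e%:E <= L2norm f)%E.
Proof.
move=> e0 h; rewrite /L2norm.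
have i0 : (0 <= \int[lebesgueRs R s]_x (f x ^+ 2 * mgauss x)%:E)%E.
  by apply: integral_ge0 => x _; rewrite lee_fin mulr_ge0 ?sqr_ge0// ltW// mgauss_gt0.
have -> : e%:E = ((e ^+ 2)%:E `^ 2^-1)%E.
  by rewrite poweR_EFin -powR_mulrn// -powRrM mulfV// powRr1.
by apply: gt0_ler_poweR => //; rewrite in_itv/= ?leey ?andbT// lee_fin sqr_ge0.
Qed.

Lemma L2norm_fin (f : Rvec R s -> R) :
  (\int[lebesgueRs R s]_x (f x ^+ 2 * mgauss x)%:E < +oo)%E -> (L2norm f < +oo)%E.
Proof. exact: poweR_lty. Qed.

Lemma Hnorm_le1 (Rw : s.-tuple nat -> R) (f : Rvec R s -> R) : (forall k, 0 < Rw k) ->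
  (Hnorm Rw f <= 1)%E <->
  (\esum_(k in setT) ((Rw k)^-1 * (hcoef f k * hcoef f k))%:E <= 1)%E.
Proof.
move=> R0; rewrite /Hnorm; set S := (\esum_(k in _) _)%E.
have S0 : (0 <= S)%E.
  by apply: esum_ge0 => k _; rewrite lee_fin mulr_ge0 ?invr_ge0 ?(ltW (R0 k))// -expr2 sqr_ge0.
split=> [h|h].
  rewrite leNgt; apply/negP => S1; move: h; rewrite leNgt => /negP; apply.
  have := S1; case: S S0 {S1} => [x x0| |]//; last first.
    by rewrite poweRyr ?ltry// invr_eq0.
  rewrite lte_fin => x1; rewrite poweR_EFin lte_fin.
  apply: (@le_lt_trans _ _ (1 `^ 2^-1)); first by rewrite powR1.
  by apply: gt0_ltr_powR; rewrite ?nnegrE ?invr_gt0// ltW// (lt_trans _ x1).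
rewrite -[leRHS](poweR1r 2^-1); apply: gt0_ler_poweR => //.
  by rewrite in_itv/= S0 leey.
by rewrite in_itv/= lee_fin ler01 leey.
Qed.

End L2_norm.

Section orthonormal_series.
Context {R : realType} {s : nat}.
Variable b : nat -> s.-tuple nat.
Hypothesis bb : set_bij setT setT b.

Lemma enum_inj : injective b.
Proof. by move=> i j; have [_ + _] := bb; apply; rewrite inE. Qed.

Lemma esum_tuple (a : s.-tuple nat -> \bar R) : (forall k, 0 <= a k)%E ->
  (\esum_(k in setT) a k = \sum_(i <oo) a (b i))%E.
Proof. by move=> a0; rewrite (reindex_esum setT setT b)// nneseries_esumT. Qed.

Lemma nneseries_cvg (a : nat -> R) : (forall k, 0 <= a k) ->
  (\sum_(i <oo) (a i)%:E < +oo)%E ->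
  \sum_(k < n) a k @[n --> \oo] --> fine (\sum_(i <oo) (a i)%:E)%E.
Proof.
move=> a0 fin.
have fn : (\sum_(i <oo) (a i)%:E)%E \is a fin_num.
  by rewrite ge0_fin_numE// nneseries_ge0// => k _ _; rewrite lee_fin.
suff : (\sum_(k < n) a k)%:E @[n --> \oo] --> (fine (\sum_(i <oo) (a i)%:E))%:E.
  by move/fine_cvgP => [_].
rewrite fineK//.
have -> : (fun n => (\sum_(k < n) a k)%:E) = (fun n => \sum_(0 <= k < n) (a k)%:E)%E.
  by apply/funext => n; rewrite sumEFin big_mkord.
by apply: is_cvg_nneseries => k _ _; rewrite lee_fin.
Qed.

(** Positive and negative parts are summable separately, so the value is the limit along any
    enumeration. *)
Lemma abs_sum_cvg (a : s.-tuple nat -> R) (l : R) : abs_sum a l ->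
  \sum_(k < n) a (b k) @[n --> \oo] --> l.
Proof.
move=> [sa]; have := summable_funepos sa; have := summable_funeneg sa.
pose p k := Num.max (a k) 0; pose n k := Num.max (- a k) 0.
have p0 k : 0 <= p k by rewrite le_max lexx orbT.
have n0 k : 0 <= n k by rewrite le_max lexx orbT.
have -> : (EFin \o a)^\+%E = EFin \o p.
  by apply/funext => k; rewrite funeposE/= EFin_max.
have -> : (EFin \o a)^\-%E = EFin \o n.
  by apply/funext => k; rewrite funenegE/= EFin_max EFinN.
rewrite /summable => sn sp.
rewrite !esum_tuple; try by move=> k; rewrite lee_fin.
rewrite esum_tuple in sp; last by move=> k; rewrite abse_ge0.
rewrite esum_tuple in sn; last by move=> k; rewrite abse_ge0.
rewrite (eq_eseriesr (g := fun i => (p (b i))%:E)) in sp; last first.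
  by move=> k _; rewrite gee0_abs//= lee_fin.
rewrite (eq_eseriesr (g := fun i => (n (b i))%:E)) in sn; last first.
  by move=> k _; rewrite gee0_abs//= lee_fin.
have cp := nneseries_cvg (fun k => p0 (b k)) sp.
have cn := nneseries_cvg (fun k => n0 (b k)) sn.
have fp : (\sum_(i <oo) (p (b i))%:E)%E \is a fin_num.
  by rewrite ge0_fin_numE// nneseries_ge0// => k _ _; rewrite lee_fin.
have fn : (\sum_(i <oo) (n (b i))%:E)%E \is a fin_num.
  by rewrite ge0_fin_numE// nneseries_ge0// => k _ _; rewrite lee_fin.
rewrite /= -(fineK fp) -(fineK fn) -EFinB => -[<-].
have -> : (fun m => \sum_(k < m) a (b k)) =
    (fun m => \sum_(k < m) p (b k) - \sum_(k < m) n (b k)).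
  apply/funext => m; rewrite -sumrB; apply: eq_bigr => k _.
  by rewrite /p /n; case: (leP (a (b k)) 0) => h;
    case: (leP (- a (b k)) 0) => h'; lra.
exact: cvgB.
Qed.

Definition enum_hermite (i : nat) : Rvec R s -> R := mhermite (b i).

Lemma enum_hermite_orth i j :
  (\int[lebesgueRs R s]_x (enum_hermite i x * enum_hermite j x * mgauss x)%:E = (i == j)%:R%:E)%E.
Proof. by rewrite mhermite_orth (inj_eq enum_inj). Qed.

Lemma L2fun_span m (e : 'I_m -> nat) (G : 'I_m -> R) :
  L2fun (fun y => \sum_j G j * enum_hermite (e j) y).
Proof.
split.
  apply: measurable_sum => j; apply: measurable_funM => //.
  exact: measurable_mhermite.
apply: L2norm_fin.
have I := qform_feature_integrable (mu := lebesgueRs R s) (om := @mgauss R s) (h := enum_hermite)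
  (fun i j => mhermite_orth_integrable (b i) (b j)) e G (const_mx 1).
apply: integrable_lty => //.
rewrite (_ : (fun x => _) = (fun x => (qform (const_mx 1) (feature enum_hermite e G x) * mgauss x)%:E))//.
apply/funext => x; rewrite qform_const1; congr (_ ^+ 2 * _)%:E.
by apply: eq_bigr => j _; rewrite mxE.
Qed.

Lemma min_error_le (Rw : s.-tuple nat -> R) (S p : R) (eps : R) n :
  (forall k, 0 < Rw k) -> (exists k, 1 <= Rw k) ->
  (\esum_(k in setT) (Rw k)%:E < +oo)%E ->
  0 < p <= 1 -> (\esum_(k in setT) (Rw k `^ p)%:E <= S%:E)%E ->
  0 < eps < 1 ->
  8 * (S * (eps ^+ 2 / 74) `^ (- p)) <= n%:R ->
  (min_error Rw n <= eps%:E)%E.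
Proof.
move=> R0 [k1 Rk1] finR /andP[p0 p1] RS /andP[e0 e1] Sn.
pose t := eps ^+ 2 / 74; rewrite -/t in Sn.
have t0 : 0 < t by rewrite divr_gt0// exprn_gt0.
(* An index of weight at least 1 then lies above the threshold, so the head is not empty. *)
have t1 : t < 1 by rewrite /t; nra.
have [||||||x [m [e [G HG]]]] := @sampling_error _ (Rvec R s) R (lebesgueRs R s) (@mgauss R s) enum_hermite
  (fun x => ltW (mgauss_gt0 x)) (@measurable_mgauss R s) (fun k => measurable_mhermite (b k))
  (fun i j => mhermite_orth_integrable (b i) (b j)) enum_hermite_orth (Rw \o b) t (S * t `^ (- p)) n.
- by move=> k; exact: R0.
- by rewrite -(esum_tuple (a := fun k => (Rw k)%:E))// => k; rewrite lee_fin ltW.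
- exact: t0.
- have [_ _ /(_ k1)[//|i _ bi]] := bb.
  by exists i; rewrite /= bi; exact: lt_le_trans Rk1.
- rewrite esum_tuple in RS; last by move=> k; rewrite lee_fin powR_ge0.
  have -> : S * t `^ (- p) * t = t `^ (1 - p) * S.
    rewrite -{2}(powRr1 (ltW t0)) -mulrA -powRD; last by rewrite (gt_eqF t0) implybT.
    by rewrite mulrC addrC.
  rewrite EFinM; apply: (@le_trans _ _ ((t `^ (1 - p))%:E * \sum_(i <oo) (Rw (b i) `^ p)%:E)%E); last first.
    by rewrite lee_wpmul2l// lee_fin powR_ge0.
  rewrite -nneseriesZl; last by move=> k _; rewrite lee_fin powR_ge0.
  apply: lee_nneseries => [k _ _|k _]; first by rewrite lee_fin le_min !ltW// R0.
  have Rk := R0 (b k); rewrite -EFinM lee_fin /=.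
  case: (leP (Rw (b k)) t) => h.
    rewrite -{1}(powRr1 (ltW Rk)) -{1}(subrK p 1) powRD; last by rewrite (gt_eqF Rk) implybT.
    rewrite ler_wpM2r ?powR_ge0//; apply: ge0_ler_powR; rewrite ?nnegrE ?subr_ge0// ltW//.
  rewrite -{1}(powRr1 (ltW t0)) -{1}(subrK p 1) powRD; last by rewrite (gt_eqF t0) implybT.
  by rewrite ler_wpM2l ?powR_ge0//; apply: ge0_ler_powR; rewrite ?nnegrE ?ltW.
- exact: Sn.
apply: (@le_trans _ _ (wc_error Rw x (fun i y => \sum_j G i j * enum_hermite (e j) y))).
  apply: ereal_inf_lbound; exists x, (fun i y => \sum_j G i j * enum_hermite (e j) y); split => // i.
  exact: L2fun_span.
apply: ge_ereal_sup => _ [f [[[mf _] Hf fsum] f1] <-].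
apply: L2norm_le; first exact: ltW.
have -> : eps ^+ 2 = 74 * t by rewrite /t; field.
have := HG f (fun k => hcoef f (b k)); apply => //.
- move=> N; move/(Hnorm_le1 f R0) : f1.
  rewrite esum_tuple; last first.
    by move=> k; rewrite lee_fin mulr_ge0 ?invr_ge0 ?(ltW (R0 k))// -expr2 sqr_ge0.
  move=> h; rewrite -lee_fin; apply: le_trans h.
  rewrite -sumEFin -(big_mkord xpredT (fun k => ((hcoef f (b k)) ^+ 2 / (Rw \o b) k)%:E)).
  under eq_bigr => k _ do rewrite mulrC expr2.
  apply: nneseries_lim_ge => k _ _.
  by rewrite lee_fin mulr_ge0 ?invr_ge0 ?(ltW (R0 _))// -expr2 sqr_ge0.
- by move=> y; exact: abs_sum_cvg (fsum y).
Qed.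

End orthonormal_series.

(** The constant is 666 = 9 * 74. The index of weight at least 1 forces S >= 1, hence a >= 1, so
    rounding 8 a up gives at most 9 a; the other factor bounds 74^p. *)
Lemma inf_compl_le (R : realType) s (Rw : s.-tuple nat -> R) (S p : R) (eps : R) :
  (0 < s)%N -> (forall k, 0 < Rw k) -> (exists k, 1 <= Rw k) ->
  (\esum_(k in setT) (Rw k)%:E < +oo)%E ->
  0 < p <= 1 -> (\esum_(k in setT) (Rw k `^ p)%:E <= S%:E)%E ->
  0 < eps < 1 ->
  (inf_compl Rw eps <= (666 * S * eps `^ (- (2 * p)))%:E)%E.
Proof.
move=> s0 R0 [k1 Rk1] finR /andP[p0 p1] RS /andP[e0 e1].
have [b bb] := tuple_nat_enum s0.
have S1 : 1 <= S.
  rewrite -lee_fin; apply: le_trans RS; apply: esum_ge.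
  exists [set k1]; first by split.
  rewrite fsbig_set1 lee_fin; apply: (@le_trans _ _ (1 `^ p)); first by rewrite powR1.
  by apply: ge0_ler_powR; rewrite ?nnegrE ?(ltW p0) ?(ltW (R0 _)) ?ler01.
set t := eps ^+ 2 / 74.
have tE : t `^ (- p) = eps `^ (- (2 * p)) * 74 `^ p.
  rewrite /t powRM ?exprn_ge0 ?invr_ge0//; last exact: ltW.
  congr (_ * _); first by rewrite -powR_mulrn ?(ltW e0)// -powRrM mulrN.
  by rewrite -(powR_inv1 (ler0n R 74)) -powRrM mulrNN mul1r.
have h74 : 74 `^ p <= 74.
  by rewrite -[leRHS]powRr1// ler_powR// ler1n.
have h74' : 1 <= (74 : R) `^ p.
  by rewrite -[leLHS](powRr0 (74 : R)) ler_powR ?ler1n// ltW.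
have ep1 : 1 <= eps `^ (- (2 * p)).
  rewrite powRN invf_ge1 ?powR_gt0//; apply: (@le_trans _ _ (1 `^ (2 * p))).
    by apply: ge0_ler_powR; rewrite ?nnegrE ?(ltW e0) ?(ltW e1)// mulr_ge0// ltW.
  by rewrite powR1.
set E := eps `^ _ in tE ep1 *.
set a := S * t `^ (- p).
have a1 : 1 <= a.
  by rewrite /a tE !(mulr_ege1).
have aE : a <= 74 * (S * E).
  rewrite /a tE mulrA (mulrC 74) ler_wpM2l// mulr_ge0//; lra.
set n := (Num.truncn (8 * a)).+1.
have nlo : 8 * a <= n%:R by apply: ltW; exact: truncnS_gt.
have nhi : n%:R <= 9 * a.
  rewrite /n -natr1; have : (Num.truncn (8 * a))%:R <= 8 * a.
    by rewrite truncn_le// mulr_ge0//; lra.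
  lra.
apply: (@le_trans _ _ n%:R%:E).
  apply: ereal_inf_lbound; exists n => //=.
  apply: (min_error_le bb R0 _ finR _ RS _ nlo); first by exists k1.
  - by rewrite p0.
  - by rewrite e0.
rewrite lee_fin; apply: (le_trans nhi).
by rewrite -mulrA; lra.
Qed.

Lemma esum_fin_support (R : realType) (I : choiceType) n (k : 'I_n -> I) (g : I -> \bar R) :
  injective k -> (forall i, 0 <= g i)%E ->
  (forall i, (forall j, i != k j) -> g i = 0%E) ->
  (\esum_(i in setT) g i = \sum_j g (k j))%E.
Proof.
move=> injk g0 supp.
have gE i : g i = (\sum_j if i == k j then g (k j) else 0)%E.
  have [[j ij]|h] := pselect (exists j, i = k j).
    rewrite (bigD1 j)//= ij eqxx big1 ?adde0// => j' j'j.
    by rewrite (inj_eq injk) eq_sym (negbTE j'j).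
  rewrite supp; last by move=> j; apply/eqP => ij; apply: h; exists j.
  by rewrite big1// => j _; case: eqP => // ij; case: h; exists j.
rewrite (eq_esum (b := fun i => \sum_j if i == k j then g (k j) else 0)%E); last first.
  by move=> i _; exact: gE.
rewrite esum_sum; last by move=> i j _ _; case: ifP.
apply: eq_bigr => j _.
rewrite -[RHS](esum_set1 (t := k j) (a := g))// [RHS]esum_mkcond; apply: eq_esum => i _.
have [->|ij] := eqVneq i (k j); first by rewrite mem_set.
by rewrite memNset//=; exact/eqP.
Qed.

(** * Fooling functions spanned by Hermite polynomials *)

Section lower_bound.
Context {R : realType} {s : nat}.
Variable b : nat -> s.-tuple nat.
Hypothesis bb : set_bij setT setT b.
Variables (n : nat) (e : 'I_n -> nat).
Hypothesis inje : injective e.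
Variable c : 'I_n -> R.
Local Notation h := (@enum_hermite R s b).

Let be_inj : injective (b \o e).
Proof. by move=> i j /= /(enum_inj bb)/inje. Qed.

Definition hermite_span y : R := \sum_j c j * h (e j) y.

Lemma hcoef_hermite_span l : hcoef hermite_span l = \sum_j (if l == b (e j) then c j else 0).
Proof.
rewrite /hcoef /Rintegral.
under eq_integral => y _.
  rewrite (_ : (hermite_span y * mhermite l y * mgauss y)%:E =
    (\sum_j (c j)%:E * (mhermite (b (e j)) y * mhermite l y * mgauss y)%:E)%E); first over.
  rewrite /hermite_span !mulr_suml -sumEFin; apply: eq_bigr => j _.
  by rewrite -EFinM !mulrA.
rewrite integral_sum//; last first.
  by move=> j; apply: integrableZl => //; exact: mhermite_orth_integrable.
under eq_bigr => j _.
  rewrite integralZl//; last exact: mhermite_orth_integrable.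
  rewrite mhermite_orth -EFinM; over.
rewrite sumEFin/=; apply: eq_bigr => j _; rewrite eq_sym.
by case: ifP; rewrite ?mulr1 ?mulr0.
Qed.

Lemma hcoef_hermite_span_in j : hcoef hermite_span (b (e j)) = c j.
Proof.
rewrite hcoef_hermite_span (bigD1 j)//= eqxx big1 ?addr0// => i ij.
by rewrite (inj_eq be_inj) eq_sym (negbTE ij).
Qed.

Lemma hcoef_hermite_span_out l : (forall j, l != b (e j)) -> hcoef hermite_span l = 0.
Proof. by move=> hl; rewrite hcoef_hermite_span big1// => j _; rewrite (negbTE (hl j)). Qed.

Lemma integral_hermite_span_sqr :
  (\int[lebesgueRs R s]_y (hermite_span y ^+ 2 * mgauss y)%:E = (\sum_j c j ^+ 2)%:E)%E.
Proof.
have -> : \sum_j c j ^+ 2 = \sum_j (const_mx 1 : 'M[R]_n) j j * c j ^+ 2.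
  by apply: eq_bigr => j _; rewrite mxE mul1r.
rewrite -(qform_feature_integral (mu := lebesgueRs R s) (om := @mgauss R s) (h := h)
  (fun i j => mhermite_orth_integrable (b i) (b j)) (enum_hermite_orth bb) c (const_mx 1) inje).
apply: eq_integral => y _; rewrite qform_const1; congr (_ ^+ 2 * _)%:E.
by apply: eq_bigr => j _; rewrite mxE.
Qed.

Lemma hermite_span_abs_sum y :
  abs_sum (fun l => hcoef hermite_span l * mhermite l y) (hermite_span y).
Proof.
have out l : (forall j, l != (b \o e) j) -> hcoef hermite_span l * mhermite l y = 0.
  by move=> hl; rewrite hcoef_hermite_span_out// mul0r.
split.
  rewrite /summable (esum_fin_support be_inj)//=; last first.
    by move=> l /out ->; rewrite normr0.
  by rewrite sumEFin ltry.
rewrite (esum_fin_support be_inj)//; last by move=> l /out E; rewrite funeposE/= E maxxx.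
rewrite (esum_fin_support be_inj)//; last first.
  by move=> l /out E; rewrite funenegE/= E oppr0 maxxx.
rewrite -fin_num_sumeN; last by move=> j _; rewrite funenegE/= -EFin_max.
rewrite -big_split/= -sumEFin; apply: eq_bigr => j _.
set F := EFin \o _; have := congr1 (@^~ (b (e j))) (funeposneg F).
by rewrite /= => <-; rewrite /F/= hcoef_hermite_span_in.
Qed.

Lemma hermite_span_Hspace (Rw : s.-tuple nat -> R) : (forall k, 0 < Rw k) ->
  \sum_j c j ^+ 2 / Rw (b (e j)) <= 1 -> Hspace Rw hermite_span /\ (Hnorm Rw hermite_span <= 1)%E.
Proof.
move=> R0 c1.
have Hn : (Hnorm Rw hermite_span <= 1)%E.
  apply/(Hnorm_le1 hermite_span R0); rewrite (esum_fin_support be_inj).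
  - rewrite sumEFin lee_fin; apply: le_trans c1; apply: ler_sum => j _.
    by rewrite /= hcoef_hermite_span_in mulrC expr2.
  - by move=> l; rewrite lee_fin mulr_ge0 ?invr_ge0 ?(ltW (R0 l))// -expr2 sqr_ge0.
  - by move=> l /hcoef_hermite_span_out ->; rewrite mulr0 mulr0.
split => //; split; first exact: L2fun_span.
- by apply: le_lt_trans Hn _; rewrite ltry.
- exact: hermite_span_abs_sum.
Qed.

End lower_bound.

(** Every algorithm using the given nodes returns 0 on a function that vanishes there. Normalised to
    R-norm 1, the combination has squared L2 norm at least rho, because none of its weights is below
    rho. *)
Lemma inf_compl_ge (R : realType) s (Rw : s.-tuple nat -> R) (eps rho : R) n
    (k : 'I_n.+1 -> s.-tuple nat) :
  (0 < s)%N -> (forall l, 0 < Rw l) -> injective k -> 0 <= eps -> eps ^+ 2 < rho ->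
  (forall i, rho <= Rw (k i)) -> (n.+1%:R%:E <= inf_compl Rw eps)%E.
Proof.
move=> s0 R0 injk e0 erho kR; have [b bb] := tuple_nat_enum s0.
have rho0 : 0 < rho by apply: le_lt_trans erho; exact: sqr_ge0.
have /choice[e eE] : forall j, exists i, b i = k j.
  by move=> j; have [_ _ /(_ (k j))[//|i _ bi]] := bb; exists i.
have inje : injective e by move=> i j /(congr1 b); rewrite !eE => /injk.
apply: le_ereal_inf_tmp => _ [n' n'e <-]; rewrite lee_fin ler_nat leqNgt.
apply/negP; rewrite ltnS => n'n; move: n'e; rewrite /= leNgt => /negP; apply.
apply: (@lt_le_trans _ _ (Num.sqrt rho)%:E).
  by rewrite lte_fin -(ger0_norm e0) -sqrtr_sqr ltr_sqrt.
apply: le_ereal_inf_tmp => _ [x [g [L2g ->]]].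
(* There are more rows than columns, as n' <= n, so the left kernel contains a nonzero coefficient
   vector. *)
pose M : 'M[R]_(n.+1, n') := \matrix_(j, i) enum_hermite b (e j) (x i).
have : kermx M != 0.
  rewrite -mxrank_eq0 mxrank_ker -lt0n subn_gt0 ltnS.
  by rewrite (leq_trans (rank_leq_col M)).
move=> /rowV0Pn[v /sub_kermxP vM v0].
have [j0 vj0] : exists j, v 0 j != 0.
  apply/existsP; rewrite -negb_forall; apply: contra v0 => /forallP h.
  by apply/eqP/rowP => j; rewrite mxE; exact/eqP/h.
pose Nv := \sum_j v 0 j ^+ 2 / Rw (k j).
have Nv0 : 0 < Nv.
  rewrite /Nv (bigD1 j0)//= ltr_pwDl//.
    by rewrite divr_gt0// lt_neqAle sqr_ge0 eq_sym sqrf_eq0 vj0.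
  by apply: sumr_ge0 => j _; rewrite divr_ge0 ?sqr_ge0// ltW.
pose c j := v 0 j / Num.sqrt Nv.
have c1 : \sum_j c j ^+ 2 / Rw (b (e j)) = 1.
  rewrite -(@divff _ Nv) ?gt_eqF// {2}/Nv mulr_suml; apply: eq_bigr => j _.
  by rewrite eE /c expr_div_n sqr_sqrtr ?(ltW Nv0)// mulrAC.
have c2 : rho <= \sum_j c j ^+ 2.
  rewrite -[rho]mulr1 -c1 mulr_sumr; apply: ler_sum => j _.
  by rewrite mulrCA ler_piMr ?sqr_ge0// ler_pdivrMr// mul1r eE.
have [|Hf Hn] := hermite_span_Hspace bb inje (c := c) R0; first by rewrite c1.
have fx i : hermite_span b e c (x i) = 0.
  have := congr1 (fun A : 'rV_n' => A 0 i) vM; rewrite !mxE => E.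
  transitivity ((\sum_j v 0 j * M j i) / Num.sqrt Nv); last by rewrite E mul0r.
  by rewrite /hermite_span mulr_suml; apply: eq_bigr => j _; rewrite mxE /c mulrAC.
apply: (@le_trans _ _ (L2norm (hermite_span b e c \- std_alg x g (hermite_span b e c)))).
  have -> : hermite_span b e c \- std_alg x g (hermite_span b e c) = hermite_span b e c.
    apply/funext => y; rewrite /= /std_alg big1 ?subr0// => i _.
    by rewrite fx mul0r.
  apply: L2norm_ge; first exact: sqrtr_ge0.
  by rewrite integral_hermite_span_sqr// lee_fin sqr_sqrtr// ltW.
by apply: ereal_sup_ubound; exists (hermite_span b e c).
Qed.

(** * Fourier weights *)

Section gamma_function.
Context {R : realType}.
Local Notation mu := (@lebesgue_measure R).
Local Notation D := (`]0, +oo[%classic : set R).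

(** Half of the exponential decay absorbs the power; the other half is integrable as a multiple of
    an exponential density. *)
Lemma powR_expRN_le (a : R) : 0 <= a ->
  exists2 C, 0 < C & forall t, 0 < t -> t `^ a * expR (- t) <= C * expR (- (2^-1 * t)).
Proof.
move=> a0; pose n := (Num.truncn a).+1.
have an : a <= n%:R by apply: ltW; exact: truncnS_gt.
have c0 : 0 < n`!%:R * 2 ^+ n :> R by rewrite mulr_gt0 ?ltr0n ?fact_gt0// exprn_gt0.
exists (1 + n`!%:R * 2 ^+ n); first by rewrite addr_gt0.
move=> t t0.
have -> : - t = 2^-1 * - t + - (2^-1 * t) by field.
rewrite expRD mulrA ler_pM2r ?expR_gt0// mulrN expRN ler_pdivrMr ?expR_gt0//.
have e1 : 1 <= expR (2^-1 * t).
  by rewrite -[leLHS]expR0 ler_expR mulr_ge0// ltW.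
have [t1|t1] := leP t 1.
  apply: (@le_trans _ _ 1); last by rewrite mulr_ege1// lerDl ltW.
  rewrite -[leRHS](congr1 (@^~ a) (@powR1 R)) /=.
  by apply: ge0_ler_powR; rewrite ?nnegrE ?ler01 ?(ltW t0).
apply: (@le_trans _ _ (t ^+ n)).
  by rewrite -powR_mulrn ?(ltW t0)// ler_powR// ltW.
rewrite mulrDl mul1r ler_wpDl ?expR_ge0//.
have t20 : 0 <= 2^-1 * t by rewrite mulr_ge0// ltW.
have h : (2^-1 * t) ^+ n <= n`!%:R * expR (2^-1 * t).
  rewrite [leRHS]mulrC -ler_pdivrMr ?ltr0n ?fact_gt0//.
  by apply: le_trans (expR_ge1Dxn (Num.truncn a) t20); rewrite lerDr.
have -> : t ^+ n = 2 ^+ n * (2^-1 * t) ^+ n by rewrite -exprMn mulrA divff// mul1r.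
by rewrite (mulrC _ (2 ^+ n)) -mulrA ler_pM2l ?exprn_gt0.
Qed.

Lemma integrable_expRN_half (C : R) : mu.-integrable D (fun t => (C * expR (- (2^-1 * t)))%:E).
Proof.
have h0 : 0 < 2^-1 :> R by rewrite invr_gt0.
have I0 : mu.-integrable D (fun t => (exponential_pdf 2^-1 t)%:E).
  by apply: integrableS (integrable_exponential_pdf h0).
have I1 : mu.-integrable D (fun t => (C * 2)%:E * (exponential_pdf 2^-1 t)%:E)%E.
  exact: integrableZl.
apply: eq_integrable I1 => // t; rewrite inE/= in_itv/= andbT => t0.
by rewrite exponential_pdfE ?ltW// -EFinM -mulrA mulNr mulVKf.
Qed.

Lemma gamma_integrable (a : R) : 0 <= a ->
  mu.-integrable D (EFin \o (fun t => t `^ a * expR (- t))).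
Proof.
move=> a0; have [C C0 aC] := powR_expRN_le a0.
apply: le_integrable (integrable_expRN_half C) => //.
  apply/measurable_EFinP; apply: measurable_funM.
    by apply: measurable_funTS; exact: measurable_powR.
  apply: measurable_funTS; apply: (measurableT_comp (f := @expR R)) => //.
move=> t; rewrite /= in_itv/= andbT => t0.
rewrite lee_fin !ger0_norm ?mulr_ge0 ?powR_ge0 ?expR_ge0 ?(ltW C0)//.
exact: aC.
Qed.

(** For y >= 1 the power t^(y - 1) stays bounded near 0. The weights evaluate Gamma only at k -
    alpha + 1 with alpha <= k, which is in this range. *)
Lemma GammaD1 (y : R) : 1 <= y -> Gamma (y + 1) = y * Gamma y.
Proof.
move=> y1; have y0 : 0 < y by apply: lt_le_trans y1.
have I1 := @gamma_integrable y (ltW y0).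
have I2 : mu.-integrable D (EFin \o (fun t => t `^ (y - 1) * expR (- t))).
  by apply: gamma_integrable; rewrite subr_ge0.
have I3 : mu.-integrable D (EFin \o (fun t => y * (t `^ (y - 1) * expR (- t)))).
  have : mu.-integrable D (fun t => y%:E * (t `^ (y - 1) * expR (- t))%:E)%E.
    exact: integrableZl.
  by apply: eq_integrable => // t _; rewrite EFinM.
pose f t := y * (t `^ (y - 1) * expR (- t)) - t `^ y * expR (- t).
have If : mu.-integrable D (EFin \o f).
  have : mu.-integrable D ((EFin \o (fun t : R => (y * (t `^ (y - 1) * expR (- t)))%R)) \-
      (EFin \o (fun t : R => (t `^ y * expR (- t))%R)))%E by exact: integrableB.
  by apply: eq_integrable => // t _; rewrite /f /= EFinB.
have pc (a x : R) : 0 < x -> {for x, continuous (fun t => t `^ a)}.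
  move=> x0; apply: differentiable_continuous; apply/derivable1_diffP.
  by have [] := is_derive1_powR a x0.
have ec (x : R) : {for x, continuous (fun t => expR (- t) : R)}.
  by apply: (continuous_comp (f := -%R)); [exact: opp_continuous|exact: continuous_expR].
have : (\int[mu]_(t in D) (f t)%:E = 0)%E.
  (* The left end 1 / (n + 2) keeps the interval nondegenerate at n = 0. *)
  apply: (@integral_derivative_eq0 _ D (fun t => t `^ y * expR (- t)) _
    (fun n => n.+2%:R^-1) (fun n => n.+1%:R)) => //.
  - move=> n; apply: (@lt_le_trans _ _ 1); last by rewrite ler1n.
    by rewrite invf_lt1// ltr1n.
  - move=> n x /=; rewrite !in_itv/= andbT => /andP[h _]; apply: lt_le_trans h.
    by rewrite invr_gt0.
  - move=> x; rewrite /= in_itv/= andbT => x0.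
    exists (maxn (Num.truncn x) (Num.truncn x^-1)) => // n /=; rewrite geq_max => /andP[n1 n2].
    apply/andP; split.
      rewrite -[leRHS]invrK lef_pV2 ?posrE ?invr_gt0//.
      apply: ltW; apply: lt_le_trans (truncnS_gt _) _.
      by rewrite ler_nat ltnW// !ltnS.
    apply: ltW; apply: lt_le_trans (truncnS_gt _) _.
    by rewrite ler_nat ltnS.
  - move=> x; rewrite /= in_itv/= andbT => x0.
    have dp := is_derive1_powR y x0.
    apply: (@trigger_derive _ ((fun t => t `^ y) * (fun t => expR (- t)))).
    by rewrite /f /GRing.scale/=; ring.
  - move=> x; rewrite inE/= in_itv/= andbT => x0.
    apply: cvgB; last by apply: cvgM; [exact: pc|exact: ec].
    apply: cvgM; first exact: cvg_cst.
    by apply: cvgM; [exact: pc|exact: ec].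
  - apply: (@squeeze_cvgr _ _ _ _ (cst 0) (fun n => n.+2%:R^-1)) => //.
    + apply: nearW => n; rewrite mulr_ge0 ?powR_ge0 ?expR_ge0//=.
      apply: (@le_trans _ _ ((n.+2%:R^-1) `^ y)).
        rewrite ler_piMr ?powR_ge0// -[leRHS]expR0 ler_expR oppr_le0 invr_ge0//.
      apply: ge1r_powR => //; apply/andP; split; first by rewrite invr_gt0.
      by rewrite invf_le1// ler1n.
    + exact: cvg_cst.
    + by have := @cvg_harmonic R; rewrite -cvg_shiftS.
  - have [C C0 aC] := powR_expRN_le (ltW y0).
    apply: (@squeeze_cvgr _ _ _ _ (cst 0) (fun n => (2 * C) * n.+1%:R^-1)) => //.
    + apply: nearW => n; rewrite mulr_ge0 ?powR_ge0 ?expR_ge0//=.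
      apply: (le_trans (aC _ _)) => //.
      rewrite (mulrC 2 C) -(mulrA C) ler_pM2l// expRN -ler_pdivrMl// -invfM.
      rewrite lef_pV2 ?posrE ?mulr_gt0 ?expR_gt0//.
      by have := expR_ge1Dx (2^-1 * n.+1%:R : R); lra.
    + exact: cvg_cst.
    + by rewrite -[X in _ --> X](mulr0 (2 * C)); apply: cvgM; [exact: cvg_cst|exact: cvg_harmonic].
move=> h; have : \int[mu]_(t in D) f t = 0 by rewrite /Rintegral h.
rewrite /f RintegralB// RintegralZl// => /eqP; rewrite subr_eq0 => /eqP.
by rewrite /Gamma addrK => ->.
Qed.

(** The integrand is at least exp (-2) on [1, 2]. *)
Lemma Gamma_gt0 (y : R) : 1 <= y -> 0 < Gamma y.
Proof.
move=> y1.
have I : mu.-integrable D (EFin \o (fun t => t `^ (y - 1) * expR (- t))).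
  by apply: gamma_integrable; rewrite subr_ge0.
rewrite /Gamma -lte_fin /Rintegral fineK; last exact: integrable_fin_num.
apply: (@lt_le_trans _ _ (expR (- 2) : R)%:E); first by rewrite lte_fin expR_gt0.
apply: (@le_trans _ _ (\int[mu]_(t in `[1%R, 2%R]) (t `^ (y - 1) * expR (- t))%:E)%E); last first.
  apply: ge0_subset_integral => //.
  - exact: measurable_int I.
  - by move=> t _; rewrite lee_fin mulr_ge0 ?powR_ge0 ?expR_ge0.
  - move=> t; rewrite /= !in_itv/= andbT => /andP[h _]; exact: lt_le_trans h.
apply: (@le_trans _ _ (\int[mu]_(t in `[1%R, 2%R]) cst (expR (- 2) : R)%:E t)%E).
  rewrite integral_cst//= lebesgue_measure_itv/= lte_fin ltr1n/=.
  by rewrite -EFinB -EFinM lee_fin -[leLHS]mulr1 ler_wpM2l ?expR_ge0//; lra.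
apply: ge0_le_integral => //.
- by move=> t _; rewrite lee_fin expR_ge0.
- have mI : measurable_fun D (fun t => (t `^ (y - 1) * expR (- t))%:E) by exact: measurable_int I.
  apply: measurable_funS mI => //.
  by move=> t; rewrite /= !in_itv/= andbT => /andP[h _]; exact: lt_le_trans h.
move=> t; rewrite /= in_itv/= => /andP[t1 t2]; rewrite lee_fin.
rewrite -[leLHS]mul1r; apply: ler_pM; rewrite ?expR_ge0// ?ler_expR ?lerN2//.
by rewrite -[leLHS](powRr0 t) ler_powR// subr_ge0.
Qed.

Lemma gen_factD1 (x : R) : 0 <= x -> gen_fact (x + 1) = (x + 1) * gen_fact x.
Proof.
move=> x0; rewrite /gen_fact.
have [/natrP[n xn]|xn] := boolP (x \is a Num.nat).
  rewrite xn natr1 natr_nat !natrK factS natrM//.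
case: ifPn => [/natrP[n x1n]|_].
  exfalso; apply/negP: xn; rewrite negbK; apply/natrP.
  case: n x1n => [|n] x1n; first by have := ltr_wpDl x0 (@ltr01 R); rewrite x1n ltxx.
  by exists n; move: x1n; rewrite -natr1 => /addIr.
by rewrite GammaD1// lerDr.
Qed.

Lemma gen_fact_gt0 (x : R) : 0 <= x -> 0 < gen_fact x.
Proof.
move=> x0; rewrite /gen_fact; case: ifPn => _; first by rewrite ltr0n fact_gt0.
by apply: Gamma_gt0; rewrite lerDr.
Qed.

End gamma_function.

(** * Two-sided bounds of order gamma k^-alpha for the three weights *)

Section weights_asymptotics.
Context {R : realType}.

(** Young's inequality for x and 1 with the conjugate exponents a and a / (a - 1), multiplied by
    a. *)
Lemma powR_bernoulli (x a : R) : 0 <= x -> 1 < a -> 1 + a * (x - 1) <= x `^ a.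
Proof.
move=> x0 a1; have a0 : 0 < a by apply: lt_trans a1.
have := @conjugate_powR R x 1 a (a / (a - 1)) x0 ler01 a0.
rewrite divr_gt0 ?subr_gt0// mulr1 powR1 => /(_ isT).
have -> : a^-1 + (a / (a - 1))^-1 = 1.
  by field; rewrite !gt_eqF ?subr_gt0.
move=> /(_ erefl) h.
have e : a * (x `^ a / a + 1 / (a / (a - 1))) = x `^ a + (a - 1).
  by field; rewrite !gt_eqF ?subr_gt0.
have := ler_wpM2l (ltW a0) h; rewrite e; lra.
Qed.

Lemma powR_div (x y a : R) : 0 <= x -> 0 <= y -> (x / y) `^ a = x `^ a / y `^ a.
Proof.
move=> x0 y0; rewrite powRM ?invr_ge0//; congr (_ * _).
by rewrite -(powR_inv1 y0) -powRrM mulN1r powRN.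
Qed.

Definition r_factor (alpha : R) (k : nat) : R :=
  if k%:R < alpha then k`!%:R^-1 else gen_fact (k%:R - alpha) / k`!%:R.

Lemma r_weightE alpha gamma k : (0 < k)%N -> r_weight alpha gamma k = gamma * r_factor alpha k.
Proof. by rewrite /r_weight /r_factor; case: k => // k _ /=; case: ifP. Qed.

Lemma r_factor_gt0 alpha k : 0 < r_factor alpha k.
Proof.
rewrite /r_factor; case: ifPn => h; first by rewrite invr_gt0 ltr0n fact_gt0.
rewrite -leNgt in h; by rewrite divr_gt0 ?ltr0n ?fact_gt0// gen_fact_gt0// subr_ge0.
Qed.

Lemma r_factorS alpha k : alpha <= k%:R ->
  r_factor alpha k.+1 = r_factor alpha k * (1 - alpha / k.+1%:R).
Proof.
move=> ak; rewrite /r_factor !ltNge ak (le_trans ak) ?ler_nat//=.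
have -> : k.+1%:R - alpha = (k%:R - alpha) + 1 by rewrite -natr1; ring.
rewrite gen_factD1 ?subr_ge0// factS natrM.
have -> : k%:R - alpha + 1 = k.+1%:R - alpha by rewrite -natr1; ring.
by field; rewrite nat1r !pnatr_eq0 -!lt0n fact_gt0.
Qed.

Lemma r_factor_upper alpha : 1 < alpha ->
  exists2 C, 0 < C & forall k, (0 < k)%N -> r_factor alpha k <= C * k%:R `^ (- alpha).
Proof.
move=> a1; have a0 : 0 < alpha by apply: lt_trans a1.
pose k0 := (Num.truncn alpha).+1.
have k0a : alpha <= k0%:R by apply: ltW; exact: truncnS_gt.
(* Bernoulli's inequality makes this product monotone. *)
have dec k : (k0 <= k)%N -> r_factor alpha k * k%:R `^ alpha <= r_factor alpha k0 * k0%:R `^ alpha.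
  elim: k => [|k IH]; first by rewrite leqn0 => /eqP <-.
  rewrite leq_eqVlt => /predU1P[<-//|]; rewrite ltnS => k0k; apply: le_trans (IH k0k).
  have ak : alpha <= k%:R by apply: le_trans k0a _; rewrite ler_nat.
  have k00 : (0 < k)%N by apply: leq_trans k0k.
  rewrite r_factorS// -mulrA ler_pM2l ?r_factor_gt0//.
  rewrite -ler_pdivlMr ?powR_gt0//.
  have -> : k%:R `^ alpha / k.+1%:R `^ alpha = (k%:R / k.+1%:R) `^ alpha :> R.
    by rewrite powR_div.
  have := @powR_bernoulli (k%:R / k.+1%:R) alpha _ a1.
  have -> : 1 + alpha * (k%:R / k.+1%:R - 1) = 1 - alpha / k.+1%:R.
    by rewrite -natr1; field; rewrite natr1 pnatr_eq0.
  by apply; rewrite divr_ge0.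
have t0 k : 0 <= r_factor alpha k * k%:R `^ alpha.
  by rewrite mulr_ge0 ?powR_ge0// ltW// r_factor_gt0.
(* A sum of nonnegative terms bounds each of them, which covers the indices up to k0; monotonicity
   covers the others. *)
pose C := \sum_(i < k0.+1) r_factor alpha i * i%:R `^ alpha.
have tC k : (k <= k0)%N -> r_factor alpha k * k%:R `^ alpha <= C.
  move=> kk0; rewrite -ltnS in kk0.
  by rewrite /C (bigD1 (Ordinal kk0))//= lerDl sumr_ge0.
exists C.
  by apply: lt_le_trans (tC k0 (leqnn _)); rewrite mulr_gt0 ?r_factor_gt0 ?powR_gt0// ltr0n.
move=> k k1; have k0' : 0 < k%:R :> R by rewrite ltr0n.
rewrite powRN ler_pdivlMr ?powR_gt0//.
have [/dec h|kk0] := leqP k0 k; first by rewrite (le_trans h)// tC.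
by apply: tC; exact: ltnW.
Qed.

Lemma r_factor_lower alpha : 1 < alpha ->
  exists c K, 0 < c /\ forall k, (K <= k)%N -> c * k%:R `^ (- alpha) <= r_factor alpha k.
Proof.
move=> a1; have a0 : 0 < alpha by apply: lt_trans a1.
pose k1 := (Num.truncn alpha).+2.
have k1a : alpha + 1 < k1%:R.
  by rewrite /k1 -[X in _ < X]natr1 ltrD2r; exact: truncnS_gt.
(* The shift by alpha reverses the monotonicity. *)
have inc k : (k1 <= k)%N ->
    r_factor alpha k1 * (k1%:R - alpha) `^ alpha <= r_factor alpha k * (k%:R - alpha) `^ alpha.
  elim: k => [|k IH]; first by rewrite leqn0 => /eqP <-.
  rewrite leq_eqVlt => /predU1P[<-//|]; rewrite ltnS => k1k; apply: le_trans (IH k1k) _.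
  have ak : alpha + 1 < k%:R by apply: lt_le_trans k1a _; rewrite ler_nat.
  rewrite r_factorS; last by lra.
  rewrite -mulrA ler_pM2l ?r_factor_gt0//.
  have m0 : 0 < k%:R - alpha by lra.
  have m1 : 0 < k.+1%:R - alpha by rewrite -natr1; lra.
  have kn0 : 0 < k.+1%:R :> R by [].
  have -> : 1 - alpha / k.+1%:R = (k.+1%:R - alpha) / k.+1%:R by field; rewrite gt_eqF.
  rewrite mulrAC ler_pdivlMr// mulrC -ler_pdivlMr ?powR_gt0//.
  have -> : (k.+1%:R - alpha) * (k.+1%:R - alpha) `^ alpha / (k%:R - alpha) `^ alpha =
     (k.+1%:R - alpha) * ((k.+1%:R - alpha) / (k%:R - alpha)) `^ alpha.
    by rewrite powR_div ?(ltW m0) ?(ltW m1)// mulrA.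
  have q0 : 0 <= (k.+1%:R - alpha) / (k%:R - alpha) by rewrite divr_ge0// ltW.
  have := powR_bernoulli q0 a1 => h.
  have e : (k.+1%:R - alpha) / (k%:R - alpha) - 1 = (k%:R - alpha)^-1.
    by rewrite -natr1; field; rewrite gt_eqF.
  rewrite e in h; apply: le_trans (ler_wpM2l (ltW m1) h).
  rewrite mulrDr mulr1 -lerBlDl opprB addrC subrK mulrCA ler_peMr ?(ltW a0)//.
  by rewrite ler_pdivlMr// mul1r lerD2r ler_nat.
exists (r_factor alpha k1 * (k1%:R - alpha) `^ alpha), k1; split.
  by rewrite mulr_gt0 ?r_factor_gt0// powR_gt0//; lra.
move=> k k1k; have k0 : 0 < k%:R :> R by rewrite ltr0n; exact: leq_trans k1k.
rewrite powRN ler_pdivrMr ?powR_gt0//; apply: (le_trans (inc k k1k)).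
rewrite ler_pM2l ?r_factor_gt0//.
have ak : alpha + 1 < k%:R by apply: lt_le_trans k1a _; rewrite ler_nat.
apply: ge0_ler_powR; rewrite ?nnegrE; lra.
Qed.

(** For k >= a the term tau = a suffices: each of its a factors is at least k - a + 1 >= k / a. For
    k < a the term tau = 1 is at least 1, while k^a <= a^a. *)
Lemma beta_sum_lower (a k : nat) : (1 < a)%N -> (0 < k)%N ->
  k%:R ^+ a <= a%:R ^+ a * \sum_(1 <= tau < a.+1) @beta_coef R tau k.
Proof.
move=> a1 k0.
have b0 tau : 0 <= @beta_coef R tau k.
  by rewrite /beta_coef; case: ifP => // _; rewrite divr_ge0.
have bE tau : (tau <= k)%N -> @beta_coef R tau k = (k ^_ tau)%:R.
  by move=> h; rewrite /beta_coef h -(ffact_fact h) natrM mulfK.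
have ge1 tau : (1 <= tau < a.+1)%N ->
    @beta_coef R tau k <= \sum_(1 <= i < a.+1) @beta_coef R i k.
  move=> ta; rewrite (bigD1_seq tau) ?mem_index_iota ?iota_uniq//= lerDl.
  by apply: sumr_ge0.
have [ak|ka] := leqP a k.
  apply: (@le_trans _ _ (a%:R ^+ a * @beta_coef R a k)); last first.
    by rewrite ler_wpM2l ?exprn_ge0// ge1// ltnSn andbT ltnW.
  rewrite bE// -!natrX -natrM ler_nat ffact_prod.
  rewrite -[in X in (X <= _)%N](card_ord a) -[in X in (_ <= _ ^ X * _)%N](card_ord a).
  rewrite -!prod_nat_const -big_split/=; apply: leq_prod => i _.
  apply: (@leq_trans (a * (k - a.-1))).
    have [d ->] : exists d, k = (d + a)%N by exists (k - a)%N; rewrite subnK.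
    case: a a1 i {ge1 ak} => // a a1 i.
    rewrite /= addnS -addSn addnK mulSn; by rewrite leq_add2l leq_pmulr.
  by rewrite leq_mul2l leq_sub2l ?orbT// -ltnS prednK ?ltn_ord// ltnW.
apply: (@le_trans _ _ (a%:R ^+ a * 1)).
  by rewrite mulr1 lerXn2r ?nnegrE// ler_nat ltnW.
rewrite ler_wpM2l ?exprn_ge0//; apply: le_trans (ge1 1%N _); last by rewrite leqnn ltnS ltnW.
by rewrite bE// ffactn1 ler1n.
Qed.

Lemma beta_sum_upper (a k : nat) : (0 < k)%N ->
  \sum_(1 <= tau < a.+1) @beta_coef R tau k <= a%:R * k%:R ^+ a.
Proof.
move=> k0.
have bE tau : (1 <= tau < a.+1)%N -> @beta_coef R tau k <= k%:R ^+ a.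
  move=> /andP[_ ta]; rewrite /beta_coef; case: ifP => [h|_]; last by rewrite exprn_ge0.
  rewrite -(ffact_fact h) natrM mulfK// -natrX ler_nat.
  apply: (@leq_trans (k ^ tau)); last by rewrite leq_pexp2l.
  rewrite ffact_prod -[X in (_ <= _ ^ X)%N](card_ord tau) -prod_nat_const.
  by apply: leq_prod => i _; exact: leq_subr.
apply: (@le_trans _ _ (\sum_(1 <= tau < a.+1) k%:R ^+ a)).
  by rewrite !big_nat; apply: ler_sum => tau; exact: bE.
by rewrite sumr_const_nat subSS subn0 mulr_natl.
Qed.

(** Later arguments see the weights only through these bounds, whose constants do not depend on
    gamma. The case k = 1 is stated apart because multi-indices of degree one need it, while the
    general lower bound starts at K. *)
Lemma weight_bounds (alpha : R) (w : R -> nat -> R) : 1 < alpha -> fourier_weight alpha w ->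
  exists c C K, [/\ 0 < c, 0 < C & forall gamma, 0 < gamma <= 1 ->
    [/\ w gamma 0%N = 1, c * gamma <= w gamma 1%N,
        forall k, (0 < k)%N -> 0 < w gamma k <= C * gamma * k%:R `^ (- alpha) &
        forall k, (K <= k)%N -> (0 < k)%N -> c * gamma * k%:R `^ (- alpha) <= w gamma k]].
Proof.
move=> a1 [||a aE].
- have [C C0 rC] := r_factor_upper a1; have [c [K [c0 rc]]] := r_factor_lower a1.
  exists (Num.min c 1), C, K; split => // [|gamma /andP[g0 g1]].
    by rewrite lt_min c0 ltr01.
  split => [//||k k0|k Kk k0].
  + rewrite r_weightE// /r_factor a1 (factS 0) fact0 mul1n invr1 mulr1.
    by rewrite ler_piMl ?(ltW g0)// ge_min lexx orbT.
  + rewrite r_weightE// mulr_gt0 ?r_factor_gt0//= (mulrC C) -mulrA ler_pM2l//.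
    exact: rC.
  + rewrite r_weightE// mulrAC mulrC ler_pM2l//; apply: le_trans (rc k Kk).
    by rewrite ler_wpM2r ?powR_ge0// ge_min lexx.
- exists 1, 1, 0%N; split => // gamma /andP[g0 g1].
  split => [//||k k0|k _ k0].
  + by rewrite /rho_weight/= powR1 mulr1 mul1r.
  + rewrite /rho_weight; case: k k0 => // k _ /=.
    by rewrite mul1r lexx andbT mulr_gt0// powR_gt0.
  + by rewrite /rho_weight; case: k k0 => // k _ /=; rewrite mul1r.
have a1' : (1 < a)%N by rewrite -(ltr1n R) -aE.
have a0 : (0 < a)%N by apply: ltnW.
have aR0 : 0 < a%:R :> R by rewrite ltr0n.
(* With S the sum of the beta coefficients, 1 + S / gamma lies between k^a / (a^a gamma) and (1 + a)
   k^a / gamma; the upper estimate uses gamma <= 1 <= k^a. *)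
exists (1 + a%:R)^-1, (a%:R ^+ a), 0%N; split => [||gamma /andP[g0 g1]].
- by rewrite invr_gt0 addr_gt0.
- by rewrite exprn_gt0.
have lo k : (0 < k)%N -> (1 + a%:R)^-1 * gamma * k%:R `^ (- alpha) <= psi_weight a gamma k.
  move=> k0; have kR : 1 <= k%:R ^+ a :> R by rewrite exprn_ege1// ler1n.
  have k0' : 0 < k%:R ^+ a :> R by apply: lt_le_trans kR.
  have S0 : 0 <= \sum_(1 <= tau < a.+1) @beta_coef R tau k.
    by apply: sumr_ge0 => tau _; rewrite /beta_coef; case: ifP => // _; rewrite divr_ge0.
  rewrite /psi_weight aE powR_invn// -[X in X * _ * _]div1r.
  have -> : 1 / (1 + a%:R) * gamma * k%:R ^- a = ((1 + a%:R) * gamma^-1 * k%:R ^+ a)^-1.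
    by rewrite !invfM invrK mul1r.
  have P0 : 0 < (1 + a%:R) * gamma^-1 * k%:R ^+ a.
    by rewrite !mulr_gt0 ?invr_gt0// addr_gt0.
  have Q0 : 0 < 1 + gamma^-1 * \sum_(1 <= tau < a.+1) @beta_coef R tau k.
    by rewrite ltr_pwDl// mulr_ge0// invr_ge0 ltW.
  rewrite lef_pV2 ?posrE//.
  have gi : 1 <= gamma^-1 by rewrite invf_ge1.
  have := beta_sum_upper a k0; set S := \sum_(1 <= tau < _) _ => Sle.
  have h1 : gamma^-1 * S <= gamma^-1 * (a%:R * k%:R ^+ a) by rewrite ler_wpM2l// invr_ge0 ltW.
  have h2 : 1 <= gamma^-1 * k%:R ^+ a by rewrite mulr_ege1.
  have -> : (1 + a%:R) * gamma^-1 * k%:R ^+ a = gamma^-1 * k%:R ^+ a + gamma^-1 * (a%:R * k%:R ^+ a) by ring.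
  lra.
split => [||k k0|k _ k0]; last exact: lo.
- rewrite /psi_weight big_nat big1 ?mulr0 ?addr0 ?invr1// => tau /andP[t1 _].
  by rewrite /beta_coef leqNgt t1.
- by have := lo 1%N isT; rewrite powR1 mulr1.
have kR : 0 < k%:R ^+ a :> R by rewrite exprn_gt0// ltr0n.
have Sl := beta_sum_lower a1' k0.
rewrite /psi_weight aE powR_invn//; set S := \sum_(1 <= tau < _) _ in Sl *.
have S0 : 0 < S.
  have : 0 < a%:R ^+ a * S by apply: lt_le_trans Sl.
  by rewrite pmulr_rgt0// exprn_gt0.
have gS : 0 < gamma^-1 * S by rewrite mulr_gt0// invr_gt0.
rewrite invr_gt0 addr_gt0//=.
apply: (@le_trans _ _ (gamma^-1 * S)^-1).
  by rewrite lef_pV2 ?posrE ?addr_gt0// lerDr.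
by rewrite invfM invrK (mulrC (a%:R ^+ a)) -mulrA ler_pM2l// ler_pdivlMr// mulrC ler_pdivrMr.
Qed.

End weights_asymptotics.

(** * Complexity of the weighted Hermite spaces *)

Section product_sums.
Context {R : realType}.

Lemma powRN_sum_le (r : R) n : 0 < r ->
  \sum_(1 <= k < n.+1) k%:R `^ (- (1 + r)) <= 1 + r^-1.
Proof.
move=> r0; have ri : 0 < r^-1 by rewrite invr_gt0.
case: n => [|n]; first by rewrite big_geq// addr_ge0// ltW.
(* The added term is the integral of x^-(1+r) over [n+1, +oo[. *)
suff : \sum_(1 <= k < n.+2) k%:R `^ (- (1 + r)) + r^-1 * n.+1%:R `^ (- r) <= 1 + r^-1.
  by apply: le_trans; rewrite lerDl mulr_ge0 ?powR_ge0// ltW.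
elim: n => [|n IH]; first by rewrite big_nat1 !powR1 mulr1.
rewrite big_nat_recr//=; apply: le_trans IH; rewrite -addrA lerD2l.
set x : R := n.+1%:R; have x0 : 0 < x by rewrite /x ltr0n.
have -> : n.+2%:R = x + 1 by rewrite natr1.
have y0 : 0 < x + 1 by rewrite addr_gt0.
rewrite opprD powRD; last by rewrite (gt_eqF y0) implybT.
rewrite powR_inv1 ?(ltW y0)//.
set E := (x + 1) `^ (- r); have E0 : 0 < E by rewrite powR_gt0.
(* This combines exp y >= 1 + y with ln ((x + 1) / x) = - ln (1 - 1 / (x + 1)) >= 1 / (x + 1). *)
have h : 1 + r * (x + 1)^-1 <= ((x + 1) / x) `^ r.
  have q0 : 0 < (x + 1) / x by rewrite divr_gt0.
  have -> : ((x + 1) / x) `^ r = expR (r * ln ((x + 1) / x)).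
    by rewrite /powR gt_eqF.
  apply: le_trans (expR_ge1Dx _); rewrite lerD2l ler_pM2l//.
  have := expR_ge1Dx (ln (x / (x + 1))); rewrite lnK ?posrE ?divr_gt0//.
  have -> : ln ((x + 1) / x) = - ln (x / (x + 1)).
    by rewrite -lnV ?posrE ?divr_gt0// invf_div.
  have -> : x / (x + 1) = 1 - (x + 1)^-1 by field; rewrite gt_eqF.
  lra.
have e : x `^ (- r) = ((x + 1) / x) `^ r * E.
  rewrite powR_div ?(ltW x0) ?(ltW y0)// /E !powRN.
  by field; rewrite !gt_eqF ?powR_gt0.
rewrite e.
have := ler_wpM2l (ltW ri) (ler_wpM2r (ltW E0) h).
have -> : r^-1 * ((1 + r / (x + 1)) * E) = r^-1 * E + (x + 1)^-1 * E.
  by field; rewrite !gt_eqF.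
lra.
Qed.

Lemma sum_tuple_box_le s m (a : 'I_s -> nat -> R) (F : seq (s.-tuple nat)) :
  (forall j k, 0 <= a j k) -> uniq F ->
  (forall k j, k \in F -> (tnth k j < m.+1)%N) ->
  \sum_(k <- F) \prod_j a j (tnth k j) <= \prod_j \sum_(i < m.+1) a j i.
Proof.
move=> a0 uF Fm; rewrite bigA_distr_bigA/=.
pose phi (k : s.-tuple nat) : {ffun 'I_s -> 'I_m.+1} := [ffun j => inord (tnth k j)].
pose G (f : {ffun 'I_s -> 'I_m.+1}) := \prod_j a j (f j).
have phiK k : k \in F -> forall j, phi k j = tnth k j :> nat.
  by move=> kF j; rewrite ffunE inordK// Fm.
have uphi : uniq (map phi F).
  rewrite map_inj_in_uniq// => k l kF lF kl.
  by apply: eq_from_tnth => j; rewrite -phiK// kl phiK.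
have -> : \sum_(k <- F) \prod_j a j (tnth k j) = \sum_(f <- map phi F) G f.
  rewrite big_map; rewrite !big_seq; apply: eq_bigr => k kF.
  by apply: eq_bigr => j _; rewrite phiK.
rewrite big_uniq// [leRHS](bigID (mem (map phi F)))/= lerDl.
by apply: sumr_ge0 => f _; exact: prodr_ge0.
Qed.

(** A finite set of multi-indices lies in a box, on which the product of partial sums expands. *)
Lemma esum_prod_le s (a : 'I_s -> nat -> R) (A : 'I_s -> R) :
  (forall j k, 0 <= a j k) ->
  (forall j m, \sum_(i < m) a j i <= A j) ->
  (\esum_(k in [set: s.-tuple nat]) (\prod_j a j (tnth k j))%:E <= (\prod_j A j)%:E)%E.
Proof.
move=> a0 aA; apply: ge_ereal_sup => _ [F [finF _] <-].
rewrite fsbig_finite//= sumEFin lee_fin.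
pose r : seq (s.-tuple nat) := finmap.enum_fset (fset_set F).
pose m := \max_(k <- r) \max_j tnth k j.
apply: (le_trans (@sum_tuple_box_le s m a r a0 _ _)).
- exact: finmap.fset_uniq.
- move=> k j kr; rewrite ltnS.
  apply: (@leq_trans (\max_j tnth k j)); first exact: (@leq_bigmax _ (fun j => tnth k j) j).
  exact: (@leq_bigmax_seq _ r xpredT (fun k : s.-tuple nat => \max_j tnth k j) k kr isT).
by apply: ler_prod => j _; rewrite aA sumr_ge0.
Qed.

Lemma prod_weight_powR (w : R -> nat -> R) (gamma : nat -> R) s (p : R) (k : s.-tuple nat) :
  (forall j i, 0 < w (gamma j) i) ->
  prod_weight w gamma k `^ p = \prod_(j < s) w (gamma j) (tnth k j) `^ p.
Proof.
move=> w0; rewrite /prod_weight.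
suff [] : 0 <= \prod_(j < s) w (gamma j) (tnth k j) /\
    (\prod_(j < s) w (gamma j) (tnth k j)) `^ p = \prod_(j < s) w (gamma j) (tnth k j) `^ p by [].
apply: (big_rec2 (fun x y => 0 <= x /\ x `^ p = y)); first by rewrite powR1.
move=> j x y _ [x0 <-]; split; first by rewrite mulr_ge0// ltW.
by rewrite powRM// ltW.
Qed.

Lemma complexity_upper (alpha : R) (w : R -> nat -> R) (gamma : nat -> R) (p : R) :
  1 < alpha -> fourier_weight alpha w -> (forall j, 0 < gamma j <= 1) ->
  p <= 1 -> 1 < p * alpha ->
  exists A Z, [/\ 1 <= A, 0 <= Z & forall s eps, (0 < s)%N -> 0 < eps < 1 ->
    (inf_compl (prod_weight w gamma (s := s)) eps <=
      (A * expR (Z * \sum_(0 <= j < s) gamma j `^ p) * eps `^ (- (2 * p)))%:E)%E].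
Proof.
move=> a1 hw g01 p1 pa; have a0 : 0 < alpha by apply: lt_trans a1.
have p0 : 0 < p by rewrite -(pmulr_lgt0 _ a0); apply: lt_trans pa.
have [c [C [K [c0 C0 wb]]]] := weight_bounds a1 hw.
have w0 j i : 0 < w (gamma j) i.
  have [w00 _ wup _] := wb _ (g01 j).
  by case: i => [|i]; [rewrite w00|have /andP[] := wup i.+1 isT].
have g0 j : 0 <= gamma j by case/andP: (g01 j) => /ltW.
(* The exponent q stays free: q = p bounds the complexity, and q = 1 gives the summability of the
   weights. *)
pose Z q := C `^ q * (1 + (q * alpha - 1)^-1).
have Z0 q : 1 < q * alpha -> 0 <= Z q.
  by move=> qa; rewrite mulr_ge0 ?powR_ge0// addr_ge0// invr_ge0 subr_ge0 ltW.
have sumw q j m : 0 < q -> 1 < q * alpha ->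
    \sum_(i < m) w (gamma j) i `^ q <= 1 + gamma j `^ q * Z q.
  move=> q0 qa; case: m => [|m].
    by rewrite big_ord0 addr_ge0// mulr_ge0 ?powR_ge0// Z0.
  have [w00 _ wup _] := wb _ (g01 j).
  rewrite big_ord_recl/= w00 powR1 lerD2l.
  have qa0 : 0 < q * alpha - 1 by rewrite subr_gt0.
  apply: le_trans (ler_wpM2l _ (ler_wpM2l _ (powRN_sum_le m qa0))); rewrite ?powR_ge0//.
  rewrite big_add1/= big_mkord !mulr_sumr; apply: ler_sum => i _.
  rewrite /bump/= add1n; have /andP[wi0 wi] := wup i.+1 isT.
  have -> : - (1 + (q * alpha - 1)) = - alpha * q by ring.
  rewrite powRrM mulrA -!powRM ?mulr_ge0 ?powR_ge0 ?(ltW C0)//.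
  apply: ge0_ler_powR; rewrite ?nnegrE ?mulr_ge0 ?powR_ge0 ?(ltW C0) ?(ltW q0) ?(ltW wi0)//.
  by rewrite (mulrC _ C).
have sumR q s : 0 < q -> 1 < q * alpha ->
    (\esum_(k in [set: s.-tuple nat]) (prod_weight w gamma k `^ q)%:E <=
      (expR (Z q * \sum_(0 <= j < s) gamma j `^ q))%:E)%E.
  move=> q0 qa; under eq_esum => k _ do rewrite prod_weight_powR//.
  apply: (le_trans (@esum_prod_le s (fun j i => w (gamma j) i `^ q)
    (fun j => 1 + gamma j `^ q * Z q) _ _)).
  - by move=> j k; exact: powR_ge0.
  - by move=> j m; exact: sumw.
  rewrite lee_fin mulr_sumr expR_sum big_mkord; apply: ler_prod => j _.
  have h0 : 0 <= gamma j `^ q * Z q by apply: mulr_ge0; [exact: powR_ge0|exact: Z0].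
  by rewrite addr_ge0//= (mulrC (Z q)) expR_ge1Dx.
exists 666, (Z p); split; [by rewrite ler1n|exact: Z0|].
move=> s eps s0 eps01; apply: inf_compl_le => //.
- by move=> k; rewrite prodr_gt0.
- exists [tuple 0%N | _ < s]; rewrite /prod_weight big1// => j _.
  by rewrite tnth_mktuple; have [] := wb _ (g01 j).
- have := sumR 1 s ltr01; rewrite mul1r => /(_ a1).
  rewrite (eq_esum (b := fun k => (prod_weight w gamma k)%:E)); last first.
    by move=> k _; rewrite powRr1// prodr_ge0// => j _; exact: ltW.
  by move/le_lt_trans; apply; rewrite ltry.
- by rewrite p0.
- exact: sumR.
Qed.

End product_sums.

Lemma seps_infty_filter (R : realType) : Filter (@seps_infty R).
Proof.
apply: filter_fromT_filter; first by exists 0.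
move=> i j; exists (Num.max i j) => -[s eps] /= [s0 e01].
by rewrite ge_max => /andP[].
Qed.

#[local] Existing Instance seps_infty_filter.

(** * From complexity bounds to tractability *)

Section tractability_criteria.
Context {R : realType}.
Variables (N : R -> nat -> \bar R) (S : nat -> R) (A Z : R).
Hypothesis A1 : 1 <= A.
Hypothesis Z0 : 0 <= Z.
Hypothesis S_bounds : forall s, 0 <= S s <= s%:R.
Hypothesis N_ge1 : forall s eps, (0 < s)%N -> 0 < eps < 1 -> (1 <= N eps s)%E.
Hypothesis N_le : forall s eps, (0 < s)%N -> 0 < eps < 1 ->
  (N eps s <= (A * expR (Z * S s) * eps `^ (- 2))%:E)%E.

Lemma lne_N_le s eps : (0 < s)%N -> 0 < eps < 1 ->
  exists2 r, lne (N eps s) = r%:E & 0 <= r <= ln A + Z * S s + 2 * ln eps^-1.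
Proof.
move=> s0 eps01; have := N_ge1 s0 eps01; have := N_le s0 eps01.
case/andP: eps01 => e0 e1.
case: (N eps s) => [x| |]//; rewrite !lee_fin => xB x1.
have x0 : 0 < x by apply: lt_le_trans x1.
have A0 : 0 < A by apply: lt_le_trans A1.
exists (ln x); first by rewrite lne_EFin.
rewrite ln_ge0//=.
have -> : ln A + Z * S s + 2 * ln eps^-1 = ln (A * expR (Z * S s) * eps `^ (- 2)).
  rewrite !lnM ?posrE ?mulr_gt0 ?expR_gt0 ?powR_gt0// expRK ln_powR lnV ?posrE//.
  by rewrite mulNr mulrN.
by rewrite ler_ln ?posrE ?mulr_gt0 ?expR_gt0 ?powR_gt0.
Qed.

(** This is ln y <= y at y = eps^(- tau / 2). Halving tau allows the result to be absorbed in a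
    small multiple of y^2 = eps^(- tau). *)
Lemma ln_inv_le (tau eps : R) : 0 < tau -> 0 < eps < 1 ->
  2 * ln eps^-1 <= 4 / tau * eps `^ (- (tau / 2)).
Proof.
move=> tau0 /andP[e0 e1].
have p0 : 0 < eps `^ (- (tau / 2)) by rewrite powR_gt0.
have h : ln (eps `^ (- (tau / 2))) <= eps `^ (- (tau / 2)).
  have := expR_ge1Dx (ln (eps `^ (- (tau / 2)))); rewrite lnK ?posrE//; lra.
rewrite ln_powR mulNr -mulrN -lnV ?posrE// in h.
have := ler_wpM2l (ltW (divr_gt0 (ltr0n R 4) tau0)) h; apply: le_trans.
by rewrite (_ : 4 / tau * _ = 2 * ln eps^-1)//; field; rewrite gt_eqF.
Qed.

(** With e' = e / 3, the term Z S s is at most e' s^sigma and the logarithm of 1 / eps contributes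
    at most e' eps^(- tau), both up to constants. All constants are gathered in [A'] and are at most
    2 e' (s^sigma + eps^(- tau)) once s + 1 / eps is large. *)
Lemma stWT_criterion (sigma tau : R) : 0 < sigma -> 0 < tau ->
  (fun s : nat => (s%:R `^ sigma)^-1 * S s) @ \oo --> (0 : R) -> stWT N sigma tau.
Proof.
move=> sg0 tau0 cS.
have bound (e : R) : 0 < e -> exists M : R, forall s eps, (0 < s)%N -> 0 < eps < 1 ->
    M <= s%:R + eps^-1 ->
    ln A + Z * S s + 2 * ln eps^-1 <= e * (s%:R `^ sigma + eps `^ (- tau)).
  move=> e0; pose e' := e / 3.
  have e'0 : 0 < e' by rewrite divr_gt0.
  have Z1 : 0 < Z + 1 by rewrite ltr_wpDl.
  have d0 : 0 < e' / (Z + 1) by rewrite divr_gt0.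
  have /cvgrPdist_le/(_ _ d0)[s0 _ hs0] := cS.
  have ZS s : (0 < s)%N -> Z * S s <= e' * s%:R `^ sigma + Z * s0%:R.
    move=> sp; have [S0 Ss] := andP (S_bounds s).
    have [s0s|ss0] := leqP s0 s.
      have := hs0 s s0s; rewrite /= sub0r normrN ger0_norm; last first.
        by rewrite mulr_ge0 ?invr_ge0 ?powR_ge0.
      rewrite mulrC ler_pdivrMr ?powR_gt0 ?ltr0n// => h.
      apply: (@le_trans _ _ (Z * (e' / (Z + 1) * s%:R `^ sigma))).
        by rewrite ler_wpM2l.
      rewrite mulrA ler_wpDr ?mulr_ge0// ler_wpM2r ?powR_ge0//.
      by rewrite mulrA ler_pdivrMr// mulrC ler_pM2l// lerDl.
    apply: ler_wpDl; first by rewrite mulr_ge0 ?powR_ge0// ltW.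
    by apply: ler_wpM2l => //; apply: (le_trans Ss); rewrite ler_nat ltnW.
  pose c := 4 / tau.
  pose A' := ln A + Z * s0%:R + c ^+ 2 / (4 * e').
  pose Dm := Num.max 1 (A' / (2 * e')).
  have Dm0 : 0 < Dm by rewrite lt_max ltr01.
  have DmA : A' / (2 * e') <= Dm by rewrite le_max lexx orbT.
  move: Dm Dm0 DmA => Dm Dm0 DmA.
  (* If the sum s + 1 / eps reaches twice the maximum, then s or 1 / eps reaches it, and the
     corresponding power reaches [Dm]. *)
  exists (2 * Num.max (Dm `^ sigma^-1) (Dm `^ tau^-1)) => s eps sp eps01 hM.
  have /andP[ep0 ep1] := eps01.
  have sR : 0 < s%:R :> R by rewrite ltr0n.
  have ei : 0 < eps^-1 by rewrite invr_gt0.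
  set x := eps `^ (- (tau / 2)).
  have xx : eps `^ (- tau) = x ^+ 2.
    rewrite -powR_mulrn; last exact: powR_ge0.
    by rewrite -powRrM; congr (_ `^ _); field.
  have DD : Dm <= s%:R `^ sigma + eps `^ (- tau).
    have : Num.max (Dm `^ sigma^-1) (Dm `^ tau^-1) <= s%:R \/
           Num.max (Dm `^ sigma^-1) (Dm `^ tau^-1) <= eps^-1.
      set mx := Num.max _ _ in hM *.
      have [h|h] := leP mx s%:R; first by left.
      right; lra.
    rewrite !ge_max => -[/andP[h _]|/andP[_ h]].
      apply: ler_wpDr; first exact: powR_ge0.
      have -> : Dm = (Dm `^ sigma^-1) `^ sigma.
        by rewrite -powRrM mulVf ?gt_eqF// powRr1// ltW.
      by apply: ge0_ler_powR; rewrite ?nnegrE ?powR_ge0 ?(ltW sg0) ?(ltW sR).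
    apply: ler_wpDl; first exact: powR_ge0.
    have -> : Dm = (Dm `^ tau^-1) `^ tau.
      by rewrite -powRrM mulVf ?gt_eqF// powRr1// ltW.
    have -> : eps `^ (- tau) = eps^-1 `^ tau.
      by rewrite -(powR_inv1 (ltW ep0)) -powRrM mulN1r.
    by apply: ge0_ler_powR; rewrite ?nnegrE ?powR_ge0 ?(ltW tau0) ?(ltW ei).
  have lneps := ln_inv_le tau0 eps01; rewrite -/x -/c in lneps.
  have amgm : c * x <= e' * x ^+ 2 + c ^+ 2 / (4 * e').
    have := mulr_ge0 (ltW e'0) (sqr_ge0 (x - c / (2 * e'))).
    have -> : e' * (x - c / (2 * e')) ^+ 2 = e' * x ^+ 2 + c ^+ 2 / (4 * e') - c * x.
      by field; rewrite gt_eqF.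
    by rewrite subr_ge0.
  have hA : A' <= 2 * e' * (s%:R `^ sigma + eps `^ (- tau)).
    have : A' / (2 * e') <= s%:R `^ sigma + eps `^ (- tau).
      by exact: le_trans DmA DD.
    by rewrite ler_pdivrMr ?mulr_gt0// mulrC.
  have := ZS s sp; rewrite xx; rewrite xx in hA.
  have -> : e = 3 * e' by rewrite /e'; field.
  by rewrite /A' in hA; lra.
have DE s eps : (0 < s)%N -> 0 < eps -> 0 < s%:R `^ sigma + eps `^ (- tau).
  by move=> s0 e0; rewrite addr_gt0 ?powR_gt0 ?ltr0n.
apply/fine_cvgP; split.
  exists 0 => // -[s eps] /= [s0 eps01 _].
  have [r -> _] := lne_N_le s0 eps01.
  by rewrite -EFinM.
apply/cvgrPdist_le => e e0; have [M HM] := bound e e0.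
exists M => // -[s eps] /= [s0 eps01 hM]; have /andP[ep0 _] := eps01.
have [r -> /andP[r0 rB]] := lne_N_le s0 eps01.
have D0 := DE s eps s0 ep0.
rewrite -EFinM /= sub0r normrN ger0_norm; last by rewrite mulr_ge0// invr_ge0 ltW.
by rewrite ler_pdivrMr// (le_trans rB)// HM.
Qed.

Lemma PT_criterion :
  (limn_esup (fun s : nat => ((ln s%:R)^-1 * S s)%:E) < +oo)%E -> PT N.
Proof.
rewrite limn_esup_lim (cvg_lim _ (@cvg_esups_inf _ _))// => /ereal_inf_lt[_ [n0 _ <-]] h.
have [B B0 hB] : exists2 B : R, 0 <= B & forall s, (n0 <= s)%N -> (ln s%:R)^-1 * S s <= B.
  have ub s : (n0 <= s)%N -> (((ln s%:R)^-1 * S s)%:E <= esups (fun s : nat => ((ln s%:R)^-1 * S s)%:E) n0)%E.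
    by move=> ns; apply: ereal_sup_ubound; exists s.
  move: h ub; case: (esups _ n0) => [b| |]// _ ub.
    exists (Num.max b 0); first by rewrite le_max lexx orbT.
    by move=> s /ub; rewrite lee_fin => /le_trans; apply; rewrite le_max lexx.
  by exists 0 => // s /ub.
(* Since ln 1 = 0, the hypothesis says nothing at s = 1. All s below s1 are absorbed in the constant
   through S s <= s. *)
pose s1 := maxn n0 2.
have SB s : (0 < s)%N -> S s <= B * ln s%:R + s1%:R.
  move=> sp; have sR : 1 <= s%:R :> R by rewrite ler1n.
  have [S0 Ss] := andP (S_bounds s).
  have ln0 : 0 <= ln s%:R :> R by rewrite ln_ge0.
  have [s1s|ss1] := leqP s1 s; last first.
    by apply: ler_wpDl; [rewrite mulr_ge0|rewrite (le_trans Ss)// ler_nat ltnW].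
  move: s1s; rewrite geq_max => /andP[n0s s2].
  have lnp : 0 < ln s%:R :> R by rewrite ln_gt0// ltr1n.
  have := hB s n0s; rewrite mulrC ler_pdivrMr// => hs.
  by rewrite (le_trans hs)// lerDl.
exists 2, (Z * B), (A * expR (Z * s1%:R)); split => //.
- by rewrite mulr_ge0.
- by rewrite mulr_ge0 ?expR_ge0// (le_trans ler01).
move=> s eps s0 eps01; apply: (le_trans (N_le s0 eps01)); rewrite lee_fin.
have A0 : 0 < A by apply: lt_le_trans A1.
rewrite -!mulrA ler_pM2l// (mulrC (eps `^ _)) mulrA ler_wpM2r ?powR_ge0//.
have -> : s%:R `^ (Z * B) = expR (Z * (B * ln s%:R)) :> R.
  by rewrite /powR pnatr_eq0 gtn_eqF// mulrA.
by rewrite -expRD ler_expR -mulrDr ler_wpM2l// addrC SB.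
Qed.

End tractability_criteria.

(** * Lower bounds for the complexity and the exponent of SPT *)

Section hermite_complexity.
Context {R : realType}.
Variables (alpha : R) (gamma : nat -> R) (w : R -> nat -> R).
Hypothesis halpha : 1 < alpha.
Hypothesis gamma01 : forall j, 0 < gamma j <= 1.
Hypothesis gamma_noninc : forall i j, (i <= j)%N -> gamma j <= gamma i.
Hypothesis hw : fourier_weight alpha w.

Local Notation N := (fun (eps : R) (s : nat) => inf_compl (prod_weight w gamma (s := s)) eps).

Let alpha_gt0 : 0 < alpha. Proof. exact: lt_trans halpha. Qed.

Lemma weight_gt0 j i : 0 < w (gamma j) i.
Proof.
have [c [C [K [_ _ wb]]]] := weight_bounds halpha hw.
have [w00 _ wup _] := wb _ (gamma01 j).
by case: i => [|i]; [rewrite w00|have /andP[] := wup i.+1 isT].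
Qed.

Lemma weight0 j : w (gamma j) 0%N = 1.
Proof.
by have [c [C [K [_ _ wb]]]] := weight_bounds halpha hw; have [] := wb _ (gamma01 j).
Qed.

Lemma prod_weight_gt0 s (k : s.-tuple nat) : 0 < prod_weight w gamma k.
Proof. by apply: prodr_gt0 => j _; exact: weight_gt0. Qed.

Lemma complexity_ge1 s (eps : R) : (0 < s)%N -> 0 < eps < 1 -> (1 <= N eps s)%E.
Proof.
move=> s0 /andP[e0 e1].
apply: (@inf_compl_ge R s (prod_weight w gamma (s := s)) eps 1 0 (fun=> [tuple 0%N | _ < s])) => //.
- exact: prod_weight_gt0.
- by move=> i j _; rewrite !ord1.
- exact: ltW.
- by rewrite expr_lt1// ltW.
- by move=> _; rewrite /prod_weight big1// => j _; rewrite tnth_mktuple weight0.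
Qed.

Lemma complexity_univariate_ge : exists c K, 0 < c <= 1 /\
  forall n eps, 0 < eps -> eps ^+ 2 < c * (K + n.+1)%:R `^ (- alpha) ->
    (n.+1%:R%:E <= N eps 1%N)%E.
Proof.
have [c [C [K [c0 _ wb]]]] := weight_bounds halpha hw.
have [_ _ _ wlo] := wb _ (gamma01 0%N).
have cg : 0 < c * gamma 0%N by rewrite mulr_gt0//; case/andP: (gamma01 0%N).
(* The cap at 1 keeps the thresholds rho at most 1, as [SPT_count] requires. *)
exists (Num.min 1 (c * gamma 0%N)), K; split; first by rewrite lt_min ltr01 cg ge_min lexx.
move=> n eps e0 erho.
apply: (inf_compl_ge (k := fun i : 'I_n.+1 => [tuple (K + i.+1)%N]) _ _ _ _ erho) => //.
- exact: prod_weight_gt0.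
- by move=> i j /(congr1 (fun t => tnth t ord0)); rewrite !(tnth_nth 0%N)/= => /addnI [] /ord_inj.
- exact: ltW.
- move=> i; rewrite /prod_weight big_ord1 (tnth_nth 0%N)/=.
  apply: le_trans (wlo _ _ _); rewrite ?leq_addr ?addnS//.
  apply: ler_pM; rewrite ?powR_ge0//.
  + by rewrite le_min ler01 ltW.
  + by rewrite ge_min lexx orbT.
  rewrite !powRN lef_pV2 ?posrE ?powR_gt0 ?ltr0n//.
  by apply: ge0_ler_powR; rewrite ?nnegrE// ?(ltW alpha_gt0)// ler_nat ltnS leq_add2l -ltnS.
Qed.

Lemma complexity_unit_ge : exists2 c, 0 < c <= 1 &
  forall j eps, 0 < eps -> eps ^+ 2 < c * gamma j -> (j.+1%:R%:E <= N eps j.+1)%E.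
Proof.
have [c [C [K [c0 _ wb]]]] := weight_bounds halpha hw.
exists (Num.min 1 c); first by rewrite lt_min ltr01 c0 ge_min lexx.
move=> j eps e0 erho.
apply: (inf_compl_ge (k := fun i : 'I_j.+1 => [tuple (l == i : nat) | l < j.+1]) _ _ _ _ erho) => //.
- exact: prod_weight_gt0.
- move=> i i' /(congr1 (fun t => tnth t i)); rewrite !tnth_mktuple eqxx.
  by case: eqP.
- exact: ltW.
- move=> i; rewrite /prod_weight (bigD1 i)//= tnth_mktuple eqxx big1 ?mulr1; last first.
    by move=> l li; rewrite tnth_mktuple (negbTE li) weight0.
  have [_ w1 _ _] := wb _ (gamma01 i); apply: le_trans w1.
  apply: ler_pM; rewrite ?le_min ?ler01 ?(ltW c0)//.
  + by case/andP: (gamma01 j) => /ltW.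
  + by rewrite ge_min lexx orbT.
  + by apply: gamma_noninc; rewrite -ltnS.
Qed.

(** Testing eps^2 = rho / 2 turns a count of indices into a bound on rho. The exponent is relaxed to
    tau' because tau may be 0, while the applications need a positive exponent. *)
Lemma SPT_count (tau tau' C rho : R) n s : SPT_bound N tau C -> 0 <= C -> tau <= tau' ->
  0 < rho <= 1 -> (0 < s)%N ->
  (forall eps, 0 < eps -> eps ^+ 2 < rho -> (n%:R%:E <= N eps s)%E) ->
  n%:R * rho `^ (tau' / 2) <= C * 2 `^ (tau' / 2).
Proof.
move=> hN C0 tt /andP[r0 r1] s0 hn.
pose eps := (rho / 2) `^ 2^-1.
have r20 : 0 < rho / 2 by rewrite divr_gt0.
have e0 : 0 < eps by rewrite powR_gt0.
have e2 : eps ^+ 2 = rho / 2.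
  by rewrite -powR_mulrn ?powR_ge0// -powRrM mulVf// powRr1// ltW.
have e1 : eps < 1 by rewrite -(@expr_lt1 _ 2)// ?(ltW e0)// e2; lra.
have := hN s eps s0; rewrite e0 e1 => /(_ isT) h1.
have : (n%:R%:E <= (C * eps `^ (- tau))%:E)%E by apply: le_trans h1; apply: hn => //; rewrite e2; lra.
rewrite lee_fin => h2.
have : n%:R <= C * eps `^ (- tau').
  apply: (le_trans h2); rewrite ler_wpM2l//; apply: ger_powR; first by rewrite e0 ltW.
  by rewrite lerN2.
have -> : eps `^ (- tau') = 2 `^ (tau' / 2) / rho `^ (tau' / 2).
  rewrite /eps -powRrM mulrN (mulrC 2^-1) powRN powR_div ?(ltW r0)//.
  by rewrite invf_div.
by rewrite mulrA ler_pdivlMr// powR_gt0.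
Qed.

(** If tau < 2 / alpha, a tau' in between makes be = alpha tau' / 2 less than 1. Then n + 1 indices
    with rho of order n^-alpha would bound (n + 1)^(1 - be) uniformly in n. *)
Lemma SPT_bound_ge_alpha (tau C : R) :
  0 <= tau -> 0 <= C -> SPT_bound N tau C -> 2 * alpha^-1 <= tau.
Proof.
move=> t0 C0 hN; rewrite leNgt; apply/negP => ta.
pose tau' := (tau + 2 * alpha^-1) / 2.
have tt : tau <= tau' by rewrite /tau'; lra.
pose h := tau' / 2.
have h0 : 0 < h.
  have : 0 < alpha^-1 by rewrite invr_gt0.
  by rewrite /h /tau'; lra.
pose be := alpha * h.
have be1 : be < 1.
  rewrite /be -(ltr_pM2l (_ : 0 < alpha^-1)) ?invr_gt0// mulKf ?gt_eqF// mulr1.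
  by rewrite /h /tau'; lra.
have be0 : 0 < be by rewrite mulr_gt0.
have [c [K [/andP[c0 c1] hK]]] := complexity_univariate_ge.
pose D := C * 2 `^ h / c `^ h * (K.+1)%:R `^ be.
have key n : n.+1%:R `^ (1 - be) <= D.
  have x0 : 0 < (K + n.+1)%:R :> R by rewrite ltr0n addnS.
  have rho01 : 0 < c * (K + n.+1)%:R `^ (- alpha) <= 1.
    rewrite mulr_gt0 ?powR_gt0//= mulr_ile1 ?powR_ge0 ?(ltW c0)//.
    rewrite powRN invf_le1 ?powR_gt0// -[leLHS](powRr0 (K + n.+1)%:R).
    by apply: ler_powR; [rewrite ler1n addnS|exact: ltW].
  have := @SPT_count tau tau' C _ n.+1 1 hN C0 tt rho01 isT (fun eps e0 e1 => hK n eps e0 e1).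
  rewrite -/h powRM ?powR_ge0 ?(ltW c0)// -powRrM mulNr -/be powRN => h1.
  have n0 : 0 < n.+1%:R :> R by rewrite ltr0n.
  have h2 : n.+1%:R <= C * 2 `^ h / c `^ h * (K + n.+1)%:R `^ be.
    have q0 : 0 < (K + n.+1)%:R `^ be / c `^ h by rewrite divr_gt0 ?powR_gt0.
    move: h1; rewrite -(ler_pM2r q0).
    have cn : c `^ h != 0 by rewrite gt_eqF ?powR_gt0.
    have xn : (K + n.+1)%:R `^ be != 0 :> R by rewrite gt_eqF ?powR_gt0.
    move: (_ `^ be) xn => y yn; move: (c `^ h) cn => z zn.
    have -> : n.+1%:R * (z / y) * (y / z) = n.+1%:R by field; rewrite yn zn.
    by have -> : C * 2 `^ h * (y / z) = C * 2 `^ h / z * y by field.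
  have h3 : (K + n.+1)%:R `^ be <= (K.+1)%:R `^ be * n.+1%:R `^ be :> R.
    rewrite -powRM//; apply: ge0_ler_powR; rewrite ?(ltW be0) ?nnegrE ?mulr_ge0//.
    by rewrite -natrM ler_nat mulSn addnC leq_add2l leq_pmulr.
  have e : n.+1%:R = n.+1%:R `^ (1 - be) * n.+1%:R `^ be :> R.
    rewrite -powRD ?subrK ?powRr1//; by rewrite (gt_eqF n0) implybT.
  have nb : 0 < n.+1%:R `^ be :> R by rewrite powR_gt0.
  rewrite -(ler_pM2r nb) -e; apply: (le_trans h2); rewrite /D -(mulrA (C * 2 `^ h / c `^ h)) ler_wpM2l//.
  by rewrite divr_ge0 ?powR_ge0// mulr_ge0 ?powR_ge0.
have b0 : 0 < 1 - be by rewrite subr_gt0.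
have D0 : 0 <= D by apply: le_trans (key 0%N); exact: powR_ge0.
pose M := (D + 1) `^ (1 - be)^-1.
have := key (Num.truncn M); rewrite leNgt => /negP; apply.
apply: (@lt_le_trans _ _ (D + 1)); first by rewrite ltrDl.
have D10 : 0 <= D + 1 by rewrite addr_ge0.
have -> : D + 1 = M `^ (1 - be) by rewrite /M -powRrM mulVf ?gt_eqF// powRr1.
apply: ge0_ler_powR; rewrite ?nnegrE ?powR_ge0 ?(ltW b0)//.
by apply: ltW; exact: truncnS_gt.
Qed.

Lemma nneseries_le (a : nat -> R) (B : R) : (forall k, 0 <= a k) ->
  (forall n, \sum_(0 <= k < n) a k <= B) -> (\sum_(0 <= k <oo) (a k)%:E <= B%:E)%E.
Proof.
move=> a0 aB; apply: lime_le.
  by apply: is_cvg_nneseries => k _ _; rewrite lee_fin.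
by apply: nearW => n; rewrite sumEFin lee_fin.
Qed.

(** The unit multi-indices give (gamma j)^h <= E / (j + 1), where h is midway between tau / 2 and
    kappa. Raising this to the power kappa / h > 1 yields a convergent series. *)
Lemma SPT_bound_ge_s_gamma (tau C : R) : 0 <= tau -> 0 <= C -> SPT_bound N tau C ->
  (s_gamma gamma <= (tau / 2)%:E)%E.
Proof.
move=> t0 C0 hN; apply/lee_addgt0Pr => e e0; rewrite -EFinD.
set kappa := tau / 2 + e.
have k0 : 0 < kappa by rewrite ltr_wpDl// divr_ge0.
apply: ereal_inf_lbound; exists kappa => //; split => //.
pose tau' := tau / 2 + kappa.
have tt : tau <= tau' by rewrite /tau' /kappa; lra.
pose h := tau' / 2.
have h0 : 0 < h by rewrite /h /tau' divr_gt0// ltr_wpDl// divr_ge0.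
have hk : h < kappa by rewrite /h /tau' /kappa; lra.
have [c /andP[c0 c1] hc] := complexity_unit_ge.
pose E := C * 2 `^ h / c `^ h.
have E0 : 0 <= E by rewrite divr_ge0 ?powR_ge0// mulr_ge0// powR_ge0.
have key j : gamma j `^ h <= E * j.+1%:R^-1.
  have /andP[g0 g1] := gamma01 j.
  have rho01 : 0 < c * gamma j <= 1 by rewrite mulr_gt0//= mulr_ile1// ltW.
  have := @SPT_count tau tau' C _ j.+1 j.+1 hN C0 tt rho01 isT (fun eps e0 e1 => hc j eps e0 e1).
  rewrite -/h powRM ?(ltW c0) ?(ltW g0)// => h1.
  have n0 : 0 < j.+1%:R :> R by rewrite ltr0n.
  have cn : 0 < c `^ h by rewrite powR_gt0.
  rewrite ler_pdivlMr// /E ler_pdivlMr//; apply: le_trans h1.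
  by rewrite mulrAC mulrC mulrA mulrAC -mulrA.
pose r := kappa / h - 1.
have r0 : 0 < r by rewrite subr_gt0 ltr_pdivlMr// mul1r.
apply: (@le_lt_trans _ _ (E `^ (1 + r) * (1 + r^-1))%:E); last by rewrite ltry.
apply: nneseries_le => [k|n]; first exact: powR_ge0.
apply: le_trans (ler_wpM2l (powR_ge0 _ _) (powRN_sum_le n r0)).
rewrite big_add1/= mulr_sumr !big_mkord; apply: ler_sum => j _.
have -> : kappa = h * (1 + r) by rewrite /r; field; rewrite gt_eqF.
have -> : j.+1%:R `^ (- (1 + r)) = (j.+1%:R^-1) `^ (1 + r) :> R.
  by rewrite -(powR_inv1 (ler0n R j.+1)) -powRrM mulN1r.
rewrite powRrM -powRM ?invr_ge0//.
apply: ge0_ler_powR; rewrite ?nnegrE.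
- by rewrite addr_ge0// ltW.
- exact: powR_ge0.
- by rewrite mulr_ge0// invr_ge0.
- exact: key.
Qed.

Lemma SPT_bound_of_series (p : R) : p <= 1 -> 1 < p * alpha ->
  (\sum_(0 <= j <oo) (gamma j `^ p)%:E < +oo)%E ->
  exists2 C, 0 < C & SPT_bound N (2 * p) C.
Proof.
move=> p1 pa fin; have [A [Z [A1 Z0 hZ]]] := complexity_upper halpha hw gamma01 p1 pa.
have A0 : 0 < A by apply: lt_le_trans A1.
set T := (\sum_(0 <= j <oo) _)%E in fin.
have T0 : (0 <= T)%E by apply: nneseries_ge0 => j _ _; rewrite lee_fin powR_ge0.
have fT : T \is a fin_num by rewrite ge0_fin_numE.
exists (A * expR (Z * fine T)); first by rewrite mulr_gt0// expR_gt0.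
move=> s eps s0 e01; apply: (le_trans (hZ s eps s0 e01)); rewrite lee_fin.
rewrite ler_wpM2r ?powR_ge0// ler_pM2l// ler_expR ler_wpM2l//.
rewrite -lee_fin fineK// -sumEFin; apply: nneseries_lim_ge => j _ _.
by rewrite lee_fin powR_ge0.
Qed.

Lemma SPT_bound2 : (\sum_(0 <= j <oo) (gamma j)%:E < +oo)%E -> 
  exists2 C, 0 < C & SPT_bound N 2 C.
Proof.
move=> fin; rewrite -[2](mulr1 2); apply: SPT_bound_of_series; rewrite ?mul1r//.
apply: le_lt_trans fin; apply: lee_nneseries => [j _ _|j _]; first by rewrite lee_fin powR_ge0.
by rewrite powRr1//; case/andP: (gamma01 j) => /ltW.
Qed.

Lemma s_gamma_bounds : (\sum_(0 <= j <oo) (gamma j)%:E < +oo)%E ->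
  (0 <= s_gamma gamma <= 1)%E.
Proof.
move=> fin; apply/andP; split.
  by apply: le_ereal_inf_tmp => _ [k [k0 _] <-]; rewrite lee_fin ltW.
apply: ereal_inf_lbound; exists 1 => //; split => //.
apply: le_lt_trans fin; apply: lee_nneseries => [j _ _|j _]; first by rewrite lee_fin powR_ge0.
by rewrite powRr1//; case/andP: (gamma01 j) => /ltW.
Qed.

Lemma SPT_exponentE : (\sum_(0 <= j <oo) (gamma j)%:E < +oo)%E ->
  SPT_exponent N = (2%:E * maxe (alpha^-1)%:E (s_gamma gamma))%E.
Proof.
move=> fin; have /andP[sg0 sg1] := s_gamma_bounds fin.
apply/eqP; rewrite eq_le; apply/andP; split; last first.
  apply: le_ereal_inf_tmp => _ [tau [t0 [C C0 hN]] <-].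
  rewrite muleC -lee_pdivlMr// ge_max -EFinM.
  rewrite (SPT_bound_ge_s_gamma t0 (ltW C0) hN) andbT lee_fin.
  by rewrite ler_pdivlMr// mulrC (SPT_bound_ge_alpha t0 (ltW C0) hN).
have fs : s_gamma gamma \is a fin_num.
  by rewrite ge0_fin_numE// (le_lt_trans sg1)// ltry.
have [sg sgE] : exists sg, s_gamma gamma = sg%:E by exists (fine (s_gamma gamma)); rewrite fineK.
rewrite sgE in sg0 sg1 *; rewrite -EFin_max -EFinM.
set m := Num.max _ _.
have am : alpha^-1 <= m by rewrite le_max lexx.
have sm : sg <= m by rewrite le_max lexx orbT.
have ai : 0 < alpha^-1 by rewrite invr_gt0.
have ai1 : alpha^-1 < 1 by rewrite invf_lt1.
apply/lee_addgt0Pr => e e0; rewrite -EFinD.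
(* The upper bound requires p <= 1. When the cap is active, the hypothesis gives convergence;
   otherwise p > s_gamma, and gamma <= 1 carries convergence from some kappa < p over to p. *)
pose p := Num.min 1 (m + e / 2).
have p1 : p <= 1 by rewrite ge_min lexx.
have pm : p <= m + e / 2 by rewrite ge_min lexx orbT.
have p0 : alpha^-1 < p by rewrite lt_min ai1/=; lra.
have pa : 1 < p * alpha by rewrite -ltr_pdivrMr// div1r.
have finp : (\sum_(0 <= j <oo) (gamma j `^ p)%:E < +oo)%E.
  have [h|h] := leP 1 (m + e / 2).
    rewrite /p min_l//; apply: le_lt_trans fin.
    apply: lee_nneseries => [j _ _|j _]; first by rewrite lee_fin powR_ge0.
    by rewrite powRr1//; case/andP: (gamma01 j) => /ltW.
  rewrite /p min_r ?(ltW h)//.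
  have : (s_gamma gamma < (m + e / 2)%:E)%E by rewrite sgE lte_fin; lra.
  move=> /ereal_inf_lt[_ [k [k0 fink] <-]]; rewrite lte_fin => km.
  apply: le_lt_trans fink.
  apply: lee_nneseries => [j _ _|j _]; first by rewrite lee_fin powR_ge0.
  by rewrite lee_fin; apply: ger_powR => //; exact: ltW.
have [C C0 hC] := SPT_bound_of_series p1 pa finp.
apply: (@le_trans _ _ (2 * p)%:E); last by rewrite lee_fin; lra.
apply: ereal_inf_lbound; exists (2 * p) => //; split; last by exists C.
by rewrite mulr_ge0// ltW// (lt_trans ai).
Qed.

End hermite_complexity.

Theorem theorem20 (R : realType) (alpha : R) (gamma : nat -> R)
    (w : R -> nat -> R)
    (halpha : 1 < alpha)
    (hgamma1 : gamma 0%N <= 1)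
    (hgamma_noninc : forall j : nat, gamma j.+1 <= gamma j)
    (hgamma_pos : forall j : nat, 0 < gamma j)
    (hw : fourier_weight alpha w) :
  let N := fun (eps : R) (s : nat) => inf_compl (prod_weight w gamma (s := s)) eps in
  [/\ (\sum_(0 <= j <oo) (gamma j)%:E < +oo)%E ->
        SPT N /\
        SPT_exponent N = (2%:E * maxe (alpha^-1)%:E (s_gamma gamma))%E,
      (limn_esup (fun s : nat =>
         ((ln s%:R)^-1 * \sum_(0 <= j < s) gamma j)%:E) < +oo)%E ->
        PT N,
      (fun s : nat => s%:R^-1 * \sum_(0 <= j < s) gamma j) @ \oo --> (0 : R) ->
        WT N,
      forall sigma : R, 0 < sigma <= 1 ->
        (fun s : nat => (s%:R `^ sigma)^-1 * \sum_(0 <= j < s) gamma j) @ \oo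
          --> (0 : R) ->
        forall tau : R, 0 < tau -> stWT N sigma tau &
      (forall sigma : R, 0 < sigma <= 1 ->
        (fun s : nat => (s%:R `^ sigma)^-1 * \sum_(0 <= j < s) gamma j) @ \oo
          --> (0 : R)) ->
        UWT N].
Proof.
have ni i j : (i <= j)%N -> gamma j <= gamma i.
  by move=> /subnK <-; elim: (j - i)%N => [|k IH]; [by rewrite add0n|exact: le_trans (hgamma_noninc _) IH].
have g01 j : 0 < gamma j <= 1 by rewrite hgamma_pos (le_trans (ni 0%N j _)).
have [|A [Z [A1 Z0 hZ]]] := complexity_upper halpha hw g01 (lexx 1); first by rewrite mul1r.
pose S s := \sum_(0 <= j < s) gamma j.
have Sb s : 0 <= S s <= s%:R.
  rewrite /S sumr_ge0/= => [|j _]; last exact: ltW.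
  rewrite -[X in _ <= X%:R]card_ord -sum1_card natr_sum big_mkord.
  by apply: ler_sum => j _; case/andP: (g01 j).
move=> N.
have N1 s eps : (0 < s)%N -> 0 < eps < 1 -> (1 <= N eps s)%E.
  by move=> s0 e01; exact: (complexity_ge1 halpha g01 hw).
have NA s eps : (0 < s)%N -> 0 < eps < 1 ->
    (N eps s <= (A * expR (Z * S s) * eps `^ (- 2))%:E)%E.
  move=> s0 e01; have := hZ s eps s0 e01; rewrite mulr1.
  rewrite (eq_bigr gamma)// => j _; rewrite powRr1//; exact: ltW.
split.
- move=> fin; split; last exact: SPT_exponentE.
  by have [C C0 hC] := SPT_bound2 halpha g01 hw fin; exists 2, C; split => //; exact: ltW.
- exact: (PT_criterion A1 Z0 Sb NA).
- move=> h; apply: (stWT_criterion A1 Z0 Sb N1 NA) => //.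
  by under eq_fun do rewrite powRr1//.
- by move=> sigma /andP[sg0 _] h tau tau0; exact: (stWT_criterion A1 Z0 Sb N1 NA).
- move=> h sigma tau sg /andP[tau0 _]; have /andP[sg0 _] := sg.
  by apply: (stWT_criterion A1 Z0 Sb N1 NA) => //; exact: h.
Qed.
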